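(* Let $d\ge2$ and suppose that $\Gamma$ is a closed subgroup of $\mathbb{R}^d$ of dimension $\dim\Gamma\ge d-1$. There are no Borel $\mathbb{R}^d$-equivariant maps $\xi:\mathcal{M}^+_\Gamma(\mathbb{R}^d)\to\mathcal{SH}_\Gamma(\mathbb{R}^d)$ satisfying $\Delta\xi(\mu)=\mu$ for all $\mu\in\mathcal{M}^+_\Gamma(\mathbb{R}^d)$. If $\dim\Gamma=d-1$, then the argument shift action $\mathbb{R}^d\curvearrowright\mathcal{SH}_\Gamma(\mathbb{R}^d)$ admits a Borel transversal. Furthermore, the only subharmonic functions on $\mathbb{R}^d$ whose stabilizer has dimension $d$ are the constant functions.
   Context: The dimension $\dim\Gamma$ of a closed subgroup of $\mathbb{R}^d$ is the dimension of its linear span. $\mathcal{M}^+(\mathbb{R}^d)$ is the space of positive Radon measures on $\mathbb{R}^d$ with the vague topology (the weakest topology making $\mu\mapsto\int f\,d\mu$ continuous for every compactly supported continuous $f$). $\mathcal{SH}(\mathbb{R}^d)$ is the space of subharmonic functions: upper semicontinuous $u:\mathbb{R}^d\to[-\infty,\infty)$, not identically $-\infty$, with $u(x)$ at most the average of $u$ over the sphere of radius $r$ about $x$ for all $x$ and $r>0$; it is viewed as a subset of $L^1_{\mathrm{loc}}(\mathbb{R}^d)$ with the $L^1_{\mathrm{loc}}$ topology. Both carry the corresponding Borel $\sigma$-algebras. $\Delta$ is the distributional Laplacian, mapping subharmonic functions to positive Radon measures. $\mathbb{R}^d$ acts by argument shifts: $(r\cdot u)(x)=u(x+r)$, $(r\cdot\mu)(A)=\mu(A+r)$.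 $\mathrm{Stab}$ denotes the stabilizer, $\mathcal{M}^+_\Gamma(\mathbb{R}^d)=\{\mu\in\mathcal{M}^+(\mathbb{R}^d):\mathrm{Stab}(\mu)=\Gamma\}$ and $\mathcal{SH}_\Gamma(\mathbb{R}^d)=\{u\in\mathcal{SH}(\mathbb{R}^d):\mathrm{Stab}(u)=\Gamma\}$. A Borel transversal for an action is a Borel set that intersects each orbit in exactly one point. *)

(* Defs.v *)
From HB Require Import structures.
From mathcomp Require Import all_boot all_order all_algebra.
From mathcomp Require Import all_classical all_reals all_analysis.
From mathcomp Require Import measurable_realfun.

Set Implicit Arguments.
Unset Strict Implicit.
Unset Printing Implicit Defensive.

Import Order.TTheory GRing.Theory Num.Theory.
Import numFieldNormedType.Exports.

Local Open Scope classical_set_scope.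
Local Open Scope ring_scope.

Definition borel (T : topologicalType) : set (set T) := <<s @open T >>.
Arguments borel T : clear implicits.

Definition borel_map (T U : topologicalType) (f : T -> U) : Prop :=
  forall B, borel U B -> borel T (f @^-1` B).

Section Actions.
Variables (V : zmodType) (T : Type) (act : V -> T -> T).

Definition stab (x : T) : set V := [set r | act r x = x].

Definition stab_stratum (G : set V) : set T := [set x | stab x = G].

(* [A] is meant to be invariant under the action *)
Definition same_orbit (A : set T) (x y : A) : Prop :=
  exists r, \val y = act r (\val x).
End Actions.

Definition equivariant (V : zmodType) (T U : Type)
    (actT : V -> T -> T) (actU : V -> U -> U) (A : set T) (B : set U)
    (f : A -> B) : Prop :=
  forall (r : V) (x y : A),
    \val y = actT r (\val x) -> \val (f y) = actU r (\val (f x)).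

Definition borel_transversal (V : zmodType) (T : topologicalType)
    (act : V -> T -> T) (A : set T) (S : set A) : Prop :=
  borel A S /\ forall x : A, exists! y : A, S y /\ same_orbit act x y.

Section Subgroups.
Variables (R : realType) (d : nat).
Implicit Types (G : set 'rV[R]_d) (W : {vspace 'rV[R]_d}).

Definition subgroup G : Prop :=
  G 0 /\ forall x y, G x -> G y -> G (x - y).

Definition is_lspan G W : Prop :=
  (forall x, G x -> x \in W) /\
  (forall W', (forall x, G x -> x \in W') -> (W <= W')%VS).

Definition lspan G : {vspace 'rV[R]_d} := xget fullv (is_lspan G).

Lemma lspanP G : is_lspan G (lspan G).
Proof.
suff [W GW] : exists W, is_lspan G W by apply: (xgetPex _ (ex_intro _ W GW)).
pose P n := `[< exists2 W : {vspace 'rV[R]_d},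
  (forall x, G x -> x \in W) & \dim W = n >].
have exP : exists n, P n.
  by exists (\dim {:'rV[R]_d}); apply/asboolP; exists fullv => // x _;
    rewrite memvf.
case: (ex_minnP exP) => m /asboolP[W GW dW] minm; exists W; split=> // W' GW'.
have GI x : G x -> x \in (W :&: W')%VS by move=> Gx; rewrite memv_cap GW ?GW'.
have dI : (\dim W <= \dim (W :&: W'))%N.
  by rewrite dW; apply: minm; apply/asboolP; exists (W :&: W')%VS.
have := eqEdim (W :&: W')%VS W; rewrite capvSl dI /= => /eqP <-.
exact: capvSr.
Qed.

Definition sgdim G : nat := \dim (lspan G).
End Subgroups.

Section Pushforward.
Variables (d d' : measure_display) (T : measurableType d)
  (T' : measurableType d') (R : realFieldType) (m : {measure set T -> \bar R})
  (f : T -> T').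

(* [pushforward], with the measurability proof kept in the term *)
Definition mpush (mf : measurable_fun setT f) : set T' -> \bar R :=
  pushforward m f.

HB.instance Definition _ (mf : measurable_fun setT f) :=
  Measure.copy (mpush mf)
    (measure_function_pushforward__canonical__measure_function_Measure m mf).
End Pushforward.

Section BorelRow.
Variables (R : realType) (d : nat).

HB.instance Definition _ :=
  @isMeasurable.Build (sigma_display (@open 'rV[R]_d)) 'rV[R]_d
    (borel 'rV[R]_d)
    (@sigma_algebra0 _ setT (@open 'rV[R]_d))
    (@sigma_algebraC _ (@open 'rV[R]_d))
    (@sigma_algebra_bigcup _ setT (@open 'rV[R]_d)).

Lemma open_measurable_row (U : set 'rV[R]_d) : open U -> measurable U.
Proof. exact: sub_sigma_algebra. Qed.

Lemma measurable_to_row dd (T : measurableType dd) (f : T -> 'rV[R]_d) :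
  (forall U, open U -> measurable (f @^-1` U)) -> measurable_fun setT f.
Proof.
move=> fU; apply: (@measurability _ _ _ _ _ _ (@open 'rV[R]_d)) => //.
by move=> _ [U oU <-]; rewrite setTI; exact: fU.
Qed.

Definition row_of_tuple (t : d.-tuple (measurableTypeR R)) : 'rV[R]_d :=
  \row_i tnth t i.

Lemma measurable_row_of_tuple : measurable_fun setT row_of_tuple.
Proof.
apply: measurable_to_row => U oU.
pose c (p : 'rV[rat]_d * nat) : set 'rV[R]_d :=
  [set y | forall i, ball (ratr (p.1 0 i) : R) p.2.+1%:R^-1 (y 0 i)].
have cU : U = \bigcup_(p in [set p | c p `<=` U]) c p.
  rewrite predeqE => x; split=> [Ux|[p pU]]; last exact: pU.
  have /nbhs_ballP[e /= e0 eU] : nbhs x U by exact: open_nbhs_nbhs.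
  have [k kP] : exists k : nat, 2 * k.+1%:R^-1 < e.
    have [k _ /(_ k (leqnn k)) kP] :=
      near_infty_natSinv_lt (PosNum (divr_gt0 e0 (ltr0n R 2))).
    by exists k; rewrite mulrC -ltr_pdivlMr.
  have /choice[q qP] : forall i,
      exists q : rat, ball (x 0 i) k.+1%:R^-1 (ratr q : R).
    move=> i; have k0 : (0 : R) < k.+1%:R^-1 by rewrite invr_gt0.
    have [z [zb [q _ qz]]] := @dense_rat R (ball (x 0 i) k.+1%:R^-1)
       (ex_intro _ (x 0 i) (ballxx _ k0)) (ball_open _ _).
    by exists q; rewrite qz.
  exists (\row_i q i, k); last by move=> i /=; rewrite mxE; exact: ball_sym.
  move=> y /= yc; apply: eU; split=> // i j; rewrite ord1.
  have := yc j; rewrite /= mxE => yj.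
  apply: (le_ball (ltW kP)); rewrite mulr_natl mulr2n.
  exact: ball_triangle (qP j) yj.
rewrite cU preimage_bigcup bigcup_mkcond.
apply: countable_bigcupT_measurable => [|p]; first exact: countableP.
case: ifP => _ //.
rewrite (_ : _ @^-1` _ = \bigcap_(i in [set: 'I_d])
    ((@tnth d (measurableTypeR R))^~ i @^-1`
      ball (ratr (p.1 0 i) : R) p.2.+1%:R^-1)).
  apply: fin_bigcap_measurable => // i _.
  rewrite -[X in measurable X]setTI; apply: measurable_tnth => //.
  by rewrite ball_itv; exact: measurable_itv.
rewrite predeqE => t; split=> [ct i _|ct i]; first by have := ct i; rewrite mxE.
by rewrite mxE; exact: ct.
Qed.
End BorelRow.

Section Lebesgue.
Variable R : realType.

Let cons_tuple n (p : measurableTypeR R * n.-tuple (measurableTypeR R)) :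
  n.+1.-tuple (measurableTypeR R) := [tuple of p.1 :: p.2].

Let measurable_cons_tuple n : measurable_fun setT (@cons_tuple n).
Proof. by apply: measurable_cons. Qed.

Fixpoint lebesgue_tuple n :
    {measure set (n.-tuple (measurableTypeR R)) -> \bar R} :=
  if n is n'.+1 then
    mpush (product_measure2 (@lebesgue_measure R) (lebesgue_tuple n'))
      (@measurable_cons_tuple n')
  else dirac [tuple].

(* d-dimensional Lebesgue measure; see [leb_box] *)
Definition leb (d : nat) : set 'rV[R]_d -> \bar R :=
  mpush (lebesgue_tuple d) (@measurable_row_of_tuple R d).

HB.instance Definition _ d := Measure.on (@leb d).

Lemma lebesgue_tuple_box n (A : 'I_n -> set (measurableTypeR R)) :
  (forall i, measurable (A i)) ->
  lebesgue_tuple n [set t | forall i, A i (tnth t i)] =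
  (\prod_i lebesgue_measure (A i))%E.
Proof.
elim: n A => [|n IHn] A mA.
  by rewrite big_ord0 /= diracE mem_set//= => -[].
pose B := [set t : n.-tuple (measurableTypeR R) |
  forall i, A (lift ord0 i) (tnth t i)].
have mB : measurable B.
  rewrite (_ : B = \bigcap_(i in [set: 'I_n])
      ((@tnth n (measurableTypeR R))^~ i @^-1` A (lift ord0 i))).
    apply: fin_bigcap_measurable => // i _.
    by rewrite -[X in measurable X]setTI; exact: measurable_tnth.
  by rewrite predeqE => t; split=> [Bt i _|Bt i]; [exact: Bt|exact: Bt].
rewrite big_ord_recl -IHn // -/B /= /mpush /pushforward.
rewrite (_ : _ @^-1` _ = A ord0 `*` B); first by rewrite product_measure2E.
rewrite predeqE => -[x t]; split=> /= [h|[Ax Bt] i].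
  split; first by have := h ord0; rewrite tnth0.
  by move=> i; have := h (lift ord0 i); rewrite tnthS.
by case: (unliftP ord0 i) => [j|] ->; rewrite ?tnthS ?tnth0 //; exact: Bt.
Qed.

Lemma leb_box d (A : 'I_d -> set (measurableTypeR R)) :
  (forall i, measurable (A i)) ->
  leb [set x : 'rV[R]_d | forall i, A i (x 0 i)] =
  (\prod_i lebesgue_measure (A i))%E.
Proof.
move=> mA; rewrite -lebesgue_tuple_box // /leb /mpush /pushforward.
congr (lebesgue_tuple d _); rewrite predeqE => t.
by split=> h i; have := h i; rewrite mxE.
Qed.
End Lebesgue.
Arguments leb {R d}.

Section TestFunctions.
Variables (R : realType) (d : nat).
Implicit Types (f : 'rV[R]_d -> R) (i : 'I_d).

Definition compactly_supported f : Prop := compact (closure [set x | f x != 0]).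

Definition partial i f : 'rV[R]_d -> R := 'D_(delta_mx 0 i) f.

Fixpoint Ck (k : nat) f : Prop :=
  continuous f /\
  if k is k'.+1 then
    forall i, (forall x, derivable f x (delta_mx 0 i)) /\ Ck k' (partial i f)
  else True.

Definition Cc : set ('rV[R]_d -> R) :=
  [set f | continuous f /\ compactly_supported f].

Definition Cc_smooth : set ('rV[R]_d -> R) :=
  [set f | (forall k, Ck k f) /\ compactly_supported f].

Definition laplacian f : 'rV[R]_d -> R :=
  fun x => \sum_i partial i (partial i f) x.
End TestFunctions.
Arguments Cc : clear implicits.

Section RadonMeasures.
Variables (R : realType) (d : nat).

(* On R^d, Borel measures that are finite on compact sets are automatically
   regular.  MathComp measures are functions on all subsets, with arbitrary
   values outside the sigma-algebra; the last field normalizes these values, so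
   that [=] is equality of measures (see [radon_eqP]). *)
Record radon := Radon {
  radon_meas :> {measure set 'rV[R]_d -> \bar R};
  radon_compact : forall K, compact K -> (radon_meas K < +oo)%E;
  radon_offborel : forall A, ~ measurable A -> radon_meas A = 0%E }.

Lemma radon_eqP (mu nu : radon) :
  (forall A, measurable A -> mu A = nu A) -> mu = nu.
Proof.
case: mu nu => [m cm om] [n cn on] /= mn.
have {mn}mn : m = n.
  apply: eq_measure; apply/funext => A.
  by have [/mn//|nA] := pselect (measurable A); rewrite om // on.
by subst n; congr Radon; exact: Prop_irrelevance.
Qed.

HB.instance Definition _ := gen_eqMixin radon.
HB.instance Definition _ := gen_choiceMixin radon.

(* The vague topology is the weakest topology making [mu |-> \int f dmu]
   continuous for every [f] in [Cc]. *)
HB.instance Definition _ := Topological.copy radon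
  (sup_topology (fun f : Cc R d =>
     Topological.on
       (initial_topology (fun mu : radon => \int[mu]_x \val f x)))).

Lemma continuous_translation (r : 'rV[R]_d) :
  continuous (fun x : 'rV[R]_d => x + r).
Proof.
move=> x A /nbhs_ballP[e /= e0 eA].
apply/nbhs_ballP; exists e => //= y [_ xy]; apply: eA; split=> // i j.
rewrite !mxE; have := xy i j.
by rewrite -!ball_normE /= opprD addrACA subrr addr0.
Qed.

Lemma measurable_translation (r : 'rV[R]_d) :
  measurable_fun setT (fun x : 'rV[R]_d => x + r).
Proof.
apply: measurable_to_row => U oU; apply: open_measurable_row.
by have /continuousP := continuous_translation (r := r); exact.
Qed.

(* [A + r] is the preimage of [A] under [x |-> x - r] *)
Lemma radon_shift_subproof (r : 'rV[R]_d) (mu : radon)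
  (nu := mpush mu (measurable_translation (- r))) :
  (forall K, compact K -> (nu K < +oo)%E) /\
  (forall A, ~ measurable A -> nu A = 0%E).
Proof.
rewrite /nu /mpush /pushforward; split=> [K cK|A nA].
  apply: radon_compact.
  rewrite (_ : _ @^-1` _ = (fun x => x + r) @` K); last first.
    rewrite predeqE => x; split=> [Kx|[y Ky <-]]; last by rewrite /= addrK.
    by exists (x - r) => //; rewrite subrK.
  apply: continuous_compact => //; apply: continuous_subspaceT.
  exact: continuous_translation.
apply: radon_offborel => mA; apply: nA.
have := measurable_translation r measurableT mA; rewrite setTI.
by congr measurable; rewrite predeqE => x /=; rewrite addrK.
Qed.

Definition radon_shift (r : 'rV[R]_d) (mu : radon) : radon :=
  Radon (radon_shift_subproof r mu).1 (radon_shift_subproof r mu).2.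

Lemma radon_shiftE r mu A : radon_shift r mu A = mu [set x + r | x in A].
Proof.
congr (radon_meas mu _); rewrite predeqE => x; split=> [Ax|[y Ay <-]].
  by exists (x - r) => //; rewrite subrK.
by rewrite /= addrK.
Qed.
End RadonMeasures.

Section Subharmonic.
Variables (R : realType) (d : nat).

Definition enorm (x : 'rV[R]_d) : R := Num.sqrt (\sum_i x 0 i ^+ 2).

Definition unit_ball : set 'rV[R]_d := [set y | enorm y <= 1].

(* The normalized surface measure on the unit sphere is the image of the
   normalized Lebesgue measure on the unit ball under [y |-> y / enorm y]. *)
Definition sphere_average (u : 'rV[R]_d -> \bar R) (x : 'rV[R]_d) (r : R) :
    \bar R :=
  (((fine (leb unit_ball))^-1)%:E *
   \int[leb]_(y in unit_ball) u (x + (r / enorm y) *: y)%R)%E.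

Record subharmonic := Subharmonic {
  sh_fun :> 'rV[R]_d -> \bar R;
  sh_lty : forall x, (sh_fun x < +oo)%E;
  sh_usc : lower_semicontinuous (fun x => - sh_fun x)%E;
  sh_not_ninfty : exists x, sh_fun x != -oo%E;
  sh_submean : forall x r, 0 < r -> (sh_fun x <= sphere_average sh_fun x r)%E }.

Lemma subharmonic_eqP (u v : subharmonic) : u =1 v -> u = v.
Proof.
case: u v => [u u1 u2 u3 u4] [v v1 v2 v3 v4] /= /funext uv.
by subst v; congr Subharmonic; exact: Prop_irrelevance.
Qed.

HB.instance Definition _ := gen_eqMixin subharmonic.
HB.instance Definition _ := gen_choiceMixin subharmonic.

(* Subharmonic functions are finite almost everywhere, so that [fine] picks a
   real representative of their class in L^1_loc. *)
Definition L1dist (K : set 'rV[R]_d) (u v : subharmonic) : \bar R :=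
  (\int[leb]_(x in K) `|fine (v x) - fine (u x)|%:E)%E.

Definition L1loc_open (U : set subharmonic) : Prop :=
  forall u, U u -> exists K (e : R),
    [/\ compact K, 0 < e & forall v, (L1dist K u v < e%:E)%E -> U v].

Lemma measurable_sh (u : subharmonic) :
  measurable_fun [set: 'rV[R]_d] (sh_fun u).
Proof.
rewrite (_ : sh_fun u = (fun x => - (- u x))%E); last first.
  by apply/funext => x; rewrite oppeK.
suff mNu : measurable_fun [set: 'rV[R]_d] (fun x => - u x)%E.
  exact: measurableT_comp mNu.
apply: (measurability _ (ErealGenOInfty.measurableE R)).
move=> /= _ [_ [a ->]] <-; rewrite setTI preimage_itvoy.
apply: open_measurable_row.
by have /lower_semicontinuousP := @sh_usc u; apply.
Qed.

Lemma L1dist_subset K K' u v : compact K -> compact K' -> K `<=` K' ->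
  (L1dist K u v <= L1dist K' u v)%E.
Proof.
have cm A : compact A -> measurable (A : set 'rV[R]_d).
  move=> cA; rewrite -[A]setCK; apply: measurableC; apply: open_measurable_row.
  by apply: closed_openC; apply: compact_closed => //; exact: norm_hausdorff.
move=> /cm mK /cm mK' KK'; apply: ge0_subset_integral => //.
apply/measurable_EFinP; apply: measurableT_comp => //.
apply: measurable_funTS; apply: measurable_funB.
  by apply: measurableT_comp => //; exact: measurable_sh.
by apply: measurableT_comp => //; exact: measurable_sh.
Qed.

Lemma L1loc_openT : L1loc_open setT.
Proof. by move=> u _; exists set0, 1; split=> //; exact: compact0. Qed.

Lemma L1loc_openI : setI_closed L1loc_open.
Proof.
move=> U V oU oV u [/oU[K [e [cK e0 KU]]] /oV[K' [e' [cK' e0' KV]]]].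
have cKK' : compact (K `|` K') by exact: compactU.
exists (K `|` K'), (Num.min e e'); split=> //; first by rewrite lt_min e0.
move=> v; rewrite EFin_min lt_min => /andP[ve ve']; split.
  by apply: KU; apply: le_lt_trans ve; apply: L1dist_subset.
by apply: KV; apply: le_lt_trans ve'; apply: L1dist_subset.
Qed.

Lemma L1loc_open_bigU (I : Type) (f : I -> set subharmonic) :
  (forall i, L1loc_open (f i)) -> L1loc_open (\bigcup_i f i).
Proof.
move=> of_ u [i _ /of_[K [e [cK e0 Kf]]]]; exists K, e; split=> // v ve.
by exists i => //; exact: Kf.
Qed.

HB.instance Definition _ := isOpenTopological.Build subharmonic
  L1loc_openT L1loc_openI L1loc_open_bigU.

Lemma sh_shift_usc (u : subharmonic) (r : 'rV[R]_d) :
  lower_semicontinuous (fun x : 'rV[R]_d => - u (x + r)%R)%E.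
Proof.
apply/lower_semicontinuousP => a.
have /lower_semicontinuousP/(_ a) := @sh_usc u.
by apply: (continuousP _).1; exact: continuous_translation.
Qed.

Lemma sh_shift_not_ninfty (u : subharmonic) (r : 'rV[R]_d) :
  exists x, u (x + r) != -oo%E.
Proof.
by have [x ux] := sh_not_ninfty u; exists (x - r); rewrite subrK.
Qed.

Lemma sh_shift_submean (u : subharmonic) (s : 'rV[R]_d) x r : 0 < r ->
  (u (x + s)%R <= sphere_average (fun y => u (y + s)%R) x r)%E.
Proof.
move=> r0; apply: le_trans (@sh_submean u (x + s) r r0) _.
rewrite /sphere_average le_eqVlt; apply/orP; left; apply/eqP.
by congr (_ * _)%E; apply: eq_integral => y _; rewrite addrAC.
Qed.

Definition sh_shift (r : 'rV[R]_d) (u : subharmonic) : subharmonic :=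
  @Subharmonic (fun x => u (x + r)) (fun x => sh_lty u (x + r))
    (@sh_shift_usc u r) (sh_shift_not_ninfty u r) (@sh_shift_submean u r).

(* Delta u = mu in the sense of distributions *)
Definition dist_laplacian (u : subharmonic) (mu : radon R d) : Prop :=
  forall f, Cc_smooth f ->
    \int[leb]_x (fine (u x) * laplacian f x) = \int[mu]_x f x.
End Subharmonic.

Definition radon_stab (R : realType) (d : nat) (G : set 'rV[R]_d) :
  set (radon R d) := stab_stratum (@radon_shift R d) G.

Definition subharmonic_stab (R : realType) (d : nat) (G : set 'rV[R]_d) :
  set (subharmonic R d) := stab_stratum (@sh_shift R d) G.

(* Main.v *)
From HB Require Import structures.
From mathcomp Require Import all_boot all_order all_algebra.
From mathcomp Require Import all_classical all_reals all_analysis.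
From mathcomp Require Import measurable_realfun.
From mathcomp Require Import ring lra.
Require Import Defs.

Set Implicit Arguments.
Unset Strict Implicit.
Unset Printing Implicit Defensive.

Import Order.TTheory GRing.Theory Num.Theory.
Import numFieldNormedType.Exports.

Local Open Scope classical_set_scope.
Local Open Scope ring_scope.

(** Everything rests on two facts about subharmonic functions: they attain their
    maximum over compact sets, by upper semicontinuity, and they satisfy the
    maximum principle ([sh_local_max]).  A closed subgroup [G] is cocompact in
    its linear span ([subgroup_cocompact]), so functions with stabilizer [G]
    behave as if that span were compact.

    If the stabilizer of [u] has dimension [d], then [u] attains a global maximum
    and is constant ([stab_full_dimP]).

    Let the dimension of [G] be [d - 1]; then the span of [G] is the kernel of a
    linear form [tau], and [tau e = 1] for some [e].  For a function [u] with
    stabilizer [G] and a real [c], the parameters [s] such that [u <= c] near the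
    hyperplane [tau = s] form an interval, because a maximum of [u] over a slab
    cannot be attained only inside it ([slab_le_conv]).  Since [u] is not
    constant, for some rational [c] this interval is nonempty and has a finite
    end point ([good_exists]).  Choosing the first such [c] in an enumeration
    gives a Borel real-valued function of [u], the height, which a shift of [u]
    by [r] lowers by [tau r] ([height_shift], [borel_height]).

    For the transversal, the condition that the height is 0 leaves only shifts by
    the span of [G], which act through a compact quotient.  A function is encoded
    by the countably many truth values of [u <= a on a cube] with rational data.
    They are closed conditions for the L^1_loc topology, so by compactness each
    orbit of the span contains exactly one function with lexicographically
    largest code, and having this property is a Borel condition
    ([transversal_exists]).

    For the nonexistence of [xi] in dimension [d - 1], there is a vaguely
    continuous family of measures [mu_th] with stabilizer [G], for [th] on the
    circle of length two pi, such that the shift of [mu_th] by [e] is [mu_(th+1)]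
    ([qp_radon]).  The height of [xi mu_th] is a Borel function [F] on the circle
    with [F (th + 1) = F th - 1].  Since a rotation preserves the measure of the
    circle, the sets [F > n] have the same measure for all integers [n], although
    they decrease to the empty set and increase to the whole circle
    ([no_rotation_height]).  This is impossible.

    In dimension [d], the function [xi mu] is constant, so its Laplacian is zero,
    whereas a measure with a positive periodic density can be chosen for [mu]
    ([no_potential_full_dim]). *)

(** * Lebesgue measure on row vectors *)

Section RowMeasurability.
Variables (R : realType) (d : nat).
Notation rV := 'rV[R]_d.

Lemma closed_measurable_row (A : set rV) : closed A -> measurable A.
Proof.
move=> cA; rewrite -[A]setCK; apply: measurableC.
by apply: open_measurable_row; exact: closed_openC.
Qed.

Lemma compact_measurable_row (A : set rV) : compact A -> measurable A.
Proof.
by move=> cA; apply: closed_measurable_row; apply: compact_closed => //;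
  exact: norm_hausdorff.
Qed.

Lemma measurable_coords dd (T : measurableType dd) (f : T -> rV) :
  (forall i, measurable_fun setT (fun x => f x 0 i : measurableTypeR R)) ->
  measurable_fun setT f.
Proof.
move=> mf.
pose g x : d.-tuple (measurableTypeR R) := [tuple (f x 0 i) | i < d].
have -> : f = @row_of_tuple R d \o g.
  by apply/funext => x; apply/rowP => i; rewrite mxE tnth_mktuple.
apply: measurableT_comp; first exact: measurable_row_of_tuple.
apply/measurable_fun_tnthP => i.
rewrite (_ : _ \o g = fun x => f x 0 i) //.
by apply/funext => x /=; rewrite tnth_mktuple.
Qed.

Lemma continuous_coord (i : 'I_d) : continuous (fun x : rV => x 0 i).
Proof. exact: coord_continuous. Qed.

Lemma continuous_measurable_row (f : rV -> R) : continuous f ->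
  measurable_fun [set: rV] f.
Proof.
move=> cf; apply: (measurability _ (RGenOpens.measurableE R)).
move=> _ [_ [a [b ->]] <-]; rewrite setTI; apply: open_measurable_row.
by move/continuousP : cf; apply; exact: interval_open.
Qed.

Lemma measurable_coord i : measurable_fun [set: rV] (fun x : rV => x 0 i).
Proof. by apply: continuous_measurable_row; exact: continuous_coord. Qed.

Lemma continuous_measurable_row_map (f : rV -> rV) : continuous f ->
  measurable_fun [set: rV] f.
Proof.
move=> cf; apply: measurable_to_row => U oU; apply: open_measurable_row.
by move/continuousP : cf; apply.
Qed.
End RowMeasurability.

Section LebesgueAffine.
Variable R : realType.

Lemma measurable_affine1 (x r : R) :
  measurable_fun setT (fun y : measurableTypeR R => x + r * y : measurableTypeR R).
Proof.
apply: continuous_measurable_fun => y.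
by apply: cvgD; [exact: cvg_cst|apply: cvgM; [exact: cvg_cst|exact: cvg_id]].
Qed.

Lemma lebesgue_measure_affine (x r : R) (A : set (measurableTypeR R)) : 0 < r ->
  measurable A ->
  lebesgue_measure ((fun y => x + r * y) @^-1` A) = (r^-1%:E * lebesgue_measure A)%E.
Proof.
move=> r0 mA; have rg0 : 0 <= r by exact: ltW.
pose m : {measure set measurableTypeR R -> \bar R} :=
  mscale (NngNum rg0) (mpush (@lebesgue_measure R) (measurable_affine1 x r)).
have : lebesgue_measure A = m A.
  apply: (@lebesgue_measure_unique R m) => // X [[a b] _ <-].
  rewrite /m /= /mscale/= /mpush /pushforward /=.
  have -> : (fun y => x + r * y) @^-1` `]a, b] = `] (a - x) / r, (b - x) / r]%classic.
    apply/seteqP; split=> y /=; rewrite !in_itv /= ltr_pdivrMr // ler_pdivlMr //;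
    by rewrite ltrBlDl lerBrDl (mulrC y).
  rewrite !lebesgue_measure_itv /= !lte_fin ltr_pM2r ?invr_gt0 // ltrD2r.
  case: ifP => _; last by rewrite mule0.
  rewrite -!EFinD -EFinM; congr (_%:E).
  by rewrite -mulrBl mulrC -mulrA mulVf ?gt_eqF // mulr1 opprB addrA subrK.
move=> ->; rewrite /m /= /mscale /= /mpush /pushforward muleA -EFinM mulVf ?gt_eqF//.
by rewrite mul1e.
Qed.

Variable d : nat.
Notation rV := 'rV[R]_d.

Definition rbox (A : 'I_d -> set R) : set rV := [set x | forall i, A i (x 0 i)].

Lemma rboxE (A : 'I_d -> set R) :
  rbox A = \bigcap_(i in [set: 'I_d]) ((fun x : rV => x 0 i) @^-1` A i).
Proof.
by apply/seteqP; split=> [x Ax i _|x Ax i]; [exact: Ax|exact: (Ax i)].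
Qed.

Lemma measurable_rbox (A : 'I_d -> set (measurableTypeR R)) : (forall i, measurable (A i)) ->
  measurable (rbox A : set rV).
Proof.
move=> mA; rewrite rboxE; apply: fin_bigcap_measurable => // i _.
by rewrite -[X in measurable X]setTI; apply: measurable_coord => //; exact: mA.
Qed.

Definition rcube (p : 'rV[rat]_d * nat) : set rV :=
  [set y | forall i, ball (ratr (p.1 0 i) : R) p.2.+1%:R^-1 (y 0 i)].

Lemma rcube_basis (U : set rV) x : open U -> U x ->
  exists p, rcube p x /\ rcube p `<=` U.
Proof.
move=> oU Ux.
have /nbhs_ballP[e /= e0 eU] : nbhs x U by exact: open_nbhs_nbhs.
have [k kP] : exists k : nat, 2 * k.+1%:R^-1 < e.
  have [k _ /(_ k (leqnn k)) kP] :=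
    near_infty_natSinv_lt (PosNum (divr_gt0 e0 (ltr0n R 2))).
  by exists k; rewrite mulrC -ltr_pdivlMr.
have /choice[q qP] : forall i,
    exists q : rat, ball (x 0 i) k.+1%:R^-1 (ratr q : R).
  move=> i; have k0 : (0 : R) < k.+1%:R^-1 by rewrite invr_gt0.
  have [z [zb [q _ qz]]] := @dense_rat R (ball (x 0 i) k.+1%:R^-1)
     (ex_intro _ (x 0 i) (ballxx _ k0)) (ball_open _ _).
  by exists q; rewrite qz.
exists (\row_i q i, k); split; first by move=> i /=; rewrite mxE; exact: ball_sym.
move=> y /= yc; apply: eU; split=> // i j; rewrite ord1.
have := yc j; rewrite /= mxE => yj.
apply: (le_ball (ltW kP)); rewrite mulr_natl mulr2n.
exact: ball_triangle (qP j) yj.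
Qed.

Lemma open_rcube p : open (rcube p).
Proof.
rewrite (_ : rcube p = \bigcap_(i in [set: 'I_d])
   ((fun x : rV => x 0 i) @^-1` ball (ratr (p.1 0 i) : R) p.2.+1%:R^-1)); last first.
  by apply/seteqP; split=> [x Ax i _|x Ax i]; [exact: Ax|exact: (Ax i)].
rewrite -bigsetI_fset_set; last exact: finite_finset.
apply: big_ind; first exact: openT.
  move=> *; exact: openI.
move=> i _; move/continuousP: (@continuous_coord R d i); apply; exact: ball_open.
Qed.

Definition leb_boxes : set (set rV) :=
  [set B | exists2 A : 'I_d -> set (measurableTypeR R), (forall i, measurable (A i)) & B = rbox A].

Lemma row_measurable_boxes : @measurable _ rV = <<s leb_boxes >>.
Proof.
apply/seteqP; split; last first.
  apply: smallest_sub; first exact: sigma_algebra_measurable.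
  by move=> _ [A mA ->]; exact: measurable_rbox.
apply: smallest_sub; first exact: smallest_sigma_algebra.
move=> U oU.
have -> : U = \bigcup_(p in [set p | rcube p `<=` U]) rcube p.
  rewrite predeqE => x; split=> [Ux|[p pU]]; last exact: pU.
  by have [p [px pU]] := rcube_basis oU Ux; exists p.
pose T := g_sigma_algebraType leb_boxes.
change (@measurable _ T (\bigcup_(p in [set p | rcube p `<=` U]) rcube p)).
rewrite bigcup_mkcond; apply: countable_bigcupT_measurable => [|p]; first exact: countableP.
case: ifP => _ //; apply: sub_sigma_algebra.
exists (fun i => ball (ratr (p.1 0 i) : R) p.2.+1%:R^-1) => // i.
by rewrite ball_itv; exact: measurable_itv.
Qed.

Definition cubeN (n : nat) : set rV := rbox (fun=> `[- n%:R, n%:R]%classic).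

Lemma measurable_cubeN n : measurable (cubeN n).
Proof. by apply: measurable_rbox => i; exact: measurable_itv. Qed.

Lemma prode_ge0_lty (F : 'I_d -> \bar R) : (forall i, 0 <= F i < +oo)%E ->
  (0 <= \prod_i F i < +oo)%E.
Proof.
move=> F0; apply: (big_ind (fun x => 0 <= x < +oo)%E); first by rewrite lee01 ltry.
  move=> x y /andP[x0 xo] /andP[y0 yo]; rewrite mule_ge0 //= lte_mul_pinfty//.
  by rewrite ge0_fin_numE.
by move=> i _; exact: F0.
Qed.

Lemma leb_cubeN n : (leb (cubeN n) < +oo)%E.
Proof.
rewrite leb_box; last by move=> i; exact: measurable_itv.
apply: (fun H => (andP (prode_ge0_lty H)).2) => i.
rewrite measure_ge0 /= lebesgue_measure_itv /=.
by case: ifP; rewrite ?ltry.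
Qed.

Lemma bigcup_cubeN : \bigcup_n cubeN n = [set: rV].
Proof.
rewrite predeqE => x; split => // _.
pose n := Num.truncn (\sum_i `|x 0 i| : R).
exists n.+1 => // i; rewrite /= in_itv /= -ler_norml.
apply: (@le_trans _ _ (\sum_i `|x 0 i|)).
  by rewrite (bigD1 i) //= lerDl sumr_ge0.
apply/ltW; apply: lt_le_trans (truncnS_gt _) _.
by rewrite ler_nat.
Qed.

(** Boxes are stable under intersection and generate the Borel sets. *)
Lemma row_measure_unique (m1 m2 : {measure set rV -> \bar R}) :
  (forall A : 'I_d -> set (measurableTypeR R), (forall i, measurable (A i)) ->
     m1 (rbox A) = m2 (rbox A)) ->
  (forall n, (m1 (cubeN n) < +oo)%E) ->
  forall A, measurable A -> m1 A = m2 A.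
Proof.
move=> m12 m1oo C mC.
have := @measure_unique _ R 'rV[R]_d leb_boxes cubeN row_measurable_boxes.
move=> /(_ _ _ _ m1 m2); apply => //.
- move=> _ _ [A mA ->] [B mB ->]; exists (fun i => A i `&` B i).
    by move=> i; exact: measurableI.
  by apply/seteqP; split=> x /= => [[Ax Bx] i|AB]; [split=> //| split=> i; case: (AB i)].
- move=> n; exists (fun=> `[- n%:R, n%:R]%classic) => // i; exact: measurable_itv.
- exact: bigcup_cubeN.
- by move=> _ [A mA ->]; exact: m12.
Qed.
End LebesgueAffine.

Section LebesgueRow.
Variables (R : realType) (d : nat).
Notation rV := 'rV[R]_d.

Lemma continuous_affine_row (x : rV) (r : R) : continuous (fun y : rV => x + r *: y).
Proof.
move=> y; apply: (@continuousD _ _ _ (cst x) ( *:%R r)).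
  exact: cst_continuous.
exact: scaler_continuous.
Qed.

Lemma measurable_affine_row (x : rV) (r : R) :
  measurable_fun [set: rV] (fun y : rV => x + r *: y).
Proof. by apply: continuous_measurable_row_map; exact: continuous_affine_row. Qed.

Lemma leb_affine (x : rV) (r : R) (A : set rV) : 0 < r -> measurable A ->
  leb ((fun y => x + r *: y) @^-1` A) = (((r^-1) ^+ d)%:E * leb A)%E.
Proof.
move=> r0 mA; have rg0 : 0 <= r^-1 ^+ d by rewrite exprn_ge0 // invr_ge0 ltW.
pose m1 : {measure set rV -> \bar R} := mpush (@leb R d) (measurable_affine_row x r).
pose m2 : {measure set rV -> \bar R} := mscale (NngNum rg0) (@leb R d).
suff : m1 A = m2 A by [].
have m12 : forall A : 'I_d -> set (measurableTypeR R), (forall i, measurable (A i)) ->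
    m1 (rbox A) = m2 (rbox A).
  move=> B mB; rewrite /m1 /m2 /= /mscale /= /mpush /pushforward.
  rewrite leb_box //.
  transitivity (leb [set y : rV | forall i, ((fun z => x 0 i + r * z) @^-1` B i) (y 0 i)]).
    by congr leb; apply/seteqP; split => y /= h i; have := h i; rewrite !mxE.
  rewrite (@leb_box R d (fun i => (fun z => x 0 i + r * z) @^-1` B i)); last first.
    move=> i; rewrite -[X in measurable X]setTI; exact: measurable_affine1.
  under eq_bigr do rewrite lebesgue_measure_affine //.
  by rewrite big_split /= prodEFin prodr_const card_ord.
apply: row_measure_unique => // n.
rewrite m12; last by move=> i; exact: measurable_itv.
by rewrite /m2 /= /mscale /= lte_mul_pinfty //= leb_cubeN.
Qed.

Lemma leb_translate (x : rV) (A : set rV) : measurable A ->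
  leb ((fun y => y + x) @^-1` A) = leb A.
Proof.
move=> mA; have := leb_affine x ltr01 mA; rewrite invr1 expr1n mul1e => <-.
by congr leb; apply/seteqP; split => y /=; rewrite scale1r addrC.
Qed.

Lemma leb_affine_null (x : rV) (r : R) (A : set rV) : 0 < r -> measurable A ->
  leb A = 0%E -> leb ((fun y => x + r *: y) @^-1` A) = 0%E.
Proof. by move=> r0 mA A0; rewrite leb_affine // A0 mule0. Qed.

Lemma leb_bounded (A : set rV) : bounded_set A -> measurable A -> (leb A < +oo)%E.
Proof.
move=> [M [Mreal MA]] mA.
pose n := (Num.truncn `|M|).+2.
apply: le_lt_trans (leb_cubeN R d n); apply: le_measure; rewrite ?inE //.
  exact: measurable_cubeN.
move=> x Ax i; rewrite /= in_itv /= -ler_norml.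
have Mn : M < n%:R.
  apply: le_lt_trans (ler_norm M) _; apply: lt_trans (truncnS_gt _) _.
  by rewrite ltr_nat.
apply: le_trans (MA _ Mn _ Ax).
rewrite [leRHS]/Num.Def.normr /= mx_normrE.
by apply: (le_bigmax _ (fun ij : 'I_1 * 'I_d => `|x ij.1 ij.2|) (ord0, i)).
Qed.

Lemma leb_compact (A : set rV) : compact A -> (leb A < +oo)%E.
Proof.
move=> cA; apply: leb_bounded; first exact: compact_bounded.
exact: compact_measurable_row.
Qed.

Lemma leb_open_gt0 (U : set rV) : open U -> U !=set0 -> (0 < leb U)%E.
Proof.
move=> oU [x Ux]; have [p [_ pU]] := rcube_basis oU Ux.
have mp i : measurable (ball (ratr (p.1 0 i) : R) p.2.+1%:R^-1 : set (measurableTypeR R)).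
  by rewrite ball_itv; exact: measurable_itv.
apply: (@lt_le_trans _ _ (leb (rcube p))); last first.
  apply: le_measure => //; rewrite inE; apply: open_measurable_row => //.
  exact: open_rcube.
have -> : leb (rcube p) = _ := leb_box mp.
apply: (big_ind (fun x => 0 < x)%E) => //.
  by move=> *; exact: mule_gt0.
by move=> i _; rewrite lebesgue_measure_ball ?invr_ge0 // lte_fin mulrn_wgt0 // invr_gt0.
Qed.

Lemma leb_sigma_finite : sigma_finite [set: rV] (@leb R d).
Proof.
exists (@cubeN R d); first by rewrite bigcup_cubeN.
by move=> n; split; [exact: measurable_cubeN|exact: leb_cubeN].
Qed.

HB.instance Definition _ :=
  Measure_isSigmaFinite.Build _ _ _ (@leb R d) leb_sigma_finite.

Lemma ge0_integral_translate (x : rV) (f : rV -> \bar R) :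
  measurable_fun setT f -> (forall y, 0 <= f y)%E ->
  (\int[leb]_y f (y + x)%R = \int[leb]_y f y)%E.
Proof.
move=> mf f0.
transitivity (\int[mpush (@leb R d) (measurable_translation x)]_y f y)%E.
  by rewrite -(@ge0_integral_pushforward _ _ _ _ _ _ (measurable_translation x) leb setT f).
by apply: eq_measure_integral => A mA _; exact: leb_translate.
Qed.

Lemma integral_translate (x : rV) (f : rV -> \bar R) :
  measurable_fun setT f ->
  (\int[leb]_y f (y + x)%R = \int[leb]_y f y)%E.
Proof.
move=> mf; rewrite [LHS]integralE [RHS]integralE.
have mx := measurable_translation x.
congr (_ - _)%E.
  rewrite -[RHS](ge0_integral_translate x (measurable_funepos mf) (funepos_ge0 f)).
  by apply: eq_integral => y _; rewrite ?funeposE ?funenegE.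
rewrite -[RHS](ge0_integral_translate x (measurable_funeneg mf) (funeneg_ge0 f)).
by apply: eq_integral => y _; rewrite ?funeposE ?funenegE.
Qed.
End LebesgueRow.

(** * Null sets and spheres *)

Section NullSections.
Context d1 d2 (T1 : measurableType d1) (T2 : measurableType d2) (R : realType).
Variables (m1 : {sigma_finite_measure set T1 -> \bar R})
  (m2 : {sigma_finite_measure set T2 -> \bar R}).

Lemma ge0_integral_eq0 dd (T : measurableType dd) (mu : {measure set T -> \bar R}) (f : T -> \bar R) :
  measurable_fun setT f -> (forall x, 0 <= f x)%E ->
  (\int[mu]_x f x = 0)%E <-> {ae mu, forall x, f x = 0%E}.
Proof.
move=> mf f0.
have -> : (\int[mu]_x f x = \int[mu]_x `|f x|)%E.
  by apply: eq_integral => x _; rewrite gee0_abs.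
rewrite (ae_eq_integral_abs mu measurableT mf).
by split; apply: filterS => x; [exact|move=> + _].
Qed.

Lemma product_measure12 (A : set (T1 * T2)) : measurable A ->
  (m1 \x m2)%E A = (m1 \x^ m2)%E A.
Proof.
by move=> mA; apply: product_measure_unique => // B C mB mC; exact: product_measure2E.
Qed.

(** Both sides say that [A] is null for the product measure. *)
Lemma ae_null_xysection (A : set (T1 * T2)) : measurable A ->
  {ae m1, forall x, m2 (xsection A x) = 0%E} <->
  {ae m2, forall y, m1 (ysection A y) = 0%E}.
Proof.
move=> mA.
have h1 : (m1 \x m2)%E A = 0%E <-> {ae m1, forall x, m2 (xsection A x) = 0%E}.
  by apply: ge0_integral_eq0 => //; exact: measurable_fun_xsection.
have h2 : (m1 \x^ m2)%E A = 0%E <-> {ae m2, forall y, m1 (ysection A y) = 0%E}.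
  by apply: ge0_integral_eq0 => //; exact: measurable_fun_ysection.
by rewrite -h1 -h2 product_measure12.
Qed.
End NullSections.

Lemma measurable_invr (R : realType) :
  measurable_fun [set: measurableTypeR R] (fun x : measurableTypeR R => x^-1 : measurableTypeR R).
Proof.
have -> : [set: measurableTypeR R] = [set 0] `|` ~` [set 0] by rewrite setUv.
apply/measurable_funU => //; first exact: measurableC.
split; first exact: measurable_fun_set1.
apply: open_continuous_measurable_fun.
  by apply: closed_openC; apply: accessible_closed_set1; apply: hausdorff_accessible; exact: norm_hausdorff.
by move=> x /set_mem/eqP x0; exact: inv_continuous.
Qed.

Lemma continuous_sumr (R : realType) (V : normedModType R) (T : topologicalType)
    (I : finType) (F : I -> T -> V) :
  (forall i, continuous (F i)) -> continuous (fun x => \sum_i F i x).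
Proof.
move=> cF x; elim: (index_enum I) => [|i s IHs].
  by under eq_fun do rewrite big_nil; exact: cst_continuous.
by under eq_fun do rewrite big_cons; apply: continuousD; [exact: cF|].
Qed.

Section EuclideanNorm.
Variables (R : realType) (d : nat).
Notation rV := 'rV[R]_d.
Implicit Types x y : rV.

Lemma enorm_ge0 x : 0 <= enorm x. Proof. exact: sqrtr_ge0. Qed.

Lemma enormZ (r : R) x : enorm (r *: x) = `|r| * enorm x.
Proof.
rewrite /enorm; under eq_bigr do rewrite mxE exprMn.
by rewrite -mulr_sumr sqrtrM ?sqr_ge0 // sqrtr_sqr.
Qed.

Lemma coord_le_enorm x i : `|x 0 i| <= enorm x.
Proof.
rewrite -sqrtr_sqr ler_wsqrtr // (bigD1 i) //= lerDl sumr_ge0 // => j _.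
exact: sqr_ge0.
Qed.

Lemma norm_le_enorm x : `|x| <= enorm x.
Proof.
rewrite [leLHS]/Num.Def.normr /= mx_normrE.
by apply: bigmax_le; [exact: enorm_ge0|move=> [i j] _; rewrite ord1; exact: coord_le_enorm].
Qed.

Lemma enorm_eq0 x : enorm x = 0 -> x = 0.
Proof.
move=> x0; apply/rowP => i; rewrite mxE; apply/eqP; rewrite -normr_le0 -x0.
exact: coord_le_enorm.
Qed.

Lemma enorm0 : enorm (0 : rV) = 0.
Proof. by rewrite -(scale0r 0) enormZ normr0 mul0r. Qed.

Lemma continuous_enorm : continuous (@enorm R d).
Proof.
move=> x; rewrite /enorm.
apply: (@continuous_comp _ _ _ (fun x : rV => \sum_i x 0 i ^+ 2) Num.sqrt); last first.
  exact: sqrt_continuous.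
apply: (@continuous_sumr R R^o _ _ (fun i (x : rV) => x 0 i ^+ 2)) => i {}x.
apply: (@continuous_comp _ _ _ (fun x : rV => x 0 i) (fun r => r ^+ 2)).
  exact: continuous_coord.
exact: exprn_continuous.
Qed.

Lemma measurable_enorm : measurable_fun [set: rV] (@enorm R d).
Proof. by apply: continuous_measurable_row; exact: continuous_enorm. Qed.

Lemma compact_closed_ball_row (x : rV) (r : R) : compact [set z | `|z - x| <= r].
Proof.
apply: bounded_closed_compact.
  exists (`|x| + r); split; first exact: num_real.
  move=> M Mxr z /= zr; rewrite -(subrK x z); apply: le_trans (ler_normD _ _) _.
  by apply/ltW; apply: le_lt_trans Mxr; rewrite addrC lerD2l.
rewrite (_ : [set z | _] = (fun z => `|z - x|) @^-1` [set s : R | s <= r]) //.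
apply: preimage_closed; last exact: closed_le.
move=> z _; apply: (@continuous_comp rV rV R (fun z => z - x) (fun z => `|z|)).
  exact: continuous_translation.
exact: (@norm_continuous _ rV).
Qed.

Lemma closed_unit_ball : closed (@unit_ball R d).
Proof.
rewrite (_ : @unit_ball R d = @enorm R d @^-1` [set r | r <= 1]) //.
by apply: preimage_closed => [x _|]; [exact: continuous_enorm|exact: closed_le].
Qed.

Lemma measurable_unit_ball : measurable (@unit_ball R d).
Proof. by apply: closed_measurable_row; exact: closed_unit_ball. Qed.

Lemma leb_unit_ball_lty : (leb (@unit_ball R d) < +oo)%E.
Proof.
apply: leb_bounded; last exact: measurable_unit_ball.
exists 1; split => // M M1 x /= xB; apply: le_trans (norm_le_enorm x) _.
exact: le_trans xB (ltW M1).
Qed.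

Lemma leb_unit_ball_gt0 : (0 < leb (@unit_ball R d))%E.
Proof.
apply: (@lt_le_trans _ _ (leb (@enorm R d @^-1` [set r | r < 1]))).
  apply: leb_open_gt0; last by exists 0; rewrite /= enorm0.
  by apply: open_comp => [x _|]; [exact: continuous_enorm|exact: open_lt].
apply: le_measure; rewrite ?inE; last by move=> x /= /ltW.
  apply: open_measurable_row.
  by apply: open_comp => [x _|]; [exact: continuous_enorm|exact: open_lt].
exact: measurable_unit_ball.
Qed.
End EuclideanNorm.

Lemma ae_lebesgue_inhabited (R : realType) (P : R -> Prop) (a b : R) : a < b ->
  {ae @lebesgue_measure R, forall r, P r} -> exists r, [/\ a < r, r < b & P r].
Proof.
move=> ab [Z [mZ Z0 sZ]]; apply: contrapT => /forallNP H.
have : (@lebesgue_measure R `]a, b[%classic <= lebesgue_measure Z)%E.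
  apply: le_measure; rewrite ?inE //.
  move=> r /=; rewrite in_itv /= => /andP[ar rb]; apply: sZ => Pr.
  by apply: (H r).
rewrite Z0 lebesgue_measure_itv /= lte_fin ab -EFinD lee_fin subr_le0.
by rewrite leNgt ab.
Qed.

Section Polar.
Variables (R : realType) (d : nat).
Notation rV := 'rV[R]_d.
Notation mu1 := (@lebesgue_measure R).

Let scaled (k : R -> rV -> R) (N : set rV) (x : rV) : set (measurableTypeR R * rV) :=
  [set p | [/\ 0 < p.1, unit_ball p.2 & N (x + k p.1 p.2 *: p.2)]].

Let measurable_scaled (k : R -> rV -> R) N x :
  measurable_fun [set: measurableTypeR R * rV] (fun p => k p.1 p.2 : measurableTypeR R) ->
  measurable N -> measurable (scaled k N x).
Proof.
move=> mk mN.
have mphi : measurable_fun [set: measurableTypeR R * rV]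
    (fun p => x + k p.1 p.2 *: p.2 : rV).
  apply: measurable_coords => i; under eq_fun do rewrite 2!mxE.
  apply: measurable_funD; first exact: measurable_cst.
  apply: measurable_funM => //.
  by apply: (measurableT_comp (measurable_coord i)); exact: measurable_snd.
rewrite (_ : scaled k N x = (fst @^-1` [set r : measurableTypeR R | 0 < r]) `&`
  ((snd @^-1` @unit_ball R d) `&` ((fun p => x + k p.1 p.2 *: p.2 : rV) @^-1` N))); last first.
  by apply/seteqP; split => p; [case|case=> ? []].
apply: measurableI; last apply: measurableI.
- rewrite -[X in measurable X]setTI; apply: measurable_fst => //.
  rewrite (_ : [set r | 0 < r] = `]0, +oo[%classic) //.
  by apply/seteqP; split => r; rewrite /= in_itv /= andbT.
- by rewrite -[X in measurable X]setTI; apply: measurable_snd => //; exact: measurable_unit_ball.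
- by rewrite -[X in measurable X]setTI; exact: mphi.
Qed.

Let ray (r : R) (y : rV) := r / enorm y.
Let lin (r : R) (y : rV) := r.

Let mray : measurable_fun [set: measurableTypeR R * rV] (fun p => ray p.1 p.2 : measurableTypeR R).
Proof.
apply: measurable_funM; first exact: measurable_fst.
apply: (measurableT_comp (@measurable_invr R)).
by apply: (measurableT_comp (@measurable_enorm R d)); exact: measurable_snd.
Qed.

Let mlin : measurable_fun [set: measurableTypeR R * rV] (fun p => lin p.1 p.2 : measurableTypeR R).
Proof. exact: measurable_fst. Qed.

(* both sections lie on the ray of [y] and are dilates of each other *)
Let ysection_null N x y : measurable N ->
  (mu1 (ysection (scaled ray N x) y) = 0 <-> mu1 (ysection (scaled lin N x) y) = 0)%E.
Proof.
move=> mN.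
have [y0|y0] := eqVneq (enorm y) 0.
  suff -> : ysection (scaled ray N x) y = ysection (scaled lin N x) y by [].
  rewrite (enorm_eq0 y0); apply/seteqP; split => r; rewrite /ysection /= !inE /scaled /=;
  by rewrite !scaler0.
have yg0 : 0 < (enorm y)^-1 by rewrite invr_gt0 lt_def y0 enorm_ge0.
have mS := measurable_ysection y (measurable_scaled x mlin mN).
suff -> : ysection (scaled ray N x) y =
    (fun r => 0 + (enorm y)^-1 * r) @^-1` ysection (scaled lin N x) y.
  rewrite lebesgue_measure_affine // invrK; split=> [/eqP|->]; last by rewrite mule0.
  by rewrite mule_eq0 eqe (negbTE y0) /= => /eqP.
apply/seteqP; split => r; rewrite /ysection /= !inE /scaled /ray /lin /= add0r.
  by move=> [r0 yB]; rewrite mulrC => h; split => //; rewrite mulr_gt0.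
by move=> [r0 yB]; rewrite mulrC => h; split => //; rewrite pmulr_rgt0 in r0.
Qed.

Definition sphere_pt (x : rV) (r : R) (y : rV) : rV := x + (r / enorm y) *: y.

Let slice N x r : set rV := [set y | unit_ball y /\ N (sphere_pt x r y)].

Let xsection_ray N x r : 0 < r -> xsection (scaled ray N x) r = slice N x r.
Proof.
by move=> r0; apply/seteqP; split => y; rewrite /xsection /= inE /scaled /=; [case|case].
Qed.

Let xsection_neg k N x r : ~~ (0 < r) -> xsection (scaled k N x) r = set0.
Proof.
move=> /negP r0; apply/seteqP; split => y //; rewrite /xsection /= inE /scaled /=.
by case.
Qed.

Lemma measurable_sphere_slice N x r : 0 < r -> measurable N -> measurable (slice N x r).
Proof.
by move=> r0 mN; rewrite -xsection_ray //; apply: measurable_xsection; exact: measurable_scaled.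
Qed.

Lemma measurable_sphere_pt x r : measurable_fun [set: rV] (sphere_pt x r).
Proof.
apply: measurable_coords => i; under eq_fun do rewrite 2!mxE.
apply: measurable_funD; first exact: measurable_cst.
apply: measurable_funM; last exact: measurable_coord.
apply: measurable_funM; first exact: measurable_cst.
by apply: (measurableT_comp (@measurable_invr R)); exact: measurable_enorm.
Qed.

(** Every dilate of [N] about [x] is null, so by Fubini almost every ray meets
    [N] in a null set of dilation factors; on a ray, the radius is a constant
    multiple of the dilation factor, and Fubini in the other order returns to
    spheres.  This replaces a change of variables to polar coordinates. *)
Lemma null_ae_sphere N x : measurable N -> leb N = 0%E ->
  {ae mu1, forall r, 0 < r -> leb [set y | unit_ball y /\ N (sphere_pt x r y)] = 0%E}.
Proof.
move=> mN N0.
have : {ae mu1, forall r, leb (xsection (scaled lin N x) r) = 0%E}.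
  apply: nearW => r; have [r0|r0] := boolP (0 < r); last first.
    by rewrite xsection_neg // measure0.
  apply/eqP; rewrite eq_le measure_ge0 andbT -(leb_affine_null x r0 mN N0).
  apply: le_measure; rewrite ?inE.
  - by apply: measurable_xsection; exact: measurable_scaled.
  - by rewrite -[X in measurable X]setTI; apply: measurable_affine_row.
  - by move=> y; rewrite /xsection /= inE => -[].
rewrite ae_null_xysection; last exact: measurable_scaled.
have : {ae leb, forall y, mu1 (ysection (scaled lin N x) y) = 0%E} ->
    {ae leb, forall y, mu1 (ysection (scaled ray N x) y) = 0%E}.
  by apply: filterS => y h; apply/(ysection_null x y mN).
move=> /[apply]; rewrite -ae_null_xysection; last exact: measurable_scaled.
by apply: filterS => r + r0; rewrite xsection_ray.
Qed.

(** The same exchange read backwards: almost every dilate of [N], cut by the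
    unit ball, is null.  Dilates by arbitrarily large factors give back the
    parts of [N] in balls that exhaust the space. *)
Lemma null_all_spheres N x : measurable N ->
  (forall r, 0 < r -> leb [set y | unit_ball y /\ N (sphere_pt x r y)] = 0%E) ->
  leb N = 0%E.
Proof.
move=> mN N0.
have : {ae mu1, forall r, leb (xsection (scaled ray N x) r) = 0%E}.
  apply: nearW => r; have [r0|r0] := boolP (0 < r); last first.
    by rewrite xsection_neg // measure0.
  by rewrite xsection_ray // N0.
rewrite ae_null_xysection; last exact: measurable_scaled.
have : {ae leb, forall y, mu1 (ysection (scaled ray N x) y) = 0%E} ->
    {ae leb, forall y, mu1 (ysection (scaled lin N x) y) = 0%E}.
  by apply: filterS => y h; apply/(ysection_null x y mN).
move=> /[apply]; rewrite -ae_null_xysection; last exact: measurable_scaled.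
move=> aeN.
have /choice[rho rhoP] : forall n : nat, exists r : R,
    n%:R < r /\ leb (xsection (scaled lin N x) r) = 0%E.
  move=> n; have nn1 : n%:R < n%:R + 1 :> R by rewrite ltrDl.
  by have [r [nr _ r0]] := ae_lebesgue_inhabited nn1 aeN; exists r.
have rho0 n : 0 < rho n by apply: le_lt_trans (rhoP n).1.
pose F n := (fun z => - ((rho n)^-1 *: x) + (rho n)^-1 *: z) @^-1` xsection (scaled lin N x) (rho n).
have mX n : measurable (xsection (scaled lin N x) (rho n)).
  by apply: measurable_xsection; exact: measurable_scaled.
have F0 n : leb (F n) = 0%E.
  by apply: leb_affine_null; [rewrite invr_gt0|exact: mX|exact: (rhoP n).2].
have mF n : measurable (F n).
  by rewrite -[X in measurable X]setTI; apply: measurable_affine_row => //; exact: mX.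
apply/eqP; rewrite eq_le measure_ge0 andbT.
have : (leb N <= \sum_(n <oo) leb (F n))%E.
  apply: measure_sigma_subadditive => // z Nz.
  pose n := Num.truncn (enorm (z - x)).
  exists n.+1 => //; rewrite /F /= /xsection /= inE /scaled /= /lin.
  have -> : - ((rho n.+1)^-1 *: x) + (rho n.+1)^-1 *: z = (rho n.+1)^-1 *: (z - x).
    by rewrite scalerBr addrC.
  split => //.
    rewrite /unit_ball /= enormZ ger0_norm ?invr_ge0 ?(ltW (rho0 _)) //.
    rewrite mulrC ler_pdivrMr // mul1r; apply/ltW.
    by apply: lt_trans (rhoP n.+1).1; exact: truncnS_gt.
  by rewrite scalerA mulfV ?gt_eqF // scale1r addrC subrK.
by rewrite eseries0 // => n _ _; rewrite F0.
Qed.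
End Polar.

(** * Subharmonic functions and the maximum principle *)

Lemma ae_le_integral dd (T : measurableType dd) (R : realType)
    (mu : {measure set T -> \bar R}) (D : set T) (f g : T -> \bar R) :
  measurable D -> measurable_fun D f -> measurable_fun D g ->
  {ae mu, forall x, D x -> (f x <= g x)%E} ->
  (\int[mu]_(x in D) f x <= \int[mu]_(x in D) g x)%E.
Proof.
move=> mD mf mg fg; rewrite [leLHS]integralE [leRHS]integralE leeB //.
  apply: ae_ge0_le_integral => //; [exact: measurable_funepos|exact: measurable_funepos|].
  by apply: filterS fg => x h Dx; rewrite !funeposE ge_max !le_max lexx h // orbT.
apply: ae_ge0_le_integral => //; [exact: measurable_funeneg|exact: measurable_funeneg|].
by apply: filterS fg => x h Dx; rewrite !funenegE ge_max !le_max lexx leeN2 h // orbT.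
Qed.

Lemma bounded_integrable dd (T : measurableType dd) (R : realType)
    (mu : {measure set T -> \bar R}) (D : set T) (f : T -> R) (M : R) :
  measurable D -> (mu D < +oo)%E -> measurable_fun D f ->
  (forall x, D x -> `|f x| <= M) -> mu.-integrable D (EFin \o f).
Proof.
move=> mD muD mf fM; apply/integrableP; split; first exact/measurable_EFinP.
apply: (@le_lt_trans _ _ (\int[mu]_(x in D) (Num.max M 0)%:E)%E).
  apply: ge0_le_integral => //.
  - by apply/measurable_EFinP; exact: measurableT_comp.
  - by move=> x Dx; rewrite lee_fin le_max fM.
rewrite integral_cst // lte_mul_pinfty //.
by rewrite lee_fin le_max lexx orbT.
Qed.

Section SphereBounds.
Variables (R : realType) (d : nat) (u : subharmonic R d).
Notation rV := 'rV[R]_d.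
Notation B := (@unit_ball R d).
Notation volB := (fine (leb B)).

Lemma volB_gt0 : 0 < volB.
Proof. by rewrite fine_gt0 // leb_unit_ball_gt0 leb_unit_ball_lty. Qed.

Lemma volBE : leb B = volB%:E.
Proof. by rewrite fineK // ge0_fin_numE ?leb_unit_ball_lty. Qed.

Lemma measurable_sh_sphere x r : measurable_fun setT (fun y => u (sphere_pt x r y)).
Proof. exact: (measurableT_comp (@measurable_sh _ _ u) (@measurable_sphere_pt _ _ x r)). Qed.

(** A quantitative submean inequality: a drop of [delta] below the ceiling [C]
    on a part [E] of the sphere lowers the mean by [delta] times the proportion
    of [E].  Taking [delta] zero, small or huge gives the essential bounds, the
    maximum principle and finiteness almost everywhere. *)
Lemma sphere_mean_bound (x : rV) (r C delta : R) (E : set rV) : 0 < r ->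
  measurable E -> E `<=` B ->
  leb [set y | B y /\ (C%:E < u (sphere_pt x r y))%E] = 0%E ->
  (forall y, E y -> u (sphere_pt x r y) <= (C - delta)%:E)%E ->
  (u x <= (C - delta * fine (leb E) / volB)%:E)%E.
Proof.
move=> r0 mE EB C0 Ed; have mB := @measurable_unit_ball R d.
have Efin : leb E \is a fin_num.
  rewrite ge0_fin_numE //; apply: le_lt_trans (leb_unit_ball_lty R d).
  by apply: le_measure; rewrite ?inE.
apply: le_trans (@sh_submean _ _ u x r r0) _; rewrite /sphere_average.
have iB : leb.-integrable B (EFin \o cst C).
  apply: (@bounded_integrable _ _ _ leb B _ `|C|) => //; exact: leb_unit_ball_lty.
have i1 : leb.-integrable B (EFin \o \1_E).
  apply: (@bounded_integrable _ _ _ leb B _ 1) => //; first exact: leb_unit_ball_lty.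
  by move=> y _; rewrite indicE; case: (_ \in _); rewrite ?normr1 ?normr0.
have iE : leb.-integrable B (EFin \o (fun y => delta * \1_E y)).
  by apply: (@integrableZl _ _ _ leb B mB delta (EFin \o \1_E)).
apply: (@le_trans _ _ ((volB^-1)%:E * \int[leb]_(y in B) (C - delta * \1_E y)%:E)%E).
  apply: lee_wpmul2l; first by rewrite lee_fin invr_ge0 ltW // volB_gt0.
  apply: ae_le_integral => //.
  - by apply: measurable_funTS; exact: measurable_sh_sphere.
  - by apply/measurable_int/(integrableB mB iB iE).
  - exists [set y | B y /\ (C%:E < u (sphere_pt x r y))%E]; split => //.
      apply: measurableI => //.
      rewrite -[X in measurable X]setTI.
      apply: emeasurable_fun_o_infty => //; exact: measurable_sh_sphere.
    move=> y /= /not_implyP[By /negP]; rewrite -ltNge indicE => ylt; split => //.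
    have [yE|yE] := boolP (y \in E); last by rewrite (negbTE yE) mulr0 subr0 in ylt.
    by move: ylt; rewrite yE mulr1 ltNge Ed // -inE.
under eq_integral do rewrite EFinB.
rewrite (integralB mB iB iE) /= integral_cst //.
under [X in (_ - X)%E]eq_integral do rewrite EFinM.
rewrite integralZl //.
rewrite integral_indic // (setIidl EB).
rewrite [X in (C%:E * X)%E](_ : _ = volB%:E); last exact: volBE.
rewrite [X in (delta%:E * X)%E](_ : _ = (fine (leb E))%:E); last by rewrite fineK.
rewrite -[leLHS]/((volB^-1 * (C * volB - delta * fine (leb E)))%:E) lee_fin.
by have := volB_gt0; move: (volB) => v v0; rewrite le_eqVlt; apply/orP; left; apply/eqP; field; lra.
Qed.

Lemma enorm_sphere_pt (x : rV) (r : R) (y : rV) : 0 <= r -> enorm (sphere_pt x r y - x) <= r.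
Proof.
move=> r0; rewrite /sphere_pt addrC addKr enormZ.
have [->|y0] := eqVneq (enorm y) 0; first by rewrite mulr0.
by rewrite normrM normfV (ger0_norm (enorm_ge0 _)) (ger0_norm r0) -mulrA mulVf // mulr1.
Qed.

Lemma measurable_sh_gt (a : \bar R) : measurable [set x : rV | (a < u x)%E].
Proof.
rewrite -[X in measurable X]setTI; apply: emeasurable_fun_o_infty => //.
exact: measurable_sh.
Qed.

Lemma measurable_sh_le (a : \bar R) : measurable [set x : rV | (u x <= a)%E].
Proof.
rewrite -[X in measurable X]setTI; apply: emeasurable_fun_infty_c => //.
exact: measurable_sh.
Qed.

Lemma measurable_sh_ninfty : measurable [set x : rV | u x = -oo%E].
Proof.
rewrite (_ : [set _ | _] = [set x : rV | (u x <= -oo)%E]); first exact: measurable_sh_le.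
by apply/seteqP; split => z /=; [move=> ->|rewrite leeNy_eq => /eqP].
Qed.

Lemma open_sh_lt (a : R) : open [set x : rV | (u x < a%:E)%E].
Proof.
have /lower_semicontinuousP/(_ (- a)) := @sh_usc _ _ u.
by congr open; apply/seteqP; split => x /=; rewrite EFinN lteN2.
Qed.

Lemma closed_sh_ge (a : R) : closed [set x : rV | (a%:E <= u x)%E].
Proof.
rewrite -openC (_ : ~` _ = [set x : rV | (u x < a%:E)%E]); first exact: open_sh_lt.
by apply/seteqP; split => x /=; rewrite leNgt; [move/negP; rewrite negbK|move=> ->].
Qed.
End SphereBounds.

Lemma exists_ltB_natSinv (R : realType) (a m : R) : a < m ->
  exists n : nat, a < m - n.+1%:R^-1.
Proof.
rewrite -subr_gt0 => am.
have [n _ /(_ n (leqnn n)) nP] := near_infty_natSinv_lt (PosNum am).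
by exists n; rewrite ltrBrDl -ltrBrDr.
Qed.

Lemma exists_rat_between (R : realType) (a b : R) : a < b -> exists q : rat, a < ratr q < b.
Proof.
move=> ab; have [q] := rat_in_itvoo ab.
by rewrite in_itv /= => qab; exists q.
Qed.

Section SubharmonicFacts.
Variables (R : realType) (d : nat) (u : subharmonic R d).
Notation rV := 'rV[R]_d.
Notation B := (@unit_ball R d).

Lemma sh_real x : u x != -oo%E -> exists a : R, u x = a%:E.
Proof. by move: (sh_lty u x); case: (u x) => // a _ _; exists a. Qed.

Lemma sh_rat_between (a : \bar R) x : (a < u x)%E ->
  exists q : rat, (a < (ratr q : R)%:E)%E /\ ((ratr q : R)%:E < u x)%E.
Proof.
move=> ax; have [b xb] : exists b, u x = b%:E.
  by apply: sh_real; rewrite gt_eqF // (le_lt_trans _ ax) // leNye.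
rewrite xb in ax *; move: ax; case: a => [a||_] //.
  by rewrite lte_fin => /exists_rat_between[q /andP[aq qb]]; exists q; rewrite !lte_fin.
have [q /andP[_ qb]] := @exists_rat_between _ (b - 1) b (ltac:(by rewrite ltrBlDr ltrDl)).
by exists q; rewrite ltNyr lte_fin.
Qed.

Lemma sh_compact_bounded (K : set rV) : compact K ->
  exists M : R, forall x, K x -> (u x < M%:E)%E.
Proof.
move=> /compact_near_coveringP cK.
have : \forall n \near \oo, K `<=` (fun x => (u x < (n%:R : R)%:E)%E).
  apply: (cK nat \oo (fun n x => (u x < (n%:R : R)%:E)%E)) => x Kx.
  have [N uN] : exists N : nat, (u x < (N%:R : R)%:E)%E.
    have := sh_lty u x; case: (u x) => [a _||_] //; last by exists 0%N; rewrite ltNyr.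
    exists (Num.truncn `|a|).+1; rewrite lte_fin.
    by apply: le_lt_trans (ler_norm a) _; exact: truncnS_gt.
  near=> x' n => /=.
  apply: (@lt_le_trans _ _ ((N%:R : R)%:E)).
    by near: x'; apply: open_nbhs_nbhs; split => //; exact: open_sh_lt.
  by rewrite lee_fin ler_nat; near: n; exact: nbhs_infty_ge.
by move=> [N _ /(_ N (leqnn N)) KN]; exists N%:R.
Unshelve. all: by end_near. Qed.

(** If the supremum [m] were not attained, the open sets [{u < m - 1/n}] would
    increase to a cover of [K], and one of them would contain [K]. *)
Lemma sh_compact_max (K : set rV) : compact K -> K !=set0 ->
  exists2 y, K y & forall z, K z -> (u z <= u y)%E.
Proof.
move=> cK [x0 Kx0]; apply: contrapT => H.
have [M uM] := sh_compact_bounded cK.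
have nmax y : K y -> exists2 z, K z & (u y < u z)%E.
  move=> Ky; apply: contrapT => Hy; apply: H; exists y => // z Kz.
  by rewrite leNgt; apply/negP => yz; apply: Hy; exists z.
pose S : set \bar R := [set u z | z in K].
have supM : (ereal_sup S <= M%:E)%E.
  by apply: ge_ereal_sup => _ [z Kz <-]; exact/ltW/uM.
have [z0 Kz0 z0gt] := nmax _ Kx0.
have : ereal_sup S \is a fin_num.
  rewrite fin_numE (gt_eqF (lt_le_trans (le_lt_trans _ z0gt) _)) ?leNye //=.
    by rewrite lt_eqF // (le_lt_trans supM) // ltry.
  by apply: ereal_sup_ubound; exists z0.
move/fineK; set m := fine _ => mE.
have um z : K z -> (u z < m%:E)%E.
  move=> Kz; have [w Kw zw] := nmax _ Kz; apply: lt_le_trans zw _.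
  by rewrite mE; apply: ereal_sup_ubound; exists w.
move: (cK) => /compact_near_coveringP ccK.
have : \forall n \near \oo, K `<=` (fun x => (u x < (m - (n.+1%:R)^-1 : R)%:E)%E).
  apply: (ccK nat \oo (fun n x => (u x < (m - (n.+1%:R)^-1 : R)%:E)%E)) => x Kx.
  have [N uN] : exists N : nat, (u x < (m - (N.+1%:R)^-1 : R)%:E)%E.
    have := um x Kx; case: (u x) => [a am||_] //; last by exists 0%N; rewrite ltNyr.
    by have [N NP] := exists_ltB_natSinv am; exists N; rewrite lte_fin.
  near=> x' n => /=.
  apply: (@lt_le_trans _ _ ((m - (N.+1%:R)^-1 : R)%:E)).
    by near: x'; apply: open_nbhs_nbhs; split => //; exact: open_sh_lt.
  rewrite lee_fin lerD2l lerN2 lef_pV2 ?posrE // ler_nat ltnS.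
  by near: n; exact: nbhs_infty_ge.
move=> [N _ /(_ N (leqnn N)) KN].
have : (ereal_sup S <= (m - (N.+1%:R)^-1 : R)%:E)%E.
  by apply: ge_ereal_sup => _ [z Kz <-]; exact/ltW/KN.
by rewrite -mE lee_fin lerBrDr gerDl leNgt invr_gt0 ltr0n.
Unshelve. all: by end_near. Qed.

(** On a sphere about a point [x] where [u] is finite, a part of positive
    measure with value -oo would make the mean smaller than [u x]. *)
Lemma sh_ninfty_null : leb [set x : rV | u x = -oo%E] = 0%E.
Proof.
have [x ux] := sh_not_ninfty u; have [a ua] := sh_real ux.
have mN := measurable_sh_ninfty u.
apply: (null_all_spheres (x := x)) => // r r0.
set E := [set y | _].
have mE : measurable E by exact: measurable_sphere_slice.
have [M uM] := sh_compact_bounded (@compact_closed_ball_row R d x r).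
have sM y : (u (sphere_pt x r y) < M%:E)%E.
  apply: uM => /=; apply: le_trans (norm_le_enorm _) _.
  by apply: enorm_sphere_pt; exact: ltW.
have EB : E `<=` B by move=> y [].
apply/eqP; rewrite eq_le measure_ge0 andbT leNgt; apply/negP => E0.
have Efin : 0 < fine (leb E).
  rewrite fine_gt0 // E0 /=; apply: le_lt_trans (leb_unit_ball_lty R d).
  by apply: le_measure; rewrite ?inE //; exact: measurable_unit_ball.
have vB := volB_gt0 R d.
(* the value that makes the mean bound equal to [a - 1] *)
pose delta := (M - a + 1) * fine (leb B) / fine (leb E).
have := @sphere_mean_bound _ _ u x r M delta E r0 mE EB.
have -> : [set y | B y /\ (M%:E < u (sphere_pt x r y))%E] = set0.
  by apply/seteqP; split => // y [_]; rewrite ltNge (ltW (sM y)).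
rewrite measure0 ua => /(_ erefl).
have -> : M - delta * fine (leb E) / fine (leb B) = a - 1.
  by rewrite /delta mulfVK ?gt_eqF // mulfK ?gt_eqF // opprD opprB addrA addrCA subrr addr0.
have h y : E y -> (u (sphere_pt x r y) <= (M - delta)%:E)%E by move=> [_ /= ->]; exact: leNye.
by move=> /(_ h); rewrite lee_fin lerBrDr gerDl leNgt ltr01.
Qed.

(** The maximum principle.  Equality in the submean inequality at [x] makes the
    set [{u < m}] null on every sphere about [x] inside the ball, hence null in
    the ball; being open, it is empty there. *)
Lemma sh_local_max (x : rV) (r0 m : R) :
  (forall z, enorm (z - x) < r0 -> (u z <= m%:E)%E) -> u x = m%:E ->
  forall z, enorm (z - x) < r0 -> u z = m%:E.
Proof.
move=> um ux.
pose Bx : set rV := [set z | enorm (z - x) < r0].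
have oBx : open Bx.
  rewrite (_ : Bx = (fun z => enorm (z - x)) @^-1` [set s : R | s < r0]) //.
  apply: open_comp; last exact: open_lt.
  move=> z _; apply: (@continuous_comp rV rV R (fun z => z - x) (@enorm R d)).
    exact: continuous_translation.
  exact: continuous_enorm.
pose N := Bx `&` [set z | (u z < m%:E)%E].
have oN : open N by apply: openI => //; exact: open_sh_lt.
suff N0 : leb N = 0%E.
  move=> z zB; apply/eqP; rewrite eq_le um //= leNgt; apply/negP => uz.
  have : (0 < leb N)%E by apply: leb_open_gt0 => //; exists z.
  by rewrite N0 ltxx.
apply: (null_all_spheres (x := x)); first exact: open_measurable_row.
move=> r r_gt0.
have sE y : y != 0 -> enorm (sphere_pt x r y - x) = r.
  move=> y0; rewrite /sphere_pt addrC addKr enormZ normrM normfV.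
  rewrite (ger0_norm (enorm_ge0 _)) gtr0_norm // -mulrA mulVf ?mulr1 //.
  by apply: contra_neq y0; exact: enorm_eq0.
have s0 : sphere_pt x r 0 = x by rewrite /sphere_pt scaler0 addr0.
have [rr0|rr0] := ltP r r0; last first.
  rewrite (_ : [set _ | _] = set0) ?measure0 //; apply/seteqP; split => // y [_ []].
  have [->|y0] := eqVneq y 0; first by rewrite s0 /= ux ltxx.
  by rewrite /Bx /= sE // ltNge rr0.
have mS (A : set rV) : measurable A -> measurable (B `&` (sphere_pt x r @^-1` A)).
  by move=> mA; exact: measurable_sphere_slice.
have E0 n : leb (B `&` (sphere_pt x r @^-1` [set z | (u z <= (m - n.+1%:R^-1)%:E)%E])) = 0%E.
  set E := (B `&` _).
  have mE : measurable E by apply: mS; exact: measurable_sh_le.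
  have EB : E `<=` B by move=> y [].
  have := @sphere_mean_bound _ _ u x r m n.+1%:R^-1 E r_gt0 mE EB.
  have -> : [set y | B y /\ (m%:E < u (sphere_pt x r y))%E] = set0.
    apply/seteqP; split => // y [_]; rewrite ltNge um //.
    by apply: le_lt_trans rr0; apply: enorm_sphere_pt; exact: ltW.
  rewrite measure0 ux => /(_ erefl).
  have h y : E y -> (u (sphere_pt x r y) <= (m - n.+1%:R^-1)%:E)%E by case.
  move=> /(_ h); rewrite lee_fin.
  have n0 : 0 < n.+1%:R^-1 :> R by rewrite invr_gt0.
  rewrite lerBrDr gerDl pmulr_lle0 ?invr_gt0 ?volB_gt0 // pmulr_rle0 // => E0.
  have Efin : leb E \is a fin_num.
    rewrite ge0_fin_numE //; apply: le_lt_trans (leb_unit_ball_lty R d).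
    by apply: le_measure; rewrite ?inE //; exact: measurable_unit_ball.
  by apply/eqP; rewrite eq_le measure_ge0 andbT -(fineK Efin) lee_fin.
pose E n := B `&` (sphere_pt x r @^-1` [set z | (u z <= (m - n.+1%:R^-1)%:E)%E]).
apply/eqP; rewrite eq_le measure_ge0 andbT.
have : (leb (B `&` (sphere_pt x r @^-1` N)) <= \sum_(n <oo) leb (E n))%E.
  apply: measure_sigma_subadditive.
  - by move=> n; apply: mS; exact: measurable_sh_le.
  - by apply: mS; exact: open_measurable_row.
  move=> y [By [_ /= uy]].
  suff [n un] : exists n : nat, (u (sphere_pt x r y) <= (m - n.+1%:R^-1)%:E)%E by exists n.
  move: uy; case: (u _) => [a am||_] //; last by exists 0%N; exact: leNye.
  by have [n nP] := exists_ltB_natSinv am; exists n; rewrite lee_fin ltW.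
by rewrite eseries0 // => n _ _; exact: E0.
Qed.

(** Almost every small sphere about [x] meets the null set where [u > a] in a
    null set, and the submean inequality on one such sphere suffices. *)
Lemma sh_ess_le (U : set rV) (a : R) : open U ->
  leb (U `&` [set z | (a%:E < u z)%E]) = 0%E -> forall x, U x -> (u x <= a%:E)%E.
Proof.
move=> oU N0 x Ux; set N := U `&` _ in N0.
have mN : measurable N.
  by apply: measurableI; [exact: open_measurable_row|exact: measurable_sh_gt].
have /nbhs_ballP[e /= e0 eU] : nbhs x U by exact: open_nbhs_nbhs.
have [r [r0 re rN]] := ae_lebesgue_inhabited e0 (null_ae_sphere x mN N0).
have := @sphere_mean_bound _ _ u x r a 0 set0 r0 measurable0.
rewrite !mul0r !subr0; apply => //.
apply/eqP; rewrite eq_le measure_ge0 andbT -(rN r0).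
apply: le_measure; rewrite ?inE.
- have mg : measurable [set z : rV | (a%:E < u z)%E] by exact: measurable_sh_gt.
  exact: (measurable_sphere_slice x r0 mg).
- exact: (measurable_sphere_slice x r0 mN).
move=> y [By uy]; split => //; split => //; apply: eU.
rewrite -ball_normE /= distrC; apply: le_lt_trans re.
apply: le_trans (norm_le_enorm _) _; apply: enorm_sphere_pt; exact: ltW.
Qed.
End SubharmonicFacts.

(** * The L^1_loc topology *)

Section L1loc.
Variables (R : realType) (d : nat).
Notation rV := 'rV[R]_d.
Notation SH := (subharmonic R d).
Implicit Types (u v w : SH) (K U : set rV).

Lemma measurable_fine_sh u : measurable_fun setT (fun x : rV => fine (u x)).
Proof. by apply: measurableT_comp => //; exact: measurable_sh. Qed.

Lemma measurable_L1dist u v : measurable_fun setT (fun x : rV => `|fine (v x) - fine (u x)|%:E).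
Proof.
apply/measurable_EFinP; apply: measurableT_comp => //.
by apply: measurable_funB; exact: measurable_fine_sh.
Qed.

Lemma L1dist_triangle K u v w : measurable K ->
  (L1dist K u w <= L1dist K u v + L1dist K v w)%E.
Proof.
move=> mK; rewrite /L1dist -ge0_integralD //; last 2 first.
- by apply: measurable_funTS; exact: measurable_L1dist.
- by apply: measurable_funTS; exact: measurable_L1dist.
apply: ge0_le_integral => //.
- by apply: measurable_funTS; exact: measurable_L1dist.
- by apply: emeasurable_funD; apply: measurable_funTS; exact: measurable_L1dist.
move=> x _; rewrite -EFinD lee_fin [leRHS]addrC.
have -> : fine (w x) - fine (u x) = (fine (w x) - fine (v x)) + (fine (v x) - fine (u x)).
  by rewrite addrA subrK.
exact: ler_normD.
Qed.

Lemma L1dist_refl K u : L1dist K u u = 0%E.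
Proof. by rewrite /L1dist integral0_eq // => x _; rewrite subrr normr0. Qed.

Lemma L1dist_nbhs K (e : R) u : compact K -> 0 < e ->
  nbhs u [set v | (L1dist K u v < e%:E)%E].
Proof.
move=> cK e0; apply: open_nbhs_nbhs; split; last by rewrite /= L1dist_refl lte_fin.
move=> v /= uv; have L0 : (0 <= L1dist K u v)%E by apply: integral_ge0.
have Lfin : L1dist K u v \is a fin_num by rewrite ge0_fin_numE // (lt_trans uv) // ltry.
exists K, (e - fine (L1dist K u v)); split => //.
  by rewrite subr_gt0 -lte_fin fineK.
move=> w vw; apply: le_lt_trans (L1dist_triangle u v w (compact_measurable_row cK)) _.
by rewrite addeC -lteBrDr // (lt_le_trans vw) // EFinB fineK.
Qed.

(** Pointwise information that is visible to the L^1_loc topology.  A value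
    above [a] at one point forces [u > a + 1/n] on a subset of [U] of positive
    measure, so a function [v] that is at most [a] on [U] stays at a positive
    distance from [u]. *)
Lemma sh_gt_open_near u U (a : R) : open U -> (exists2 x, U x & (a%:E < u x)%E) ->
  \forall v \near u, exists2 x, U x & (a%:E < sh_fun v x)%E.
Proof.
move=> oU [x0 Ux0 ux0].
have /nbhs_ballP[e /= e0 eU] : nbhs x0 U by exact: open_nbhs_nbhs.
pose K : set rV := [set z | `|z - x0| <= e / 2].
have cK : compact K by exact: compact_closed_ball_row.
have e20 : 0 < e / 2 by rewrite divr_gt0.
pose V : set rV := ball x0 (e / 2).
have oV : open V by exact: ball_open.
have VK : V `<=` K by move=> z; rewrite /V -ball_normE /= distrC => /ltW.
have KU : K `<=` U.
  move=> z zK; apply: eU; rewrite -ball_normE /= distrC; apply: le_lt_trans zK _.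
  by rewrite ltr_pdivrMr // ltr_pMr // ltr1n.
pose E n := V `&` [set z | ((a + n.+1%:R^-1)%:E < u z)%E].
have mE n : measurable (E n).
  by apply: measurableI; [exact: open_measurable_row|exact: measurable_sh_gt].
have [n En] : exists n, leb (E n) != 0%E.
  apply: contrapT => /forallNP H.
  have : (u x0 <= a%:E)%E.
    apply: (sh_ess_le oV); last exact: ballxx.
    apply/eqP; rewrite eq_le measure_ge0 andbT.
    have : (leb (V `&` [set z | (a%:E < u z)%E]) <= \sum_(n <oo) leb (E n))%E.
      apply: measure_sigma_subadditive => //.
        by apply: measurableI; [exact: open_measurable_row|exact: measurable_sh_gt].
      move=> z [Vz /= uz].
      have [b ub] : exists b, u z = b%:E by apply: sh_real; rewrite gt_eqF // (lt_trans _ uz) // ltNyr.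
      move: uz; rewrite ub lte_fin => /exists_ltB_natSinv[n an].
      by exists n => //; split => //=; rewrite ub lte_fin -ltrBrDr.
    rewrite eseries0 // => n _ _; apply/eqP/negPn/negP; exact: H.
  by rewrite leNgt ux0.
have Egt0 : (0 < leb (E n))%E by rewrite lt_def En measure_ge0.
have EK : E n `<=` K by move=> z [/VK].
have mK : measurable K by exact: compact_measurable_row.
have Efin : leb (E n) \is a fin_num.
  rewrite ge0_fin_numE //; apply: le_lt_trans (leb_compact cK).
  by apply: le_measure; rewrite ?inE.
have Ef0 : 0 < fine (leb (E n)) by rewrite -lte_fin fineK.
have d0 : 0 < n.+1%:R^-1 * fine (leb (E n)) by rewrite mulr_gt0 ?invr_gt0.
apply: filterS (L1dist_nbhs u cK d0) => v /= uv.
apply: contrapT => H; move: uv; apply/negP; rewrite -leNgt.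
have va z : U z -> (v z <= a%:E)%E.
  by move=> Uz; rewrite leNgt; apply/negP => av; apply: H; exists z.
pose N := [set z : rV | v z = -oo%E].
have mN : measurable N by exact: measurable_sh_ninfty.
have mEN : measurable (E n `\` N) by exact: measurableD.
have -> : (n.+1%:R^-1 * fine (leb (E n)))%:E =
    (\int[leb]_(x in E n `\` N) (n.+1%:R^-1)%:E)%E.
  rewrite integral_cst // EFinM fineK //; congr (_ * _)%E.
  apply/eqP; rewrite eq_le; apply/andP; split; last first.
    by apply: le_measure; rewrite ?inE // => z [].
  rewrite (le_trans (_ : _ <= leb ((E n `\` N) `|` N))%E) //.
    apply: le_measure; rewrite ?inE //; first exact: measurableU.
    by move=> z Ez; have [Nz|Nz] := pselect (N z); [right|left].
  apply: le_trans (measureU2 _ _ _) _ => //.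
  by rewrite [X in (_ + X)%E](_ : _ = 0%E) ?adde0 //; exact: sh_ninfty_null.
apply: (@le_trans _ _ (\int[leb]_(x in E n `\` N) `|fine (v x) - fine (u x)|%:E)%E).
  apply: ge0_le_integral => //.
    by apply: measurable_funTS; exact: measurable_L1dist.
  move=> z [[Vz /= uz] Nz]; rewrite lee_fin.
  have [b ub] : exists b, u z = b%:E by apply: sh_real; rewrite gt_eqF // (lt_trans _ uz) // ltNyr.
  have [c vc] : exists c, v z = c%:E by apply: sh_real; apply/eqP.
  have := va z (KU _ (VK _ Vz)); rewrite vc lee_fin => ca.
  move: uz; rewrite ub lte_fin /= distrC => ab.
  apply: le_trans (ler_norm _); rewrite lerBrDr; apply: le_trans (ltW ab).
  by rewrite addrC lerD2r.
apply: ge0_subset_integral => //.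
  by apply: measurable_funTS; exact: measurable_L1dist.
by move=> z [/EK].
Qed.

Lemma sh_gt_near_shift u U (a : R) (r0 : rV) : open U ->
  (exists2 x, U x & (a%:E < u (x + r0)%R)%E) ->
  \forall r \near r0 & v \near u, exists2 x, U x & (a%:E < sh_fun v (x + r)%R)%E.
Proof.
move=> oU [x0 Ux0 ux0].
have /nbhs_ballP[e /= e0 eU] : nbhs x0 U by exact: open_nbhs_nbhs.
have e20 : 0 < e / 2 by rewrite divr_gt0.
have oV : open (ball (x0 + r0) (e / 2)) by exact: ball_open.
have nv : \forall v \near u, exists2 z, ball (x0 + r0) (e / 2) z & (a%:E < sh_fun v z)%E.
  by apply: sh_gt_open_near => //; exists (x0 + r0) => //; exact: ballxx.
near=> r v.
have [z zB vz] : exists2 z, ball (x0 + r0) (e / 2) z & (a%:E < sh_fun v z)%E by near: v.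
exists (z - r); last by rewrite subrK.
apply: eU; have rB : ball r0 (e / 2) r by near: r; exact: nbhsx_ballx.
move: rB zB; rewrite -!ball_normE /= => rB zB.
have -> : x0 - (z - r) = (x0 + r0 - z) - (r0 - r).
  by apply/matrixP => i j; rewrite !mxE; ring.
apply: le_lt_trans (ler_normB _ _) _.
by rewrite (splitr e) ltrD.
Unshelve. all: by end_near. Qed.

(** The negation is open jointly in [r] and [v], and the compactness of [K]
    lets the quantifier over [r] preserve this, as in the tube lemma. *)
Lemma closed_ex_shift_le (I : Type) (s : set I) (U : I -> set rV) (a : I -> R) K :
  (forall i, open (U i)) -> compact K ->
  closed [set v : SH | exists2 r, K r & forall i, s i -> forall x, U i x ->
    (v (x + r)%R <= (a i)%:E)%E].
Proof.
move=> oU /compact_near_coveringP cK.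
rewrite -openC openE => u /= uP; rewrite /interior.
pose P (v : SH) (r : rV) := exists2 i, s i & exists2 x, U i x & ((a i)%:E < v (x + r)%R)%E.
have : \forall v \near u, K `<=` P v.
  apply: (cK SH (nbhs u) P) => r Kr.
  have [i si [x Ux ux]] : P u r.
    apply: contrapT => nP; apply: uP; exists r => // i si x Ux.
    by rewrite leNgt; apply/negP => ux; apply: nP; exists i => //; exists x.
  have := sh_gt_near_shift (oU i) (ex_intro2 _ _ x Ux ux).
  by apply: filterS => -[r' v'] /= [y Uy uy]; exists i => //; exists y.
apply: filterS => v KP /= [r Kr h].
have [i si [x Ux ux]] := KP r Kr.
by have := h i si x Ux; rewrite leNgt ux.
Qed.

Lemma closed_sh_le (U : set rV) (a : R) : open U ->
  closed [set v : SH | forall x, U x -> (v x <= a%:E)%E].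
Proof.
move=> oU.
have := @closed_ex_shift_le unit setT (fun=> U) (fun=> a) [set 0] (fun=> oU) (@compact_set1 rV 0).
congr closed; apply/seteqP; split => v /=.
  by move=> [_ ->] h x Ux; rewrite -(addr0 x); exact: (h tt).
by move=> h; exists 0 => // _ _ x Ux; rewrite addr0; exact: h.
Qed.
End L1loc.

(** * Subgroups, their spans and full-dimensional stabilizers *)

Section Lattices.
Variables (R : realType) (d : nat).
Notation rV := 'rV[R]_d.
Implicit Types (G : set rV).

Lemma subgroup_mulrz G : subgroup G -> forall x (n : int), G x -> G (x *~ n).
Proof.
move=> [G0 GB] x n Gx.
have GN y : G y -> G (- y) by move=> Gy; rewrite -sub0r; exact: GB.
have Gn m : G (x *+ m).
  by elim: m => [|m IHm]; rewrite ?mulr0n // mulrSr -[x in _ + x]opprK; apply: GB => //; exact: GN.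
by case: n => m; [rewrite -pmulrn|rewrite NegzE mulrNz -pmulrn; apply: GN].
Qed.

Lemma subgroupD G x y : subgroup G -> G x -> G y -> G (x + y).
Proof.
by move=> [G0 GB] Gx Gy; rewrite -[y]opprK; apply: (GB) => //; rewrite -sub0r; exact: GB.
Qed.

Lemma subgroup_sum G (I : finType) (F : I -> rV) : subgroup G ->
  (forall i, G (F i)) -> G (\sum_i F i).
Proof.
move=> sG GF; apply: big_ind => //; first by case: sG.
by move=> x y; exact: subgroupD.
Qed.

(** A free family of maximal size among those in [G]. *)
Lemma lspan_free_basis G : exists X : seq rV,
  [/\ free X, (forall x, x \in X -> G x) & <<X>>%VS = lspan G].
Proof.
pose P n := `[< exists X : seq rV,
  [/\ free X, (forall x, x \in X -> G x) & size X = n] >].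
have exP : exists n, P n by exists 0%N; apply/asboolP; exists [::]; split => //; exact: nil_free.
have ubP n : P n -> (n <= \dim {:rV})%N.
  move=> /asboolP[X [fX _ <-]]; rewrite -(eqP fX); apply: dimvS; exact: subvf.
case: (ex_maxnP exP ubP) => n /asboolP[X [fX XG sX]] maxn; exists X; split => //.
have [GW minW] := lspanP G.
apply/eqP; rewrite eqEsubv; apply/andP; split.
  by apply/span_subvP => x /XG; exact: GW.
apply: minW => g Gg; apply: contrapT => /negP gX.
have : P n.+1.
  apply/asboolP; exists (g :: X); rewrite free_cons gX fX /= sX; split => //.
  by move=> x; rewrite inE => /orP[/eqP ->|/XG].
by move/maxn; rewrite ltnn.
Qed.

(** Elements of [G] contain a basis of the span; removing the integer parts of
    the coordinates in this basis leads into the image of the unit cube. *)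
Lemma subgroup_cocompact G : subgroup G -> exists K : set rV,
  [/\ compact K, (forall x, K x -> x \in lspan G) &
      forall x, x \in lspan G -> exists2 g, G g & K (x - g)].
Proof.
move=> sG; have [X [fX XG spanX]] := lspan_free_basis G.
pose n := size X; pose Y := in_tuple X.
pose f (a : 'rV[R]_n) : rV := \sum_(i < n) a 0 i *: X`_i.
have cf : continuous f.
  apply: (@continuous_sumr R rV _ _ (fun i (a : 'rV[R]_n) => a 0 i *: X`_i)) => i a.
  apply: (@continuous_comp 'rV[R]_n R^o rV (fun a => a 0 i) (fun r => r *: X`_i)).
    exact: continuous_coord.
  exact: scalel_continuous.
pose box : set 'rV[R]_n := [set v | forall i, `[0, 1]%classic (v 0 i)].
have cbox : compact box by apply: (@rV_compact R n (fun=> `[0, 1]%classic)) => i; exact: segment_compact.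
exists (f @` box); split.
- by apply: continuous_compact => //; exact: continuous_subspaceT.
- move=> _ [a _ <-]; rewrite -spanX; apply: memv_suml => i _; apply: memvZ.
  by apply: memv_span; exact: mem_nth.
move=> x; rewrite -spanX => /(@coord_span _ _ _ Y) xE.
pose c i := coord Y i x.
exists (\sum_(i < n) X`_i *~ Num.floor (c i)).
  apply: subgroup_sum => // i; apply: subgroup_mulrz => //.
  by apply: XG; exact: mem_nth.
exists (\row_i (c i - (Num.floor (c i))%:~R)).
  move=> i; rewrite /= mxE in_itv /= subr_ge0 floor_le /=.
  by rewrite lerBlDr addrC -{2}[1]/(1%:~R) -intrD; apply/ltW; exact: floorD1_gt.
rewrite [in RHS]xE /f -sumrB; apply: eq_bigr => i _.
by rewrite mxE scalerBl scaler_int.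
Qed.
End Lattices.

Section MaximumPrinciple.
Variables (R : realType) (d : nat).
Notation rV := 'rV[R]_d.
Notation SH := (subharmonic R d).

Lemma sh_max_const (u : SH) (y : rV) : (forall z, u z <= u y)%E ->
  exists c : R, forall x, u x = c%:E.
Proof.
move=> umax.
have [m um] : exists m : R, u y = m%:E.
  apply: sh_real; apply/negP => /eqP uy; have [x ux] := sh_not_ninfty u.
  by move: (umax x); rewrite uy leeNy_eq (negbTE ux).
exists m => x; apply: (@sh_local_max _ _ u y (enorm (x - y) + 1)) => //.
  by move=> z _; rewrite -um.
by rewrite ltrDl.
Qed.

Lemma stab_shP (u : SH) r : stab (@sh_shift R d) u r <-> forall x, u (x + r) = u x.
Proof.
split=> [h x|h]; first by rewrite -[in RHS]h.
by apply: subharmonic_eqP => x; exact: h.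
Qed.

Lemma subgroup_stab_sh (u : SH) : subgroup (stab (@sh_shift R d) u).
Proof.
split; first by apply/stab_shP => x; rewrite addr0.
move=> r s /stab_shP ur /stab_shP us; apply/stab_shP => x.
by rewrite -us -addrA subrK ur.
Qed.

Lemma dim_rV : \dim {:rV} = d.
Proof. by rewrite dimvf /dim /= mul1n. Qed.

(** A stabilizer of full dimension is cocompact, so [u] attains its maximum
    over the whole space, and the maximum principle applies. *)
Lemma stab_full_dim_const (u : SH) : sgdim (stab (@sh_shift R d) u) = d ->
  exists c : R, forall x, u x = c%:E.
Proof.
move=> dimd; have sG := subgroup_stab_sh u.
set G := stab _ _ in dimd sG.
have [K [cK _ coK]] := subgroup_cocompact sG.
have full x : x \in lspan G.
  suff -> : lspan G = fullv by exact: memvf.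
  by apply/eqP; rewrite eqEdim subvf /= dim_rV; move: dimd; rewrite /sgdim => ->.
have [y Ky ymax] : exists2 y, K y & forall z, K z -> (u z <= u y)%E.
  by apply: sh_compact_max => //; have [g _ Kg] := coK _ (full 0); exists (0 - g).
apply: (@sh_max_const u y) => z; have [g /stab_shP Gg Kg] := coK _ (full z).
by rewrite -[z](subrK g) Gg; exact: ymax.
Qed.

Lemma stab_const (u : SH) (c : R) : (forall x, u x = c%:E) ->
  stab (@sh_shift R d) u = setT.
Proof. by move=> uc; apply/seteqP; split => // r _; apply/stab_shP => x; rewrite !uc. Qed.

Lemma sgdim_setT : sgdim [set: rV] = d.
Proof.
rewrite /sgdim; suff -> : lspan [set: rV] = fullv by exact: dim_rV.
apply/eqP; rewrite eqEsubv subvf /=; apply/subvP => x _.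
by have [h _] := lspanP [set: rV]; exact: h.
Qed.

Lemma stab_full_dimP (u : SH) :
  sgdim (stab (@sh_shift R d) u) = d <-> exists c : R, forall x, u x = c%:E.
Proof.
split; first exact: stab_full_dim_const.
by move=> [c uc]; rewrite (stab_const uc) sgdim_setT.
Qed.
End MaximumPrinciple.

(** * Borel sets *)

Section BorelSets.
Variable T : topologicalType.
Notation bor := (borel T).

Lemma borel_iff (A B : set T) : (forall x, A x <-> B x) -> bor A -> bor B.
Proof. by move=> AB; rewrite (_ : A = B) //; apply/seteqP; split => x /AB. Qed.

Lemma borel_open (A : set T) : open A -> bor A.
Proof. exact: sub_sigma_algebra. Qed.

Lemma borelC (A : set T) : bor A -> bor (~` A).
Proof. by rewrite -setTD; exact: sigma_algebraCD. Qed.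

Lemma borel_closed (A : set T) : closed A -> bor A.
Proof. by move=> cA; rewrite -[A]setCK; apply: borelC; apply: borel_open; exact: closed_openC. Qed.

Lemma borel0 : bor set0. Proof. exact: sigma_algebra0. Qed.

Lemma borel_bigcup (I : countType) (F : I -> set T) :
  (forall i, bor (F i)) -> bor (\bigcup_i F i).
Proof.
move=> bF.
rewrite (_ : \bigcup_i F i = \bigcup_n (if unpickle n is Some i then F i else set0)).
  apply: sigma_algebra_bigcup => n; case: unpickle => //; exact: borel0.
apply/seteqP; split => [x [i _ Fx]|x [n _]].
  by exists (pickle i) => //; rewrite pickleK.
by case: unpickle => // i Fx; exists i.
Qed.

Lemma borel_bigcap (I : countType) (F : I -> set T) :
  (forall i, bor (F i)) -> bor (\bigcap_i F i).
Proof.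
move=> bF; rewrite -[X in bor X]setCK setC_bigcap; apply: borelC.
by apply: borel_bigcup => i; exact: borelC.
Qed.

Lemma borelU (A B : set T) : bor A -> bor B -> bor (A `|` B).
Proof.
move=> bA bB; rewrite (_ : A `|` B = \bigcup_(b : bool) (if b then A else B)).
  by apply: borel_bigcup => -[].
apply/seteqP; split => x; first by case=> ?; [exists true|exists false].
by move=> [[] _]; [left|right].
Qed.

Lemma borelI (A B : set T) : bor A -> bor B -> bor (A `&` B).
Proof.
move=> bA bB; rewrite -[X in bor X]setCK setCI; apply: borelC.
by apply: borelU; exact: borelC.
Qed.

Lemma borelT : bor setT. Proof. by rewrite -setC0; apply: borelC; exact: borel0. Qed.

Lemma borel_cst (P : Prop) : bor [set _ | P].
Proof.
have [p|np] := pselect P.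
  rewrite (_ : [set _ | P] = setT); first exact: borelT.
  by apply/seteqP; split.
rewrite (_ : [set _ | P] = set0); first exact: borel0.
by apply/seteqP; split.
Qed.

Lemma borel_ex (I : countType) (P : I -> T -> Prop) :
  (forall i, bor [set x | P i x]) -> bor [set x | exists i, P i x].
Proof.
move=> bP; rewrite (_ : [set x | _] = \bigcup_i [set x | P i x]).
  exact: borel_bigcup.
by apply/seteqP; split => x [i]; exists i.
Qed.

Lemma borel_all (I : countType) (P : I -> T -> Prop) :
  (forall i, bor [set x | P i x]) -> bor [set x | forall i, P i x].
Proof.
move=> bP; rewrite (_ : [set x | _] = \bigcap_i [set x | P i x]).
  exact: borel_bigcap.
by apply/seteqP; split => [x h i _|x h i]; [exact: h|exact: (h i)].
Qed.

Lemma borel_imply (P Q : T -> Prop) :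
  bor [set x | P x] -> bor [set x | Q x] -> bor [set x | P x -> Q x].
Proof.
move=> bP bQ; rewrite (_ : [set x | _] = ~` [set x | P x] `|` [set x | Q x]).
  by apply: borelU => //; exact: borelC.
apply/seteqP; split => x /=; last by case.
by have [p|np] := pselect (P x); [right; auto|left].
Qed.
End BorelSets.

Lemma borel_preimage_continuous (T U : topologicalType) (f : T -> U) : continuous f ->
  forall B, borel U B -> borel T (f @^-1` B).
Proof.
move=> cf; pose S := [set B | borel T (f @^-1` B)].
suff h : borel U `<=` S by move=> B /h.
apply: smallest_sub; last first.
  by move=> A oA; apply: borel_open; move/continuousP: cf; exact.
split; rewrite /S /=.
- by rewrite preimage_set0; exact: borel0.
- by move=> A bA; rewrite setTD preimage_setC; exact: borelC.
- by move=> F bF; rewrite preimage_bigcup; exact: borel_bigcup.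
Qed.

(** * Levels of periodic subharmonic functions along a transverse axis *)

Section Transverse.
Variables (R : realType) (d : nat) (G : set 'rV[R]_d).
Notation rV := 'rV[R]_d.

Lemma continuous_scalar (tau : {scalar rV}) : continuous (tau : rV -> R).
Proof.
have -> : (tau : rV -> R) = fun x => \sum_(j < d) x 0 j * tau (delta_mx 0 j).
  by apply/funext => x; rewrite [in LHS](row_sum_delta x) linear_sum; apply: eq_bigr => j _; rewrite linearZ.
apply: (@continuous_sumr R R^o _ _ (fun j (x : rV) => x 0 j * tau (delta_mx 0 j))) => j x.
apply: (@continuousM R rV (fun x : rV => x 0 j) (fun=> tau (delta_mx 0 j))).
  exact: continuous_coord.
exact: cst_continuous.
Qed.

(** The coordinate along [e] in a basis of the span of [G] completed by [e]. *)
Lemma codim1_functional : (0 < d)%N -> sgdim G = d.-1 ->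
  exists (tau : {scalar rV}) (e : rV), tau e = 1 /\ forall x, (x \in lspan G) = (tau x == 0).
Proof.
move=> d0 dG; have [X [fX XG spanX]] := lspan_free_basis G.
have sX : size X = d.-1 by rewrite -(eqP fX) spanX.
have [e eX] : exists e, e \notin lspan G.
  apply: contrapT => /forallNP H.
  have full : lspan G = fullv.
    by apply/eqP; rewrite eqEsubv subvf /=; apply/subvP => x _; have /negP/negPn := H x.
  have : sgdim G = d by rewrite /sgdim full dim_rV.
  by rewrite dG => /eqP; rewrite -{2}(prednK d0) eqn_leq ltnn andbF.
pose Y := [tuple of e :: in_tuple X].
have fY : free Y by rewrite free_cons spanX eX fX.
have spanY x : x \in <<Y>>%VS.
  suff -> : <<Y>>%VS = fullv by exact: memvf.
  apply/eqP; rewrite eqEdim subvf /= dim_rV (eqP fY) /= sX prednK //.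
exists (coord Y ord0), e; split.
  by have := coord_free (@ord0 (size X)) ord0 fY; rewrite eqxx.
have tauX i : (i < size X)%N -> coord Y ord0 X`_i = 0.
  move=> iX; have iX' : (i.+1 < (size X).+1)%N by [].
  by have := coord_free (Ordinal iX') ord0 fY.
move=> x; apply/idP/eqP.
  rewrite -spanX => /(@coord_span _ _ _ (in_tuple X)) ->.
  rewrite linear_sum big1 // => i _; rewrite linearZ /= tauX ?mulr0 //.
move=> tx; rewrite (coord_span (spanY x)) big_ord_recl tx scale0r add0r -spanX.
apply: memv_suml => i _; apply: memvZ; apply: memv_span.
by rewrite lift0 /=; apply: mem_nth; exact: ltn_ord.
Qed.
End Transverse.

Section Slabs.
Variables (R : realType) (d : nat) (tau : {scalar 'rV[R]_d}).
Notation rV := 'rV[R]_d.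
Notation SH := (subharmonic R d).
Implicit Types (u : SH) (c s : R).

(** The positions of the hyperplanes, parallel to the kernel of [tau], in a
    neighborhood of which [u] is at most [c].  Asking for a neighborhood makes
    this an open set of positions, so rational positions determine it, and
    expresses it by conditions on open sets, which the L^1_loc topology sees. *)
Definition slab_le c u : set R :=
  [set s | exists n : nat, forall x, `|tau x - s| < n.+1%:R^-1 -> (u x <= c%:E)%E].

Lemma slab_le_near c u s : slab_le c u s ->
  exists2 e : R, 0 < e & forall s', `|s' - s| < e -> slab_le c u s'.
Proof.
move=> [n un]; exists (n.+1%:R^-1 / 2); first by rewrite divr_gt0 ?invr_gt0.
move=> s' ss'; exists (n.+1 * 2).-1 => x xs'; apply: un.
have -> : tau x - s = (tau x - s') + (s' - s) by rewrite addrA subrK.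
apply: le_lt_trans (ler_normD _ _) _; rewrite [ltRHS]splitr ltrD //.
by move: xs'; rewrite prednK ?muln_gt0 // natrM invfM.
Qed.

Lemma slab_le_shift c u r s : slab_le c (sh_shift r u) s <-> slab_le c u (s + tau r).
Proof.
split=> -[n un]; exists n => x xs /=.
  rewrite -[x](subrK r); apply: un; rewrite raddfB /=.
  by rewrite -addrA -opprD (addrC (tau r)).
by apply: un; rewrite raddfD /= opprD addrACA subrr addr0.
Qed.

Lemma borel_slab_le c s : borel SH [set u | slab_le c u s].
Proof.
apply: borel_ex => n; apply: borel_closed.
apply: (@closed_sh_le R d [set x | `|tau x - s| < n.+1%:R^-1]).
rewrite (_ : [set x | _] = (tau : rV -> R) @^-1` ball s n.+1%:R^-1).
  apply: open_comp => [x _|]; [exact: continuous_scalar|exact: ball_open].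
by apply/seteqP; split => x /=; rewrite -ball_normE /= distrC.
Qed.

Variables (e : rV) (G : set rV).
Hypotheses (sG : subgroup G) (tau_e : tau e = 1)
  (lspanE : forall x, (x \in lspan G) = (tau x == 0)).

Lemma tau_stab g : G g -> tau g = 0.
Proof. by move=> Gg; apply/eqP; rewrite -lspanE; have [h _] := lspanP G; exact: h. Qed.

(** The slab is the product of [lspan G] and the segment from [s0] to [s1] on
    the line of [e], and [G] is cocompact in the first factor. *)
Lemma slab_cocompact (s0 s1 : R) : exists P : set rV, [/\ compact P,
  (forall x, P x -> s0 <= tau x <= s1) &
  (forall x, s0 <= tau x <= s1 -> exists2 g, G g & P (x - g))].
Proof.
have [K [cK KW coK]] := subgroup_cocompact sG.
pose f (p : rV * R^o) := p.1 + p.2 *: e.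
have cf : continuous f.
  move=> p; apply: (@continuousD R rV (rV * R^o)%type fst (fun p => p.2 *: e)).
    exact: cvg_fst.
  apply: (@continuous_comp (rV * R^o)%type R^o rV snd (fun r => r *: e)).
    exact: cvg_snd.
  exact: scalel_continuous.
have cKI : compact (K `*` (`[s0, s1]%classic : set R^o)).
  by apply: compact_setX => //; exact: segment_compact.
have tauK x : K x -> tau x = 0 by move=> /KW; rewrite lspanE => /eqP.
exists (f @` (K `*` `[s0, s1]%classic)); split.
- by apply: continuous_compact => //; exact: continuous_subspaceT.
- move=> x [[k t] [/= Kk]]; rewrite in_itv /= => tI <-.
  by rewrite /f /= raddfD /= linearZ /= tau_e mulr1 (tauK k) // add0r.
move=> x xI; have xW : x - tau x *: e \in lspan G.
  by rewrite lspanE raddfB /= linearZ /= tau_e mulr1 subrr.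
have [g Gg Kg] := coK _ xW.
exists g => //; exists (x - tau x *: e - g, tau x); first by split => //=; rewrite in_itv.
by rewrite /f /= addrAC subrK.
Qed.

Variable u : SH.
Hypothesis Gu : G `<=` stab (@sh_shift R d) u.

Lemma sh_periodic x g : G g -> u (x - g) = u x.
Proof.
by move=> /Gu /stab_shP ug; rewrite -[in RHS](subrK g x) ug.
Qed.

Lemma compact_sh_ge (P : set rV) (a : R) : compact P -> compact (P `&` [set x | (a%:E <= u x)%E]).
Proof.
move=> cP; apply: compact_closedI => //; exact: closed_sh_ge.
Qed.

(** If [u] exceeded [c] between [s0] and [s2], its maximum over the closed slab
    would be attained, by compactness modulo [G], and only inside the slab.
    Among the maximum points take one, [z], with [tau z] largest.  The function
    is constant near [z] by the maximum principle, so a small step along [e]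
    reaches another maximum point further away. *)
Lemma slab_le_conv c s0 s1 s2 : slab_le c u s0 -> slab_le c u s2 ->
  s0 < s1 -> s1 < s2 -> slab_le c u s1.
Proof.
move=> [n0 I0] [n2 I2] s01 s12.
suff H x : s0 <= tau x <= s2 -> (u x <= c%:E)%E.
  have [n nP] := exists_ltB_natSinv s01.
  have [m mP] := exists_ltB_natSinv s12.
  exists (maxn n m) => x; rewrite ltr_norml => /andP[h1 h2]; apply: H.
  have hn : (maxn n m).+1%:R^-1 <= n.+1%:R^-1 :> R.
    by rewrite lef_pV2 ?posrE // ler_nat ltnS leq_maxl.
  have hm : (maxn n m).+1%:R^-1 <= m.+1%:R^-1 :> R.
    by rewrite lef_pV2 ?posrE // ler_nat ltnS leq_maxr.
  move: hn hm nP mP h1 h2; move: (n.+1%:R^-1) (m.+1%:R^-1) ((maxn n m).+1%:R^-1) (tau x).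
  by move=> a b l t *; apply/andP; split; lra.
move=> xI; rewrite leNgt; apply/negP => cux.
have [P [cP PI coP]] := slab_cocompact s0 s2.
have [y Py ymax] : exists2 y, P y & forall z, P z -> (u z <= u y)%E.
  by apply: sh_compact_max => //; have [g _ Pg] := coP _ xI; exists (x - g).
have slabmax z : s0 <= tau z <= s2 -> (u z <= u y)%E.
  by move=> zI; have [g Gg Pg] := coP _ zI; rewrite -(sh_periodic z Gg); exact: ymax.
have cuy : (c%:E < u y)%E by apply: lt_le_trans cux _; exact: slabmax.
have [m um] : exists m, u y = m%:E by apply: sh_real; rewrite gt_eqF // (lt_trans _ cuy) // ltNyr.
have cm : c < m by rewrite -lte_fin -um.
pose A := P `&` [set x | (m%:E <= u x)%E].
have cA : compact A by exact: compact_sh_ge.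
have A0 : A !=set0 by exists y; split => //=; rewrite um.
have [z /[!inE] [[Pz /= uz] zmax]] := compact_EVT_max A0 cA
  (continuous_subspaceT (@continuous_scalar R d tau)).
have /andP[z0 z2] := PI _ Pz.
have uzm : u z = m%:E by apply/eqP; rewrite eq_le uz -um ymax.
have edge s : s = s0 \/ s = s2 -> tau z != s.
  move=> sE; apply/eqP => zs.
  suff : (u z <= c%:E)%E by rewrite uzm lee_fin leNgt cm.
  by case: sE => sE; [apply: I0|apply: I2]; rewrite -sE zs subrr normr0 invr_gt0.
have z0' : s0 < tau z by rewrite lt_neqAle z0 andbT eq_sym; apply: edge; left.
have z2' : tau z < s2 by rewrite lt_neqAle z2 andbT; apply: edge; right.
have [r r0 rP] : exists2 r : R, 0 < r & forall w, enorm (w - z) < r -> s0 <= tau w <= s2.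
  have : nbhs z ((tau : rV -> R) @^-1` `]s0, s2[%classic).
    apply: (@continuous_scalar R d tau z); apply: open_nbhs_nbhs; split.
      exact: interval_open.
    by rewrite /= in_itv /= z0'.
  move/nbhs_ballP => [r /= r0 rP]; exists r => // w wz.
  have := rP w; rewrite -ball_normE /= distrC in_itv /= => h.
  by have /andP[/ltW -> /ltW ->] := h (le_lt_trans (norm_le_enorm _) wz).
have um' := sh_local_max (x := z) (r0 := r) (m := m)
  (fun w wz => le_trans (slabmax w (rP w wz)) (eq_ind_r (fun t => t <= m%:E)%E (lexx _) um)) uzm.
pose h := r / (2 * (enorm e + 1)).
have ee : 0 < 2 * (enorm e + 1) by rewrite mulr_gt0 // ltr_wpDl // enorm_ge0.
have h0 : 0 < h by rewrite divr_gt0.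
pose w := z + h *: e.
have wz : enorm (w - z) < r.
  rewrite /w addrC addKr enormZ gtr0_norm // /h -mulrA gtr_pMr //.
  rewrite mulrC ltr_pdivrMr // mul1r; have := enorm_ge0 e; lra.
have [g Gg Pg] := coP _ (rP w wz).
have : tau (w - g) <= tau z.
  apply: zmax; rewrite inE; split => //=.
  by rewrite sh_periodic // um'.
rewrite raddfB /= (tau_stab Gg) subr0 /w raddfD /= linearZ /= tau_e mulr1.
by rewrite gerDl leNgt h0.
Qed.
End Slabs.

Lemma sup_shift (R : realType) (A B : set R) (t : R) : has_sup A ->
  (forall s, B s <-> A (s + t)) -> sup B = sup A - t.
Proof.
move=> hA BA; have [[a Aa] [M AM]] := hA.
have hB : has_sup B.
  split; first by exists (a - t); rewrite BA subrK.
  by exists (M - t) => s /BA /AM; rewrite lerBrDr.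
apply/eqP; rewrite eq_le; apply/andP; split.
  apply: ge_sup; first by case: hB.
  by move=> s /BA As; rewrite lerBrDr; apply: sup_upper_bound.
rewrite lerBlDr; apply: ge_sup; first by exists a.
by move=> s As; rewrite -lerBlDr; apply: sup_upper_bound => //; rewrite BA subrK.
Qed.

Section Height.
Variables (R : realType) (d : nat) (tau : {scalar 'rV[R]_d}).
Notation rV := 'rV[R]_d.
Notation SH := (subharmonic R d).
Implicit Types (u : SH) (s : R) (n : nat).

(** The set [slab_le tau c u] is an interval; for a nonconstant [u] and a suitable
    rational [c] it is nonempty and bounded on one side.  Its finite end point
    is a Borel function of [u] that follows the shifts of [u].  The sign in an
    index reflects the axis to make this end point a supremum, and taking the
    first index that works makes the choice of the level and of the side Borel
    and invariant under shifts. *)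
Definition level_index n : option (rat * bool) := unpickle n.

Definition hsign n : R := if level_index n is Some (_, b) then (-1) ^+ b else 1.

Definition level n u : set R :=
  if level_index n is Some (c, b)
  then [set s | slab_le tau (ratr c) u ((-1) ^+ b * s)] else set0.

Definition good n u := level n u !=set0 /\ has_ubound (level n u).

Definition first_good u n := good n u /\ forall m : nat, (m < n)%N -> ~ good m u.

Definition height u : R :=
  let n := xget 0%N (first_good u) in hsign n * sup (level n u).

Lemma hsign_sq n : hsign n * hsign n = 1.
Proof. by rewrite /hsign; case: level_index => [[c b]|]; rewrite ?mulr1 // -expr2 sqrr_sign. Qed.

Lemma level_near n u s : level n u s ->
  exists2 e : R, 0 < e & forall s', `|s' - s| < e -> level n u s'.
Proof.
rewrite /level; case: level_index => // -[c b] /= /slab_le_near[e e0 he]; exists e => // s' ss'.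
by apply: he; rewrite -mulrBr normrM normrX normrN1 expr1n mul1r.
Qed.

Lemma level_shift n r u s : level n (sh_shift r u) s <-> level n u (s + hsign n * tau r).
Proof.
rewrite /level /hsign; case: level_index => // -[c b] /=.
by rewrite slab_le_shift mulrDr mulrA -expr2 sqrr_sign mul1r.
Qed.

Lemma good_shift n r u : good n (sh_shift r u) <-> good n u.
Proof.
split=> -[[s ls] [M lM]]; split.
- by exists (s + hsign n * tau r); apply/level_shift.
- exists (M + hsign n * tau r) => t lt; rewrite -lerBlDr; apply: lM.
  by apply/level_shift; rewrite subrK.
- by exists (s - hsign n * tau r); apply/level_shift; rewrite subrK.
- by exists (M - hsign n * tau r) => t /level_shift /lM; rewrite -lerBrDr.
Qed.

Lemma first_good_unique u n m : first_good u n -> first_good u m -> n = m.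
Proof.
by move=> [gn hn] [gm hm]; case: (ltngtP n m) => // h; [have := hm _ h|have := hn _ h].
Qed.

Lemma first_good_exists u : (exists n, good n u) -> exists n, first_good u n.
Proof.
move=> [n gn].
have exP : exists n, `[< good n u >] by exists n; apply/asboolP.
case: (ex_minnP exP) => m /asboolP gm minm; exists m; split => // k km gk.
by have /minm := asboolT gk; rewrite leqNgt km.
Qed.

Lemma heightE u n : first_good u n -> height u = hsign n * sup (level n u).
Proof.
move=> fn; have := xgetPex 0%N (ex_intro _ n fn) => fx.
by rewrite /height (first_good_unique fx fn).
Qed.

Lemma height_shift r u : (exists n, good n u) ->
  height (sh_shift r u) = height u - tau r.
Proof.
move=> /first_good_exists[n [gn hn]].
have fn : first_good u n by [].
have fn' : first_good (sh_shift r u) n.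
  by split; [exact/good_shift|move=> m mn /good_shift; exact: hn].
rewrite (heightE fn) (heightE fn') (@sup_shift _ (level n u) _ (hsign n * tau r)) //.
  by rewrite mulrBr mulrA hsign_sq mul1r.
by move=> s; exact: level_shift.
Qed.

Lemma borel_level n s : borel SH [set u | level n u s].
Proof.
rewrite /level; case: level_index => [[c b]|]; first exact: borel_slab_le.
by have := @borel_cst SH False.
Qed.

(** Level sets are open, so suprema can be tested on rational points. *)
Lemma level_rat n u s : level n u s -> forall e, 0 < e ->
  exists2 q : rat, level n u (ratr q) & `|ratr q - s| < e.
Proof.
move=> /level_near[e e0 he] e' e'0.
have [q qP] : exists q : rat, s < ratr q < s + Num.min e e'.
  by apply: exists_rat_between; rewrite ltrDl lt_min e0.
have /andP[q1 q2] : (`|ratr q - s| < e) && (`|ratr q - s| < e').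
  rewrite -lt_min ger0_norm; last by rewrite subr_ge0 ltW //; case/andP: qP.
  by rewrite ltrBlDl; case/andP: qP.
by exists q => //; exact: he.
Qed.

Lemma borel_good n : borel SH [set u | good n u].
Proof.
rewrite (_ : [set u | good n u] = [set u | exists q : rat, level n u (ratr q)] `&`
   [set u | exists N : nat, forall q : rat, level n u (ratr q) -> ratr q <= N%:R :> R]).
  apply: borelI; first by apply: borel_ex => q; exact: borel_level.
  apply: borel_ex => N; apply: borel_all => q; apply: borel_imply; first exact: borel_level.
  exact: borel_cst.
apply/seteqP; split => u /=.
  move=> [[s ls] [M lM]]; split.
    by have [q lq _] := level_rat ls ltr01; exists q.
  exists (Num.truncn `|M|).+1 => q /lM qM; apply: le_trans qM _.
  by apply: le_trans (ler_norm M) _; apply/ltW; exact: truncnS_gt.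
move=> [[q lq] [N hN]]; split; first by exists (ratr q).
exists (N%:R + 1) => s ls; have [p lp] := level_rat ls ltr01.
move=> ps; have := hN _ lp; move: ps; rewrite ltr_norml => /andP[ps _] pN.
by move: ps; rewrite ltrBrDr => ps; have := lt_le_trans ps pN; rewrite addrC ltrBlDr => /ltW.
Qed.

Lemma borel_sup_level n s : borel SH [set u | good n u /\ s < sup (level n u)].
Proof.
rewrite (_ : [set u | _] = [set u | good n u] `&`
    [set u | exists q : rat, level n u (ratr q) /\ s < ratr q]).
  apply: borelI; first exact: borel_good.
  apply: borel_ex => q; apply: borelI; [exact: borel_level|exact: borel_cst].
apply/seteqP; split => u /= [gn h]; split => //.
  have [t lt st] := sup_gt gn.1 h.
  have ts : 0 < t - s by rewrite subr_gt0.
  have [q lq qt] := level_rat lt ts; exists q; split => //.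
  by move: qt; rewrite ltr_norml => /andP[qt _]; move: qt; lra.
have [q [lq sq]] := h; apply: lt_le_trans sq _.
by apply: sup_upper_bound.
Qed.

Lemma borel_height s : borel SH [set u | (exists n, good n u) /\ s < height u].
Proof.
rewrite (_ : [set u | _] = [set u | exists n, first_good u n /\
    (good n u /\ s < hsign n * sup (level n u))]); last first.
  apply/seteqP; split => u /=.
    move=> [/first_good_exists[n fn]]; rewrite (heightE fn) => h.
    by exists n; split => //; split => //; case: fn.
  by move=> [n [fn [gn h]]]; rewrite (heightE fn); split => //; exists n.
apply: borel_ex => n; apply: borelI.
  apply: borelI; first exact: borel_good.
  apply: borel_all => m; apply: borel_imply; first exact: borel_cst.
  by apply: borelC; exact: borel_good.
have [->|->] : hsign n = 1 \/ hsign n = -1.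
- rewrite /hsign; case: level_index => [[_ []]|]; [right|left|left]; by rewrite ?expr1 ?expr0.
- by apply: borel_iff (borel_sup_level n s) => u; rewrite mul1r.
(* for the negative sign: [sup < - s] iff [sup <= - s - 1/(k+1)] for some [k] *)
apply: (@borel_iff _ ([set u | good n u] `&`
  [set u | exists k : nat, ~ (good n u /\ - s - k.+1%:R^-1 < sup (level n u))])); last first.
  apply: borelI; first exact: borel_good.
  by apply: borel_ex => k; apply: borelC; exact: borel_sup_level.
move=> u; split => /= -[gn h]; split => //; last first.
  have sup_lt : sup (level n u) < - s by move: h; rewrite mulN1r ltrNr.
  have [k kP] := exists_ltB_natSinv sup_lt.
  by exists k => -[_]; rewrite ltNge (ltW kP).
have [k /not_andP[//|/negP]] := h; rewrite -leNgt mulN1r ltrNr => hk.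
by apply: le_lt_trans hk _; rewrite gtrDl oppr_lt0 invr_gt0 ltr0n.
Qed.

Variables (e : rV) (G : set rV).
Hypotheses (sG : subgroup G) (tau_e : tau e = 1)
  (lspanE : forall x, (x \in lspan G) = (tau x == 0)).

(** A nonconstant [u] exceeds, at some point [z], its maximum over the hyperplane
    [tau = 0].  For a rational [c] between this maximum and [u z], the interval
    [slab_le tau c u] contains 0, by upper semicontinuity and compactness modulo
    [G], but not [tau z]; so it is bounded on the side of [z]. *)
Lemma good_exists u : G `<=` stab (@sh_shift R d) u ->
  ~ (exists c : R, forall x, u x = c%:E) -> exists n, good n u.
Proof.
move=> Gu nc.
have [P [cP PI coP]] := slab_cocompact sG tau_e lspanE 0 0.
have t00 : 0 <= tau 0 <= (0 : R) by rewrite raddf0 lexx.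
have [y Py ymax] : exists2 y, P y & forall z, P z -> (u z <= u y)%E.
  by apply: sh_compact_max => //; have [g _ Pg] := coP _ t00; exists (0 - g).
have ymax0 z : tau z = 0 -> (u z <= u y)%E.
  move=> tz; have zI : 0 <= tau z <= 0 by rewrite tz lexx.
  by have [g Gg Pg] := coP _ zI; rewrite -(sh_periodic Gu z Gg); exact: ymax.
have [z yz] : exists z, (u y < u z)%E.
  apply: contrapT => /forallNP H; apply: nc; apply: (@sh_max_const _ _ u y) => z.
  by rewrite leNgt; apply/negP; exact: H.
have [c [yc cz]] := sh_rat_between yz.
have I0 : slab_le tau (ratr c) u 0.
  have [P1 [cP1 P1I coP1]] := slab_cocompact sG tau_e lspanE (-1) 1.
  pose A := (tau : rV -> R) @` (P1 `&` [set x | ((ratr c : R)%:E <= u x)%E]).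
  have cA : compact A.
    apply: continuous_compact; last exact: compact_sh_ge.
    by apply: continuous_subspaceT; exact: continuous_scalar.
  have nA : nbhs (0 : R) (~` A).
    apply: open_nbhs_nbhs; split.
      by apply: closed_openC; apply: compact_closed => //; exact: Rhausdorff.
    move=> [x [_ /= cx] tx]; have := ymax0 x tx.
    by rewrite leNgt (lt_le_trans yc cx).
  have [r /= r0 rA] := (nbhs_ballP _ _).1 nA.
  have mr0 : 0 < Num.min r 1 by rewrite lt_min r0 ltr01.
  have [n _ /(_ n (leqnn n)) nP] := near_infty_natSinv_lt (PosNum mr0).
  exists n => x; rewrite subr0 => xn; rewrite leNgt; apply/negP => cx.
  have : `|tau x| < Num.min r 1 by exact: lt_trans xn nP.
  rewrite lt_min => /andP[xr x1].
  have xI : -1 <= tau x <= 1 by rewrite -ler_norml ltW.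
  have [g Gg Pg] := coP1 _ xI.
  apply: (rA (tau x)); first by rewrite -ball_normE /= sub0r normrN.
  exists (x - g); last by rewrite raddfB /= (tau_stab lspanE Gg) subr0.
  by split => //=; rewrite (sh_periodic Gu) // ltW.
have Iz : ~ slab_le tau (ratr c) u (tau z).
  move=> [n /(_ z)]; rewrite subrr normr0 invr_gt0 ltr0n => /(_ isT).
  by rewrite leNgt cz.
have tz0 : tau z != 0.
  by apply/eqP => tz; have := ymax0 z tz; rewrite leNgt yz.
pose b := tau z < 0.
exists (pickle (c, b)); rewrite /good /level /level_index pickleK; split.
  by exists 0; rewrite /= mulr0.
exists `|tau z| => s /= ls; rewrite leNgt; apply/negP => zs; apply: Iz.
have [tz|tz] := ltP (tau z) 0.
  rewrite /b tz expr1 mulN1r in ls.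
  apply: (slab_le_conv sG tau_e lspanE Gu ls I0) => //.
  by rewrite ltrNl -(ltr0_norm tz).
rewrite /b ltNge tz /= expr0 mul1r in ls.
apply: (slab_le_conv sG tau_e lspanE Gu I0 ls); first by rewrite lt_neqAle eq_sym tz0.
by rewrite -(ger0_norm tz).
Qed.
End Height.

(** * Selection of one function in each orbit *)

Section ShiftAction.
Variables (R : realType) (d : nat).
Notation rV := 'rV[R]_d.
Notation SH := (subharmonic R d).
Implicit Types (u v : SH) (r s : rV).

Lemma sh_shiftD r s u : sh_shift r (sh_shift s u) = sh_shift (r + s) u.
Proof. by apply: subharmonic_eqP => x /=; rewrite addrA. Qed.

Lemma stab_sh_shift r u : stab (@sh_shift R d) (sh_shift r u) = stab (@sh_shift R d) u.
Proof.
apply/seteqP; split => s /stab_shP us; apply/stab_shP => x.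
  by have := us (x - r); rewrite /= subrK addrAC subrK.
by have := us (x + r); rewrite /= addrAC.
Qed.

Lemma sh_shift_stab u r g : stab (@sh_shift R d) u g -> sh_shift (r + g) u = sh_shift r u.
Proof. by move=> ug; rewrite -sh_shiftD ug. Qed.
End ShiftAction.

Section Code.
Variables (R : realType) (d : nat).
Notation rV := 'rV[R]_d.
Notation SH := (subharmonic R d).
Implicit Types (u v : SH) (r s : rV) (n : nat).

(** A subharmonic function is encoded by the truth values of the statements
    [u <= a on a cube], for rational [a] and rational cubes.  Each of them is a
    closed condition on [u], and remains one after a shift by some element of a
    compact set is allowed, so that maximization over shifts stays Borel. *)
Definition code_index n : option (('rV[rat]_d * nat) * rat) := unpickle n.

Definition code_cube n : set rV := if code_index n is Some (p, _) then rcube p else set0.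

Definition code_bound n : R := if code_index n is Some (_, a) then ratr a else 0.

Definition bit n u := forall x, code_cube n x -> (u x <= (code_bound n)%:E)%E.

Lemma open_code_cube n : open (code_cube n).
Proof.
rewrite /code_cube; case: code_index => [[p a]|]; [exact: open_rcube|exact: open0].
Qed.

Lemma bit_le u v : (forall n, bit n u -> bit n v) -> forall x, (v x <= u x)%E.
Proof.
move=> uv x; rewrite leNgt; apply/negP => /sh_rat_between[a [ua av]].
have [p [px pu]] := rcube_basis (@open_sh_lt R d u (ratr a)) ua.
have E : code_index (pickle (p, a)) = Some (p, a) by rewrite /code_index pickleK.
have : bit (pickle (p, a)) v.
  by apply: uv => z; rewrite /code_cube /code_bound E => /pu /= /ltW.
move=> /(_ x); rewrite /code_cube /code_bound E => /(_ px).
by rewrite leNgt av.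
Qed.

Lemma bit_inj u v : (forall n, bit n u <-> bit n v) -> u = v.
Proof.
move=> uv; apply: subharmonic_eqP => x; apply/eqP; rewrite eq_le.
by rewrite !bit_le // => n /uv.
Qed.

Lemma borel_bit n : borel SH [set u | bit n u].
Proof. by apply: borel_closed; apply: closed_sh_le; exact: open_code_cube. Qed.

Lemma bit_shift_open n u r : ~ bit n (sh_shift r u) ->
  \forall r' \near r, ~ bit n (sh_shift r' u).
Proof.
move=> nb.
have [x Ux ux] : exists2 x, code_cube n x & ((code_bound n)%:E < u (x + r)%R)%E.
  apply: contrapT => nP; apply: nb => x Ux; rewrite leNgt; apply/negP => ux.
  by apply: nP; exists x.
have : nbhs x (code_cube n) by apply: open_nbhs_nbhs; split => //; exact: open_code_cube.
move=> /nbhs_ballP[e /= e0 eU]; near=> r' => /= h.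
have xr : code_cube n (x + (r - r')).
  apply: eU; rewrite -ball_normE /= opprD addrA subrr sub0r normrN.
  have : ball r e r' by near: r'; exact: nbhsx_ballx.
  by rewrite -ball_normE.
by have := h _ xr; rewrite /= -addrA subrK leNgt ux.
Unshelve. all: by end_near. Qed.

Variable K : set rV.
Hypotheses (cK : compact K).

Definition improvable n u := exists2 w, K w &
  (forall i, (i < n)%N -> bit i u -> bit i (sh_shift w u)) /\ bit n (sh_shift w u).

(** Maximality of the sequence [bit 0 u, bit 1 u, ...] in the lexicographic
    order among the shifts of [u] by [K], written bit by bit so that it is a
    countable combination of Borel conditions. *)
Definition lexmax u := forall n, bit n u \/ ~ improvable n u.

Lemma borel_lexmax : borel SH [set u | lexmax u].
Proof.
apply: borel_all => n; apply: borelU; first exact: borel_bit.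
apply: borelC.
(* [t] lists indices that include the bits of [u] below [n]; a finite list
   makes the remaining condition closed *)
apply: (@borel_iff _ [set u | exists t : seq nat,
   (forall i : nat, (i < n)%N -> bit i u -> i \in t) /\
   (exists2 w, K w & forall i, i \in n :: t -> bit i (sh_shift w u))]); last first.
  apply: borel_ex => t; apply: borelI.
    apply: borel_all => i; apply: borel_imply; first exact: borel_cst.
    by apply: borel_imply; [exact: borel_bit|exact: borel_cst].
  apply: borel_closed.
  exact: (@closed_ex_shift_le R d nat [set i | i \in n :: t] code_cube code_bound K
    open_code_cube cK).
move=> u; split => /= [[t [tn [w Kw wt]]]|[w Kw [wn nw]]].
  exists w => //; split => [i lin bi|]; apply: wt; rewrite inE ?eqxx //.
  by rewrite tn // orbT.
exists [seq i <- iota 0 n | `[< bit i u >]]; split.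
  by move=> i lin bi; rewrite mem_filter mem_iota /= add0n lin andbT; exact/asboolP.
exists w => // i; rewrite inE => /orP[/eqP -> //|].
by rewrite mem_filter mem_iota /= add0n => /andP[/asboolP bi lin]; exact: wn.
Qed.

Variable G : set rV.
Hypotheses (sG : subgroup G) (KW : forall x, K x -> x \in lspan G)
  (coK : forall x, x \in lspan G -> exists2 g, G g & K (x - g)).

Section FixedFunction.
Variable u : SH.
Hypothesis Gu : G `<=` stab (@sh_shift R d) u.

Lemma sh_shift_into_K w : w \in lspan G -> exists2 k, K k & sh_shift w u = sh_shift k u.
Proof.
move=> wW; have [g Gg Kg] := coK wW; exists (w - g) => //.
by rewrite -{1}(subrK g w) sh_shift_stab //; exact: Gu.
Qed.

(** The greedy choice of the largest code: an index is accepted when some shift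
    of [u] by [K] has this bit and all bits accepted before. *)
Fixpoint accepted n : seq nat :=
  if n is n'.+1 then
    if `[< exists2 w, K w & forall i, i \in n' :: accepted n' -> bit i (sh_shift w u) >]
    then n' :: accepted n' else accepted n'
  else [::].

Lemma accepted_lt n i : i \in accepted n -> (i < n)%N.
Proof.
elim: n => //= n IHn; case: ifP => _; rewrite ?inE; last by move/IHn/ltnW.
by move=> /orP[/eqP ->|/IHn/ltnW].
Qed.

Lemma accepted_le n m i : (n <= m)%N -> i \in accepted n -> i \in accepted m.
Proof.
move=> nm; rewrite -(subnK nm); elim: (m - n)%N => // k IHk im.
by rewrite addSn /=; case: ifP => _; rewrite ?inE IHk ?orbT.
Qed.

Lemma accepted_exists n : exists2 w, K w & forall i, i \in accepted n -> bit i (sh_shift w u).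
Proof.
elim: n => [|n [w Kw hw]] /=.
  by have [g _ Kg] := coK (mem0v (lspan G)); exists (0 - g).
by case: ifP => [/asboolP //|_]; exists w.
Qed.

(** For each [n], the shifts in [K] with all bits of [accepted n] form a nonempty
    closed set, and these sets decrease, so they have a common point. *)
Lemma accepted_all : exists2 w, K w & forall n i, i \in accepted n -> bit i (sh_shift w u).
Proof.
apply: contrapT => H.
have : \forall n \near \oo, K `<=` (fun w => ~ (forall i, i \in accepted n -> bit i (sh_shift w u))).
  move/compact_near_coveringP : (cK).
  apply; move=> w Kw.
  have [n [i [im nb]]] : exists n i, i \in accepted n /\ ~ bit i (sh_shift w u).
    apply: contrapT => nP; apply: H; exists w => // n i im.
    by apply: contrapT => nb; apply: nP; exists n, i.
  near=> w' m.
  have nm : (n <= m)%N by near: m; exact: nbhs_infty_ge.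
  have nb' : ~ bit i (sh_shift w' u) by near: w'; exact: bit_shift_open.
  by move=> hm; apply: nb'; apply: hm; exact: accepted_le im.
move=> [n _ /(_ n (leqnn n)) Kn].
by have [w Kw hw] := accepted_exists n; exact: (Kn w Kw hw).
Unshelve. all: by end_near. Qed.

Lemma lexmax_exists : exists2 w, w \in lspan G & lexmax (sh_shift w u).
Proof.
have [w Kw hw] := accepted_all; exists w; first exact: KW.
move=> n; have [bn|nbn] := pselect (bit n (sh_shift w u)); [by left|right].
move=> [w' Kw' [h1 h2]]; apply: nbn; apply: (hw n.+1) => /=.
have [k Kk E] : exists2 k, K k & sh_shift (w' + w) u = sh_shift k u.
  by apply: sh_shift_into_K; apply: memvD; exact: KW.
rewrite asboolT ?inE ?eqxx //; exists k => // i; rewrite inE -E -sh_shiftD => /orP[/eqP -> //|im].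
by apply: h1; [exact: accepted_lt im|exact: hw im].
Qed.
End FixedFunction.

(** Induction step for uniqueness: [v] is a shift of [u] by an element of [K]
    modulo [G], so a bit of [v] absent from [u] would improve [u]. *)
Lemma lexmax_bits u v r : G `<=` stab (@sh_shift R d) u -> r \in lspan G ->
  v = sh_shift r u -> lexmax u ->
  forall n, (forall i, (i < n)%N -> bit i u <-> bit i v) -> bit n v -> bit n u.
Proof.
move=> Gu rW vE lu n IH bv; case: (lu n) => // nimp; case: nimp.
have [k Kk E] := sh_shift_into_K Gu rW.
exists k => //; rewrite -E -vE; split => // i lin; exact: (IH i lin).1.
Qed.

Lemma lexmax_unique u v r : G `<=` stab (@sh_shift R d) u -> r \in lspan G ->
  v = sh_shift r u -> lexmax u -> lexmax v -> u = v.
Proof.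
move=> Gu rW vE lu lv; apply: bit_inj => n.
have Gv : G `<=` stab (@sh_shift R d) v by rewrite vE stab_sh_shift.
have uE : u = sh_shift (- r) v.
  by rewrite vE sh_shiftD addNr; apply: subharmonic_eqP => x /=; rewrite addr0.
have rW' : - r \in lspan G by rewrite memvN.
elim/ltn_ind: n => n IH; split.
  by apply: (lexmax_bits Gv rW' uE lv) => i lin; have := IH i lin; tauto.
exact: (lexmax_bits Gu rW vE lu).
Qed.
End Code.

Section Transversal.
Variables (R : realType) (d : nat) (G : set 'rV[R]_d).
Notation rV := 'rV[R]_d.
Notation SH := (subharmonic R d).
Notation SHG := (subharmonic_stab G).
Hypotheses (hd : (2 <= d)%N) (sG : subgroup G) (dG : sgdim G = d.-1).
Variables (tau : {scalar rV}) (e : rV).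
Hypotheses (tau_e : tau e = 1) (lspanE : forall x, (x \in lspan G) = (tau x == 0)).

Lemma stratum_stab (x : SHG) : stab (@sh_shift R d) (\val x) = G.
Proof. by case: x => x /= /set_mem. Qed.

Lemma stratum_sub (x : SHG) : G `<=` stab (@sh_shift R d) (\val x).
Proof. by rewrite stratum_stab. Qed.

Lemma stratum_good (x : SHG) : exists n, good tau n (\val x).
Proof.
apply: (good_exists sG tau_e lspanE (@stratum_sub x)) => -[c xc].
have : sgdim G = d by rewrite -(stratum_stab x) (stab_const xc) sgdim_setT.
by rewrite dG => /eqP; rewrite -{2}(prednK (ltnW hd)) eqn_leq ltnn andbF.
Qed.

Lemma borel_height_stratum s :
  borel SHG [set x | s < height tau (\val x)].
Proof.
have cval : continuous (set_val : SHG -> SH) by exact: initial_continuous.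
apply: borel_iff (borel_preimage_continuous cval (borel_height tau s)) => x /=.
by split=> [[]|h] //; split => //; exact: stratum_good.
Qed.

(** A shift along [e] brings the height of [u] to 0, and the remaining freedom
    is a shift by [lspan G], in which lexicographic maximality determines the
    function uniquely. *)
Lemma transversal_exists : exists S : set SHG, borel_transversal (@sh_shift R d) S.
Proof.
have [K [cK KW coK]] := subgroup_cocompact sG.
have cval : continuous (set_val : SHG -> SH) by exact: initial_continuous.
exists [set x | height tau (\val x) = 0 /\ lexmax K (\val x)]; split.
  apply: borelI; last exact: (borel_preimage_continuous cval (borel_lexmax cK)).
  apply: (@borel_iff _ [set x : SHG | ~ (0 < height tau (\val x)) /\
    forall n : nat, - n.+1%:R^-1 < height tau (\val x)]).
    move=> x /=; split=> [[/negP h0 h]|->]; last first.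
      by rewrite ltxx; split => // n; rewrite oppr_lt0 invr_gt0 ltr0n.
    apply/eqP; rewrite eq_le leNgt h0 /= leNgt; apply/negP => hx.
    have [n hn] := exists_ltB_natSinv hx.
    by have := lt_trans hn (_ : _ < height tau (\val x)); rewrite sub0r => /(_ (h n)); rewrite ltxx.
  apply: borelI; first by apply: borelC; exact: borel_height_stratum.
  by apply: borel_all => n; exact: borel_height_stratum.
move=> x; set u := \val x.
have gx := stratum_good x; have ux : G `<=` stab (@sh_shift R d) u by exact: stratum_sub.
pose u1 := sh_shift (height tau u *: e) u.
have Gu1 : G `<=` stab (@sh_shift R d) u1 by rewrite stab_sh_shift.
have h1 : height tau u1 = 0.
  by rewrite height_shift // linearZ /= tau_e mulr1 subrr.
have [w wW lw] := lexmax_exists cK KW coK Gu1.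
pose v := sh_shift w u1.
have Gv : v \in subharmonic_stab G.
  by rewrite inE /subharmonic_stab /stab_stratum /= !stab_sh_shift stratum_stab.
pose y : SHG := exist _ v Gv.
have yE : \val y = sh_shift (w + height tau u *: e) u by rewrite -sh_shiftD.
have hy : height tau (\val y) = 0.
  rewrite yE height_shift // raddfD /= linearZ /= tau_e mulr1.
  by move: wW; rewrite lspanE => /eqP ->; rewrite add0r subrr.
exists y; split.
  by split; [split|exists (w + height tau u *: e)].
move=> z [[hz lz] [r zE]]; apply: val_inj.
have zy : \val z = sh_shift (r - (w + height tau u *: e)) (\val y).
  by rewrite zE yE sh_shiftD subrK.
apply: (lexmax_unique coK (@stratum_sub y) _ zy) => //.
have := height_shift (r - (w + height tau u *: e)) (stratum_good y).
by rewrite -zy hz hy sub0r lspanE => /esym/eqP; rewrite oppr_eq0.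
Qed.
End Transversal.

(** * Rotation of the circle by one radian *)

Section Rotation.
Variable R : realType.
Notation mu1 := (@lebesgue_measure R).

Lemma sin_mulz_pi (k : int) : sin (k%:~R * pi : R) = 0.
Proof.
have H n : sin (n%:R * pi : R) = 0.
  elim: n => [|n IHn]; first by rewrite mul0r sin0.
  by rewrite -natr1 mulrDl mul1r sinD IHn sinpi mul0r mulr0 addr0.
case: k => n; first by rewrite -pmulrn H.
by rewrite NegzE mulrNz mulNr sinN -pmulrn H oppr0.
Qed.

Lemma sin_eq0 (x : R) : sin x = 0 -> exists k : int, x = k%:~R * pi.
Proof.
move=> sx; pose k := Num.floor (x / pi); exists k.
have pi0 : 0 < (pi : R) by exact: pi_gt0.
have y0 : 0 <= x - k%:~R * pi.
  by rewrite subr_ge0 -ler_pdivlMr // floor_le.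
have ypi : x - k%:~R * pi < pi.
  have := floorD1_gt (x / pi); rewrite -/k intrD ltr_pdivrMr // mulrDl mul1r.
  by rewrite ltrBlDl.
have : sin (x - k%:~R * pi) = 0 by rewrite sinB sx sin_mulz_pi mul0r mulr0 subrr.
move: y0; rewrite le_eqVlt => /orP[/eqP /esym/eqP|y0 sy].
  by rewrite subr_eq0 => /eqP.
by have := @sin_gt0_pi R (x - k%:~R * pi); rewrite y0 ypi => /(_ isT); rewrite sy ltxx.
Qed.

(** The equations say that [s] is an integer and an even multiple of pi, which
    is irrational. *)
Lemma sin_half_sin_pi_eq0 (s : R) : sin (s / 2) = 0 -> sin (pi * s) = 0 -> s = 0.
Proof.
move=> /sin_eq0[k kE] /sin_eq0[m mE].
have pi0 : (pi : R) != 0 by rewrite gt_eqF // pi_gt0.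
have sm : s = m%:~R by apply: (mulfI pi0); rewrite mE mulrC.
have sk : s = 2 * k%:~R * pi by rewrite -mulrA -kE mulrC divfK.
have [k0|k0] := eqVneq k 0; first by rewrite sk k0 mulr0 mul0r.
exfalso; apply: (@pi_irrationnal R).
exists (m%:~R / (2 * k%:~R)) => //.
have k0' : (k%:~R : R) != 0 by rewrite intr_eq0.
rewrite fmorph_div rmorphM /= !ratr_int rmorph_nat -sm sk.
by rewrite mulrC mulKf // mulf_neq0 // pnatr_eq0.
Qed.

Notation twopi := (pi *+ 2 : R).

Lemma twopi_ge1 : 1 <= twopi.
Proof. by rewrite mulr2n; have := @pi_ge2 R; lra. Qed.

Lemma lebesgue_translate (A : set (measurableTypeR R)) (t : R) : measurable A ->
  mu1 ((fun x => x + t) @^-1` A) = mu1 A.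
Proof.
move=> mA; have := lebesgue_measure_affine t ltr01 mA.
rewrite invr1 mul1e => <-; congr mu1; apply/seteqP; split => x /=; by rewrite mul1r addrC.
Qed.

(** After translation, the left side is the measure of [A] on the fundamental
    domain shifted by 1; the periodicity of [A] carries the piece that sticks
    out at the right to the piece that is missing at the left. *)
Lemma periodic_rotation (A : set (measurableTypeR R)) : measurable A ->
  (forall x, A (x + twopi) <-> A x) ->
  mu1 (`[0, twopi[ `&` (fun x => x + 1) @^-1` A) = mu1 (`[0, twopi[ `&` A).
Proof.
move=> mA pA; have t1 := twopi_ge1.
have mI (a b : R) : measurable (`[a, b[%classic : set (measurableTypeR R)) by exact: measurable_itv.
transitivity (mu1 (`[1, twopi + 1[ `&` A)).
  rewrite -(@lebesgue_translate (`[1, twopi + 1[ `&` A) 1); last exact: measurableI.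
  congr mu1; apply/seteqP; split => x /=; rewrite !in_itv /=.
    by move=> [/andP[x0 x2] Ax]; split => //; rewrite lerDr x0 ltrD2r.
  by move=> [/andP[x0 x2] Ax]; split => //; move: x0 x2; rewrite lerDr ltrD2r => -> ->.
have split2 (a b c : R) : a <= b -> b <= c ->
    mu1 (`[a, c[ `&` A) = (mu1 (`[a, b[ `&` A) + mu1 (`[b, c[ `&` A))%E.
  move=> ab bc; rewrite -measureU; try exact: measurableI.
    congr mu1; apply/seteqP; split => x /=; rewrite !in_itv /=.
      move=> [/andP[ax xc] Ax]; have [xb|xb] := ltP x b; [left|right]; split => //.
        by rewrite ax.
    by move=> [|] [/andP[h1 h2] Ax]; split => //; apply/andP; split => //; lra.
  apply/seteqP; split => x //= -[[]]; rewrite !in_itv /= => /andP[_ xb] _ [/andP[bx _] _].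
  by move: xb; rewrite ltNge bx.
rewrite (split2 1 twopi) ?lerDl // (split2 0 1 twopi) // addeC; congr (_ + _)%E.
rewrite -(@lebesgue_translate (`[twopi, twopi + 1[ `&` A) twopi); last exact: measurableI.
congr mu1; apply/seteqP; split => x /=; rewrite !in_itv /=.
  by move=> [/andP[x0 x1] /pA Ax]; split => //; move: x0 x1; rewrite lerDr [twopi + 1]addrC ltrD2r => -> ->.
by move=> [/andP[x0 x1] Ax]; split; [rewrite lerDr x0 [twopi + 1]addrC ltrD2r|exact/pA].
Qed.

(** Rotation by one radian preserves the measure of the circle and carries
    [{F > a + 1}] to [{F > a}], so the measure of [{F > a}] is the same for all
    integers [a].  These sets exhaust the circle as [a] decreases, so each of
    them has full measure; so do their complements, by symmetry. *)
Lemma no_rotation_height (F : R -> R) :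
  (forall a, measurable ([set x | a < F x] : set (measurableTypeR R))) ->
  (forall x, F (x + twopi) = F x) -> (forall x, F (x + 1) = F x - 1) -> False.
Proof.
move=> mF Fp Fr; pose I : set (measurableTypeR R) := `[0, twopi[%classic.
have mI : measurable I by exact: measurable_itv.
pose A (a : R) : set (measurableTypeR R) := [set x | a < F x].
have mC a : measurable (~` A a) by apply: measurableC; exact: mF.
have E1 a : mu1 (I `&` A (a + 1)) = mu1 (I `&` A a).
  rewrite -(periodic_rotation (mF a)); last by move=> x; rewrite /= Fp.
  by congr mu1; congr (_ `&` _); apply/seteqP; split => x; rewrite /A /= Fr ltrBrDr.
have E2 a : mu1 (I `&` ~` A (a + 1)) = mu1 (I `&` ~` A a).
  rewrite -(periodic_rotation (mC a)); last by move=> x; rewrite /A /setC /= Fp.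
  by congr mu1; congr (_ `&` _); apply/seteqP; split => x; rewrite /A /= Fr ltrBrDr.
have const1 n : mu1 (I `&` A (- n%:R)) = mu1 (I `&` A 0).
  elim: n => [|n IHn]; first by rewrite oppr0.
  by rewrite -IHn -[in RHS](subrK 1 (- n%:R)) -opprD natr1 E1.
have const2 n : mu1 (I `&` ~` A n%:R) = mu1 (I `&` ~` A 0).
  elim: n => [//|n IHn]; by rewrite -natr1 E2.
have full (B : nat -> set (measurableTypeR R)) (m : \bar R) :
    (forall n, measurable (B n)) ->
    {homo B : i j / (i <= j)%N >-> i `<=` j} -> (forall x, exists n, B n x) ->
    (forall n, mu1 (I `&` B n) = m) -> m = mu1 I.
  move=> mB ndB covB constB.
  have mIB n : measurable (I `&` B n) by exact: measurableI.
  have EI : \bigcup_n (I `&` B n) = I.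
    apply/seteqP; split => x; first by move=> [n _ []].
    by move=> Ix; have [n Bx] := covB x; exists n.
  have mU : measurable (\bigcup_n (I `&` B n)) by rewrite EI.
  have := @nondecreasing_cvg_mu _ _ _ mu1 (fun n => I `&` B n) mIB mU.
  rewrite EI => /(_ _)/cvg_lim => <- //.
    rewrite (_ : mu1 \o _ = cst m); first by rewrite lim_cst.
    by apply/funext => n /=; exact: constB.
  by move=> i j ij; apply/subsetPset; apply: setIS; exact: ndB.
have h1 : mu1 (I `&` A 0) = mu1 I.
  apply: (full (fun n => A (- n%:R)) _ (fun n => mF (- n%:R))) => [i j ij x|x|//].
    by rewrite /A /=; apply: le_lt_trans; rewrite lerN2 ler_nat.
  exists (Num.truncn `|F x|).+1; rewrite /A /= ltrNl.
  by apply: le_lt_trans (truncnS_gt _); rewrite -normrN ler_norm.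
have h2 : mu1 (I `&` ~` A 0) = mu1 I.
  apply: (full (fun n => ~` A n%:R) _ (fun n => mC n%:R)) => [i j ij x|x|//].
    by rewrite /A /= => /negP; rewrite -leNgt => Fi; apply/negP; rewrite -leNgt (le_trans Fi) // ler_nat.
  exists (Num.truncn `|F x|).+1; rewrite /A /=; apply/negP; rewrite -leNgt.
  by apply/ltW; apply: le_lt_trans (truncnS_gt _); rewrite ler_norm.
have : mu1 I = (mu1 (I `&` A 0%R) + mu1 (I `&` ~` A 0%R))%E.
  rewrite -measureU.
  - by rewrite -setIUr setUv setIT.
  - by apply: measurableI => //; exact: mF.
  - by apply: measurableI => //; exact: mC.
  - by rewrite setIACA setICr setI0.
rewrite h1 h2 /I lebesgue_measure_itv /= lte_fin; have t1 := twopi_ge1.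
rewrite (lt_le_trans ltr01 t1) -EFinD => /eqP; rewrite -EFinD eqe => /eqP; lra.
Qed.
End Rotation.

(** * Measures with continuous densities *)

Section Densities.
Variables (R : realType) (d : nat).
Notation rV := 'rV[R]_d.

(** The lower bound turns a uniform estimate between two densities into a
    bound on their ratio, which is what makes integrals vary continuously. *)
Record density := Density {
  dens_fun :> rV -> R;
  dens_cont : continuous dens_fun;
  dens_ge1 : forall x, 1 <= dens_fun x;
  dens_le : exists C, forall x, dens_fun x <= C }.

Implicit Type g : density.

Lemma dens_ge0 g x : 0 <= g x. Proof. exact: le_trans (dens_ge1 g x). Qed.

Lemma measurable_dens g : measurable_fun setT (fun x => (g x)%:E).
Proof. by apply/measurable_EFinP; apply: continuous_measurable_row; exact: dens_cont. Qed.

Definition dens_meas g (A : set rV) : \bar R :=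
  if `[< measurable A >] then (\int[leb]_(x in A) (g x)%:E)%E else 0%E.

Lemma dens_measE g A : measurable A -> dens_meas g A = (\int[leb]_(x in A) (g x)%:E)%E.
Proof. by move=> mA; rewrite /dens_meas asboolT. Qed.

Let dens_meas0 g : dens_meas g set0 = 0%E.
Proof. by rewrite dens_measE // integral_set0. Qed.

Let dens_meas_ge0 g A : (0 <= dens_meas g A)%E.
Proof.
rewrite /dens_meas; case: ifP => // _; apply: integral_ge0 => x _.
by rewrite lee_fin dens_ge0.
Qed.

Let dens_meas_sigma_additive g : semi_sigma_additive (dens_meas g).
Proof.
move=> F mF tF mUF; rewrite dens_measE //.
under eq_fun do under eq_bigr do rewrite dens_measE //.
apply: semi_sigma_additive_nng_induced => //.
- exact: measurable_dens.
- by move=> x; rewrite lee_fin dens_ge0.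
Qed.

HB.instance Definition _ g := isMeasure.Build _ _ _ (dens_meas g)
  (dens_meas0 g) (dens_meas_ge0 g) (@dens_meas_sigma_additive g).

Lemma dens_meas_compact g K : compact K -> (dens_meas g K < +oo)%E.
Proof.
move=> cK; have mK := compact_measurable_row cK; rewrite dens_measE //.
have [C gC] := dens_le g.
apply: (@le_lt_trans _ _ (\int[leb]_(x in K) C%:E)%E).
  apply: ge0_le_integral => //.
  - by move=> x _; rewrite lee_fin dens_ge0.
  - by apply: measurable_funTS; exact: measurable_dens.
  - by move=> x _; rewrite lee_fin.
rewrite integral_cst // lte_mul_pinfty //; last exact: leb_compact.
by rewrite lee_fin; exact: le_trans (dens_ge0 g 0) (gC 0).
Qed.

Lemma dens_meas_offborel g A : ~ measurable A -> dens_meas g A = 0%E.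
Proof. by move=> nA; rewrite /dens_meas asboolF. Qed.

Definition dens_radon g : radon R d :=
  @Radon R d (dens_meas g) (@dens_meas_compact g) (@dens_meas_offborel g).

Lemma integral_dens_translate g (r : rV) A : measurable A ->
  (\int[leb]_(x in (fun x => (x - r)%R) @^-1` A) (g x)%:E = \int[leb]_(x in A) (g (x + r)%R)%:E)%E.
Proof.
move=> mA; rewrite [LHS]integral_mkcond [RHS]integral_mkcond.
rewrite -(ge0_integral_translate r).
- apply: eq_integral => x _; rewrite !patchE; congr (if _ then _ else _).
  by apply/idP/idP; rewrite !inE /= addrK.
- apply/(measurable_restrictT _ _).1.
  + rewrite -[X in measurable X]setTI; exact: measurable_translation.
  + by apply: measurable_funTS; exact: measurable_dens.
- by move=> y; rewrite patchE; case: ifP => // _; rewrite lee_fin dens_ge0.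
Qed.

Lemma dens_radon_shift g g' r : (forall x, g' x = g (x + r)) ->
  radon_shift r (dens_radon g) = dens_radon g'.
Proof.
move=> gg'; apply: radon_eqP => A mA /=.
rewrite /mpush /pushforward dens_measE; last first.
  by rewrite -[X in measurable X]setTI; exact: measurable_translation.
rewrite integral_dens_translate // dens_measE //.
by apply: eq_integral => x _; rewrite gg'.
Qed.

(** Where [g' < g], continuity gives a gap [eps] on an open set of finite
    positive measure, to which the two measures would give different values. *)
Lemma dens_le_of_measure g g' : (forall A, measurable A -> dens_meas g A = dens_meas g' A) ->
  forall x, g x <= g' x.
Proof.
move=> gg' x; rewrite leNgt; apply/negP => gx.
pose eps := (g x - g' x) / 2.
have eps0 : 0 < eps by rewrite divr_gt0 // subr_gt0.
pose U := [set y : rV | g' y + eps < g y].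
have oU : open U.
  rewrite (_ : U = (fun y => g y - g' y) @^-1` [set t | eps < t]); last first.
    by apply/seteqP; split => y; rewrite /U /= ltrBrDl.
  apply: open_comp => [y _|]; last exact: open_gt.
  by apply: (@continuousB _ R^o _ g g'); exact: dens_cont.
have Ux : U x by rewrite /U /= /eps; lra.
pose V := U `&` ball x 1.
have oV : open V by apply: openI => //; exact: ball_open.
have mV : measurable V by exact: open_measurable_row.
have V0 : (0 < leb V)%E by apply: leb_open_gt0 => //; exists x; split => //; exact: ballxx.
have Vfin : (leb V < +oo)%E.
  apply: (@le_lt_trans _ _ (leb [set z | `|z - x| <= 1])).
    apply: le_measure; rewrite ?inE //.
      by apply: compact_measurable_row; exact: compact_closed_ball_row.
    by move=> z [_]; rewrite -ball_normE /= distrC => /ltW.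
  by apply: leb_compact; exact: compact_closed_ball_row.
have := gg' V mV; rewrite !dens_measE // => E.
have Ifin : (\int[leb]_(y in V) (g' y)%:E)%E \is a fin_num.
  rewrite ge0_fin_numE; last by apply: integral_ge0 => y _; rewrite lee_fin dens_ge0.
  have [C g'C] := dens_le g'.
  apply: (@le_lt_trans _ _ (\int[leb]_(y in V) C%:E)%E).
    apply: ge0_le_integral => //.
    - by move=> y _; rewrite lee_fin dens_ge0.
    - by apply: measurable_funTS; exact: measurable_dens.
    - by move=> y _; rewrite lee_fin.
  rewrite integral_cst // lte_mul_pinfty //.
  by rewrite lee_fin; exact: le_trans (dens_ge0 g' 0) (g'C 0).
have : (\int[leb]_(y in V) ((g' y)%:E + eps%:E) <= \int[leb]_(y in V) (g y)%:E)%E.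
  apply: ge0_le_integral => //.
  - by move=> y _; rewrite -EFinD lee_fin addr_ge0 ?dens_ge0 // ltW.
  - by apply: emeasurable_funD => //; apply: measurable_funTS; exact: measurable_dens.
  - by apply: measurable_funTS; exact: measurable_dens.
  - by move=> y [/ltW Uy _]; rewrite -EFinD lee_fin.
rewrite ge0_integralD //; first last.
- by move=> y _; rewrite lee_fin ltW.
- by apply: measurable_funTS; exact: measurable_dens.
- by move=> y _; rewrite lee_fin dens_ge0.
rewrite integral_cst // E -[leRHS]adde0 leeD2lE // leNgt => /negP; apply.
by rewrite mule_gt0.
Qed.

Lemma dens_radon_inj g g' : dens_radon g = dens_radon g' -> forall x, g x = g' x.
Proof.
move=> gg' x.
have E A : dens_meas g A = dens_meas g' A by exact: (congr1 (fun m : radon R d => m A) gg').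
by apply/eqP; rewrite eq_le !dens_le_of_measure // => A _; rewrite E.
Qed.

Lemma dens_radon_stab g (r : rV) : stab (@radon_shift R d) (dens_radon g) r <->
  forall x, g (x + r) = g x.
Proof.
split=> [h x|h]; last by rewrite /stab /=; apply: dens_radon_shift => x; rewrite h.
have cg : continuous (fun x : rV => g (x + r)).
  move=> y; apply: (@continuous_comp rV rV R (fun y : rV => y + r) g); last exact: dens_cont.
  exact: continuous_translation.
have [C gC] := dens_le g.
pose g' := @Density (fun x => g (x + r)) cg (fun x => dens_ge1 g (x + r))
  (ex_intro _ C (fun x => gC (x + r))).
have := @dens_radon_shift g g' r (fun=> erefl).
by move=> E; have := dens_radon_inj (etrans (esym h) E) x.
Qed.
End Densities.

Section VagueContinuity.
Variables (R : realType) (d : nat).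
Notation rV := 'rV[R]_d.

Lemma Cc_off (f : rV -> R) x : ~ closure [set x | f x != 0] x -> f x = 0.
Proof. by move=> nx; apply/eqP/negPn/negP => fx; apply: nx; exact: subset_closure. Qed.

Lemma CcS (f g : rV -> R) : Cc R d f -> continuous g -> (forall x, f x = 0 -> g x = 0) ->
  Cc R d g.
Proof.
move=> [cf sf] cg fg; split => //; apply: (subclosed_compact _ sf); first exact: closed_closure.
by apply: closureS => x; apply: contra_neq; exact: fg.
Qed.

Lemma Cc_bounded (f : rV -> R) : Cc R d f -> exists M, forall x, `|f x| <= M.
Proof.
move=> [cf sf].
have cfs : compact (f @` closure [set x | f x != 0]).
  by apply: continuous_compact => //; exact: continuous_subspaceT.
have [M [Mreal MP]] := compact_bounded cfs.
exists (`|M| + 1) => x.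
have [fx0|fx0] := eqVneq (f x) 0; first by rewrite fx0 normr0 addr_ge0.
apply: (MP (`|M| + 1)).
  by rewrite (le_lt_trans (ler_norm M)) // ltrDl.
by exists x => //; exact: subset_closure.
Qed.

Lemma Cc_integrable (mu : {measure set rV -> \bar R}) (f : rV -> R) :
  (forall K, compact K -> (mu K < +oo)%E) -> Cc R d f -> mu.-integrable setT (EFin \o f).
Proof.
move=> muK Cf; have [M fM] := Cc_bounded Cf; have [cf sf] := Cf.
rewrite /compactly_supported in sf; set K := closure _ in sf.
have mK : measurable K by exact: compact_measurable_row.
have -> : EFin \o f = (EFin \o f) \_ K.
  apply/funext => x; rewrite patchE; case: ifPn => //; rewrite notin_setE => nK.
  by rewrite /= (Cc_off nK).
apply/(integrable_mkcond _ mK); apply: (@bounded_integrable _ _ _ mu K f M) => //.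
- exact: muK.
- by apply: measurable_funTS; exact: continuous_measurable_row.
Qed.

(** Since [g' >= 1], the error [delta] is at most [delta * g']. *)
Lemma dens_integral_le (g g' : density R d) (delta : R) (h : rV -> \bar R) : 0 <= delta ->
  (forall x, g x <= g' x + delta) -> measurable_fun setT h -> (forall x, 0 <= h x)%E ->
  (\int[dens_meas g]_x h x <= (1 + delta)%:E * \int[dens_meas g']_x h x)%E.
Proof.
move=> d0 gg' mh h0; have d1 : 0 <= 1 + delta by rewrite addr_ge0.
rewrite -(@ge0_integral_mscale _ _ _ (dens_meas g') setT measurableT (NngNum d1) h) //.
apply: ge0_le_measure_integral => // A mA; rewrite /= /mscale /= !dens_measE //.
rewrite -ge0_integralZl //; first last.
- by move=> x _; rewrite lee_fin dens_ge0.
- by apply: measurable_funTS; exact: measurable_dens.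
apply: ge0_le_integral => //.
- by move=> x _; rewrite lee_fin dens_ge0.
- by apply: measurable_funTS; exact: measurable_dens.
- by apply: measurable_funTS; apply: measurable_funeM; exact: measurable_dens.
move=> x _; rewrite -EFinM lee_fin (le_trans (gg' x)) // mulrDl mul1r lerD2l.
by rewrite ler_peMr // dens_ge1.
Qed.

(** The ratio bound, used in both directions, also bounds [Phi s] near [t]. *)
Lemma ratio_bound_continuous (Phi : R -> R) : (forall s, 0 <= Phi s) ->
  (forall s t, Phi s <= (1 + `|s - t|) * Phi t) -> continuous Phi.
Proof.
move=> Phi0 ratio t.
apply/(@cvgrPdist_lt _ R^o) => eps eps0.
have c0 : 0 < 2 * Phi t + 1 by rewrite ltr_wpDl // mulr_ge0.
have e0 : 0 < Num.min 1 (eps / (2 * Phi t + 1)) by rewrite lt_min ltr01 divr_gt0.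
near=> s.
have : `|s - t| < Num.min 1 (eps / (2 * Phi t + 1)).
  rewrite distrC; near: s; have := nbhsx_ballx t _ e0; rewrite -ball_normE.
  exact.
rewrite lt_min => /andP[st1]; rewrite ltr_pdivlMr // => st2.
have h1 := ratio s t; have h2 := ratio t s.
have s0 := normr_ge0 (s - t); rewrite distrC in h2.
have p0 := Phi0 t; have ps := Phi0 s.
move: h1 h2 st1 st2 s0 p0 ps; set x := `|s - t|; set a := Phi t; set b := Phi s.
move=> h1 h2 st1 st2 s0 p0 ps.
have b2 : b <= 2 * a by nra.
by rewrite ltr_norml; apply/andP; split; nra.
Unshelve. all: by end_near. Qed.

Variable gs : R -> density R d.
Hypothesis gs_lip : forall s t x, `|gs s x - gs t x| <= `|s - t|.

Lemma dens_Rintegral_continuous (f : rV -> R) : Cc R d f ->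
  continuous (fun s => \int[dens_meas (gs s)]_x f x).
Proof.
move=> Cf; have [cf sf] := Cf.
have cn : continuous (fun x => `|f x|).
  by move=> x; apply: (@continuous_comp rV R R f (fun y => `|y|)); [exact: cf|exact: norm_continuous].
(* ratio bounds need nonnegative functions: write [f = |f| - (|f| - f)] *)
have C1 : Cc R d (fun x => `|f x|) by apply: CcS Cf cn _ => x ->; rewrite normr0.
have C2 : Cc R d (fun x => `|f x| - f x).
  apply: CcS Cf _ _; last by move=> x ->; rewrite normr0 subrr.
  by move=> x; apply: (@continuousB _ R^o rV (fun x => `|f x|) f); [exact: cn|exact: cf].
have fin s K : compact K -> (dens_meas (gs s) K < +oo)%E by exact: dens_meas_compact.
have pos h : Cc R d h -> (forall x, 0 <= h x) ->
    continuous (fun s => \int[dens_meas (gs s)]_x h x).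
  move=> Ch h0; apply: ratio_bound_continuous => [s|s t]; first exact: Rintegral_ge0.
  have ih u := Cc_integrable (fin u) Ch.
  have mh : measurable_fun setT (EFin \o h) by exact: (measurable_int _ (ih s)).
  have := @dens_integral_le (gs s) (gs t) `|s - t| (EFin \o h) (normr_ge0 _) _ mh _.
  have l x : gs s x <= gs t x + `|s - t|.
    by rewrite -lerBlDl; apply: le_trans (ler_norm _) (gs_lip _ _ _).
  move=> /(_ l) H; have {}H := H (fun x => h0 x).
  have fi v : (\int[dens_meas (gs v)]_x (h x)%:E)%E \is a fin_num.
    exact: (integrable_fin_num measurableT (ih v)).
  by have := H; rewrite -[X in (X <= _)%E](fineK (fi s)) -[X in (_ * X)%E](fineK (fi t)).
have -> : (fun s => \int[dens_meas (gs s)]_x f x) =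
    (fun s => \int[dens_meas (gs s)]_x `|f x| - \int[dens_meas (gs s)]_x (`|f x| - f x)).
  apply/funext => s; rewrite -RintegralB //.
  - by apply: eq_Rintegral => x _ /=; rewrite opprB addrC subrK.
  - exact: Cc_integrable (fin s) C1.
  - exact: Cc_integrable (fin s) C2.
move=> s; apply: (@continuousB _ R^o _ (fun s => \int[dens_meas (gs s)]_x `|f x|)).
  exact: pos.
by apply: pos => // x; rewrite subr_ge0 ler_norm.
Qed.

Lemma dens_radon_continuous : continuous (fun s => dens_radon (gs s) : radon R d).
Proof.
move=> s; apply/cvg_sup => -[f Cf] A [B [[W oW <-] Ws] WA].
apply: filterS WA _.
have := @dens_Rintegral_continuous f (set_mem Cf) s; apply.
by apply: open_nbhs_nbhs; split.
Qed.
End VagueContinuity.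

(** * A family of measures parametrized by the circle *)

Section TruncatedDistance.
Variables (R : realType) (d : nat) (G : set 'rV[R]_d).
Notation rV := 'rV[R]_d.
Hypotheses (sG : subgroup G) (cG : closed G).

Let dists (x : rV) : set R := [set Num.min 1 `|x - g| | g in G].

(** The truncation at 1 keeps functions built from the distance bounded; like
    the distance, it is continuous, [G]-periodic, and 0 exactly on [G]. *)
Definition tdist (x : rV) : R := inf (dists x).

Let min_ge0 (x g : rV) : 0 <= Num.min 1 `|x - g|.
Proof. by rewrite le_min ler01 normr_ge0. Qed.

Let dists_inf x : has_inf (dists x).
Proof.
split; first by exists (Num.min 1 `|x - 0|); exists 0 => //; case: sG.
by exists 0 => _ [g _ <-]; exact: min_ge0.
Qed.

Lemma tdist_le x g : G g -> tdist x <= Num.min 1 `|x - g|.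
Proof. by move=> Gg; apply: ge_inf; [exact: (dists_inf x).2|exists g]. Qed.

Lemma tdist_ge0 x : 0 <= tdist x.
Proof. by apply: lb_le_inf; [exact: (dists_inf x).1|move=> _ [g _ <-]; exact: min_ge0]. Qed.

Lemma tdist_le1 x : tdist x <= 1.
Proof.
have [G0 _] := sG; apply: le_trans (tdist_le x G0) _; by rewrite ge_min lexx.
Qed.

Lemma tdist_lip x y : tdist x <= tdist y + `|x - y|.
Proof.
rewrite -lerBlDr; apply: lb_le_inf; first exact: (dists_inf y).1.
move=> _ [g Gg <-]; rewrite lerBlDr; apply: le_trans (tdist_le x Gg) _.
have [y1|y1] := leP 1 `|y - g|.
  by rewrite ge_min lerDl normr_ge0.
rewrite ge_min; apply/orP; right.
by rewrite -[x](subrK y) -addrA [leRHS]addrC subrK ler_normD.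
Qed.

Lemma continuous_tdist : continuous tdist.
Proof.
move=> x A /nbhs_ballP[eps /= eps0 epsA]; apply/nbhs_ballP; exists eps => //= y xy.
have {}xy : `|x - y| < eps by move: xy; rewrite -ball_normE.
apply: epsA; rewrite -ball_normE /=; apply: le_lt_trans xy; rewrite ler_norml.
have h1 := tdist_lip x y; have h2 := tdist_lip y x; rewrite (distrC y x) in h2.
by apply/andP; split; lra.
Qed.

Lemma tdist_in x : G x -> tdist x = 0.
Proof.
move=> Gx; apply/eqP; rewrite eq_le tdist_ge0 andbT.
by apply: le_trans (tdist_le x Gx) _; rewrite subrr normr0 ge_min lexx orbT.
Qed.

Lemma tdist_eq0 x : tdist x = 0 -> G x.
Proof.
move=> dx; apply: cG => U /nbhs_ballP[e /= e0 eU].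
have m0 : 0 < Num.min 1 e by rewrite lt_min ltr01.
have [_ [g Gg <-]] := inf_adherent m0 (dists_inf x).
rewrite -/(tdist x) dx add0r lt_min => /andP[h1 h2].
exists g; split => //; apply: eU; rewrite -ball_normE /=.
by have [g1|g1] := leP 1 `|x - g|; [rewrite (min_idPl g1) ltxx in h1|rewrite (min_idPr (ltW g1)) in h2].
Qed.

Lemma tdistD x g : G g -> tdist (x + g) = tdist x.
Proof.
have [G0 GB] := sG.
have H y h : G h -> tdist (y + h) <= tdist y.
  move=> Gh; apply: lb_le_inf; first exact: (dists_inf y).1.
  move=> _ [k Gk <-]; apply: le_trans (tdist_le _ (subgroupD sG Gk Gh)) _.
  by rewrite opprD addrACA subrr addr0.
move=> Gg; apply/eqP; rewrite eq_le H //=.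
rewrite -[in X in X <= _](addrK g x); apply: H.
by rewrite -sub0r; apply: GB.
Qed.
End TruncatedDistance.

Section QuasiperiodicFamily.
Variables (R : realType) (d : nat) (G : set 'rV[R]_d).
Notation rV := 'rV[R]_d.
Notation SHG := (subharmonic_stab G).
Notation MG := (radon_stab G).
Hypotheses (hd : (2 <= d)%N) (sG : subgroup G) (cG : closed G) (dG : sgdim G = d.-1).
Variables (tau : {scalar rV}) (e : rV).
Hypotheses (tau_e : tau e = 1) (lspanE : forall x, (x \in lspan G) = (tau x == 0)).

Let proj (x : rV) : rV := x - tau x *: e.

(** The distance term and the term of period 1 in [tau] confine the stabilizer;
    the last term carries the parameter [th], and its period two pi in [tau] is
    incommensurable with 1, so that only [G] remains.  A shift by [e] leaves the
    first two terms unchanged and moves [th] by 1.  The constant 5 keeps the sum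
    above 1. *)
Definition qp_fun (th : R) (x : rV) : R :=
  5 + tdist G (proj x) + cos (pi *+ 2 * tau x) + cos (tau x + th).

Lemma continuous_qp_fun th : continuous (qp_fun th).
Proof.
have ct : continuous (tau : rV -> R) by exact: continuous_scalar.
have cc (h : R -> R) : continuous h -> continuous (fun x : rV => cos (h (tau x))).
  move=> ch x; apply: (@continuous_comp rV R R (fun x => h (tau x)) cos).
    by apply: (@continuous_comp rV R R tau h); [exact: ct|exact: ch].
  exact: continuous_cos.
have cp : continuous proj.
  move=> x; apply: (@continuousB R rV rV id (fun x => tau x *: e)); first by [].
  apply: (@continuous_comp rV R^o rV tau (fun r => r *: e)); first exact: ct.
  exact: scalel_continuous.
move=> x; rewrite /qp_fun.
apply: (@continuousD R R^o rV (fun x => 5 + tdist G (proj x) + cos (pi *+ 2 * tau x))); last first.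
  apply: (cc (fun t => t + th)) => t.
  by apply: (@continuousD R R^o R id (fun=> th)); [|exact: cst_continuous].
apply: (@continuousD R R^o rV (fun x => 5 + tdist G (proj x))); last first.
  by apply: (cc (fun t => pi *+ 2 * t)) => t; exact: mulrl_continuous.
apply: (@continuousD R R^o rV (fun=> 5)); first exact: cst_continuous.
apply: (@continuous_comp rV rV R proj (tdist G)); first exact: cp.
exact: continuous_tdist.
Qed.

Lemma qp_ge1 th x : 1 <= qp_fun th x.
Proof.
rewrite /qp_fun; have := tdist_ge0 sG (proj x).
have := cos_geN1 (pi *+ 2 * tau x); have := cos_geN1 (tau x + th); lra.
Qed.

Lemma qp_le th : exists C, forall x, qp_fun th x <= C.
Proof.
exists 8 => x; rewrite /qp_fun; have := tdist_le1 sG (proj x).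
have := cos_le1 (pi *+ 2 * tau x); have := cos_le1 (tau x + th); lra.
Qed.

Definition qp (th : R) : density R d :=
  Density (@continuous_qp_fun th) (qp_ge1 th) (qp_le th).

Lemma cos_lip (a b : R) : `|cos a - cos b| <= `|a - b|.
Proof.
wlog ab : a b / a <= b.
  by move=> H; have [/H//|/ltW /H] := leP a b; rewrite distrC [leRHS]distrC.
have [c _ E] := @MVT_segment _ cos (fun x => - sin x) a b ab
  (fun x _ => is_derive_cos x) (continuous_subspaceT (@continuous_cos R)).
rewrite distrC E normrM normrN [leRHS]distrC.
by rewrite ler_piMl // sin_max.
Qed.

Lemma qp_lip s t x : `|qp s x - qp t x| <= `|s - t|.
Proof.
have -> : qp s x - qp t x = cos (tau x + s) - cos (tau x + t).
  by rewrite /= /qp_fun; ring.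
apply: le_trans (cos_lip _ _) _.
by rewrite opprD addrACA subrr add0r.
Qed.

Lemma qp_shift th x : qp (th + 1) x = qp th (x + e).
Proof.
rewrite /= /qp_fun /proj raddfD /= tau_e.
have -> : x + e - (tau x + 1) *: e = x - tau x *: e.
  by rewrite scalerDl scale1r opprD addrACA subrr addr0.
by rewrite mulrDr mulr1 cosD2pi -[tau x + 1 + th]addrA (addrC 1 th).
Qed.

Lemma qp_periodic th x : qp (th + pi *+ 2) x = qp th x.
Proof. by rewrite /= /qp_fun addrA cosD2pi. Qed.

Lemma qp_invariant th r : G r -> forall x, qp th (x + r) = qp th x.
Proof.
move=> Gr x; rewrite /= /qp_fun /proj raddfD /= (tau_stab lspanE Gr) addr0.
by rewrite [x + r - _]addrAC (tdistD sG _ Gr).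
Qed.

Lemma cosB_eq (t s : R) : cos t - cos (t + s) = 2 * sin (s / 2) * sin (t + s / 2).
Proof.
have -> : t + s = (t + s / 2) + s / 2 by field.
rewrite -{1}(addrK (s / 2) t) cosB [cos (_ + s / 2 + s / 2)]cosD; ring.
Qed.

(** Comparing the values at [t *: e] and [t *: e + r], and then [t] with
    [t + 1], isolates the term of period two pi and gives [sin (s / 2) = 0] for
    [s = tau r]; then [t = 0] and [t = 1/2] give [cos (2 pi s) = 1] and put the
    projection of [r] at distance 0 from [G]. *)
Lemma qp_stab th r : (forall x, qp th (x + r) = qp th x) -> G r.
Proof.
move=> inv; pose s := tau r; pose w := proj r.
have key t : tdist G w = cos (pi *+ 2 * t) - cos (pi *+ 2 * t + pi *+ 2 * s) +
    (cos (t + th) - cos (t + th + s)).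
  have te : tau (t *: e) = t by rewrite linearZ /= tau_e mulr1.
  have ter : tau (t *: e + r) = t + s by rewrite raddfD /= te.
  have := inv (t *: e); rewrite /= /qp_fun /proj ter te.
  have -> : t *: e + r - (t + s) *: e = w.
    by rewrite /w /proj -/s scalerDl opprD addrACA subrr add0r.
  rewrite subrr (tdist_in sG (proj1 sG)) addr0 mulrDr -[t + s + th]addrAC.
  move=> E; lra.
have per t : cos (t + th + 1) - cos (t + th + 1 + s) = cos (t + th) - cos (t + th + s).
  have := key (t + 1); rewrite (key t) mulrDr mulr1 cosD2pi.
  rewrite -[_ + pi *+ 2 + _]addrAC cosD2pi -[t + 1 + th]addrAC => E; lra.
have s2 : sin (s / 2) = 0.
  have := per (- th - s / 2); rewrite !cosB_eq.
  have -> : - th - s / 2 + th = - (s / 2) by ring.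
  have -> : - (s / 2) + 1 + s / 2 = 1 by ring.
  rewrite addNr sin0 mulr0 => /eqP; rewrite mulf_eq0 [sin 1 == 0]gt_eqF; last first.
    by apply: sin2_gt0; rewrite ltr01 ltr1n.
  by rewrite orbF mulf_eq0 pnatr_eq0 /= => /eqP.
have key' t : tdist G w = cos (pi *+ 2 * t) - cos (pi *+ 2 * t + pi *+ 2 * s).
  by rewrite (key t) [cos (t + th) - _]cosB_eq s2 mulr0 mul0r addr0.
have w0 : tdist G w = 0 /\ cos (pi *+ 2 * s) = 1.
  have h0 := key' 0; have h1 := key' (1 / 2).
  rewrite mulr0 add0r cos0 in h0.
  have E : pi *+ 2 * (1 / 2) = pi :> R by rewrite -mulr_natr; field.
  rewrite E [pi + _]addrC cosDpi cospi in h1; split; lra.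
have sinpis : sin (pi * s) = 0.
  have := cosB_eq 0 (pi *+ 2 * s); rewrite add0r cos0 w0.2 subrr add0r.
  have -> : pi *+ 2 * s / 2 = pi * s by rewrite -mulr_natr; field.
  move=> /esym/eqP; rewrite -mulrA mulf_eq0 pnatr_eq0 /= mulf_eq0 orbb => /eqP //.
have s0 : s = 0 by exact: sin_half_sin_pi_eq0.
have -> : r = w by rewrite /w /proj -/s s0 scale0r subr0.
exact: (tdist_eq0 sG cG w0.1).
Qed.

Lemma qp_radon_stab th : stab (@radon_shift R d) (dens_radon (qp th)) = G.
Proof.
apply/seteqP; split => r; first by move/dens_radon_stab; exact: qp_stab.
by move=> Gr; apply/dens_radon_stab; exact: qp_invariant.
Qed.

Definition qp_radon (th : R) : MG :=
  exist _ (dens_radon (qp th)) (mem_set (qp_radon_stab th)).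

Lemma qp_radon_continuous : continuous qp_radon.
Proof.
apply: continuous_comp_initial.
exact: (@dens_radon_continuous R d qp qp_lip).
Qed.

Lemma qp_radon_shift th : \val (qp_radon (th + 1)) = radon_shift e (\val (qp_radon th)).
Proof. by rewrite /=; apply/esym; apply: dens_radon_shift => x; exact: qp_shift. Qed.

Lemma dens_radon_ext (g g' : density R d) : (forall x, g x = g' x) ->
  dens_radon g = dens_radon g'.
Proof.
move=> gg'; apply: radon_eqP => A mA /=; rewrite !dens_measE //.
by apply: eq_integral => x _; rewrite gg'.
Qed.

Lemma borel_measurableR (A : set R) : borel R A -> measurable (A : set (measurableTypeR R)).
Proof.
move: A; apply: smallest_sub; first exact: sigma_algebra_measurable.
by move=> A oA; exact: open_measurable.
Qed.

(** The height of [xi mu_th] is a Borel function of [th] on the circle of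
    length two pi.  Increasing [th] by 1 shifts [mu_th] by [e], so it lowers
    this function by 1, and no such function exists. *)
Lemma no_borel_equivariant_map (xi : MG -> SHG) : borel_map xi ->
  equivariant (@radon_shift R d) (@sh_shift R d) xi -> False.
Proof.
move=> bxi exi; pose F th := height tau (\val (xi (qp_radon th))).
apply: (@no_rotation_height R F).
- move=> a; apply: borel_measurableR.
  have bh := bxi _ (borel_height_stratum hd sG dG tau_e lspanE a).
  exact: (borel_preimage_continuous qp_radon_continuous bh).
- move=> th; rewrite /F; suff -> : qp_radon (th + pi *+ 2) = qp_radon th by [].
  by apply: val_inj => /=; apply: dens_radon_ext => x; exact: qp_periodic.
- move=> th; rewrite /F (exi _ _ _ (qp_radon_shift th)) height_shift ?tau_e //.
  exact: (stratum_good hd sG dG tau_e lspanE).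
Qed.
End QuasiperiodicFamily.

(** * Test functions and the Laplacian of a constant *)

Section PartialDerivatives.
Variables (R : realType) (d : nat).
Notation rV := 'rV[R]_d.
Implicit Types (F : rV -> R) (i : 'I_d).
Notation ev i := (delta_mx 0 i : rV).

Let line_quotient F (x v : rV) (t : R) :
  (fun h : R => h^-1 *: (((fun s : R => F (x + s *: v)) \o shift t) (h *: (1 : R)) - F (x + t *: v))) =
  (fun h : R => h^-1 *: ((F \o shift (x + t *: v)) (h *: v) - F (x + t *: v))).
Proof.
apply/funext => h /=; congr (_ *: (F _ - _)).
by rewrite [h *: 1]mulr1 scalerDl addrCA.
Qed.

Lemma derivable_line F (x v : rV) (t : R) : derivable F (x + t *: v) v <->
  derivable (fun s : R => F (x + s *: v)) t 1.
Proof. by rewrite /derivable line_quotient. Qed.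

Lemma derive_line F (x v : rV) (t : R) :
  'D_1 (fun s : R => F (x + s *: v)) t = 'D_v F (x + t *: v).
Proof. by rewrite /derive line_quotient. Qed.

Lemma partial_off F i x : ~ closure [set x | F x != 0] x -> partial i F x = 0.
Proof.
move=> nx; rewrite /partial.
have oF : open (~` closure [set x | F x != 0]) by apply: closed_openC; exact: closed_closure.
have nF : \forall y \near x, F y = cst 0 y.
  have : nbhs x (~` closure [set x | F x != 0]) by exact: open_nbhs_nbhs.
  by apply: filterS => y; exact: Cc_off.
by rewrite (near_eq_derive _ nF) derive_cst.
Qed.

Lemma partial_Cc F i : Cc R d F -> continuous (partial i F) -> Cc R d (partial i F).
Proof.
move=> [cF sF] cP; split => //; apply: (subclosed_compact _ sF); first exact: closed_closure.
rewrite [X in _ `<=` X]((closure_id _).1 (@closed_closure _ [set x | F x != 0])).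
apply: closureS => x /=; apply: contraPP => nx /eqP Px.
by apply: Px; exact: partial_off.
Qed.

(** The integral of [y |-> F (y + h *: ev i)] does not depend on [h];
    differentiation under the integral sign at [h = 0] gives the claim. *)
Lemma Rintegral_partial_eq0 F i : Cc R d F ->
  (forall x, derivable F x (ev i)) -> continuous (partial i F) ->
  \int[leb]_x partial i F x = 0.
Proof.
move=> CF dF cP; have CP := partial_Cc CF cP.
have [M PM] := Cc_bounded CP.
have [_ sF] := CF; have [B [Breal BP]] := compact_bounded sF.
pose rho : R := `|B| + 1 + `|ev i|.
pose K : set rV := [set z | `|z - 0| <= rho].
have cK : compact K by exact: compact_closed_ball_row.
have mK : measurable K by exact: compact_measurable_row.
have lebK (A : set rV) : compact A -> (leb A < +oo)%E by exact: leb_compact.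
pose f (h : R) (y : rV) := F (y + h *: ev i).
have M0 : 0 <= M by apply: le_trans (PM 0); exact: normr_ge0.
have mF : measurable_fun setT F by apply: continuous_measurable_row; case: CF.
have mE : measurable_fun setT (EFin \o F) by exact/measurable_EFinP.
have iF : leb.-integrable setT (EFin \o F) by exact: Cc_integrable lebK CF.
have If h : (\int[leb]_y (f h y)%:E = \int[leb]_y (F y)%:E)%E.
  exact: (integral_translate (h *: ev i) mE).
have intf h : leb.-integrable setT (EFin \o f h).
  apply/integrableP; split.
    by apply: (measurableT_comp mE); exact: measurable_translation.
  rewrite (ge0_integral_translate (h *: ev i) (f := fun y => `|(F y)%:E|%E)) //.
    by case/integrableP : iF.
  by apply: measurableT_comp.
have d1E h y : partial1of2 f h y = partial i F (y + h *: ev i).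
  by rewrite partial1of2E derive_line.
pose G (y : rV) : R := M * \1_K y.
have iG : leb.-integrable setT (EFin \o G).
  apply: (@integrableZl _ _ _ leb setT measurableT M (EFin \o \1_K)).
  have -> : EFin \o (\1_K : rV -> R) = (EFin \o (cst 1 : rV -> R)) \_ K.
    by apply/funext => x; rewrite /= patchE indicE; case: (x \in K).
  apply/(integrable_mkcond _ mK); apply: (@bounded_integrable _ _ _ leb K _ 1) => //.
    exact: lebK.
  by move=> x _; rewrite normr1.
have I0 : `]-1, 1[%classic (0 : R) by rewrite /= in_itv /= ltrN10 ltr01.
have E := @differentiation_under_integral R _ rV leb f setT measurableT 0 (-1) 1 I0
  (fun h _ => intf h) _ G _ iG _.
have {}E : (fun h => \int[leb]_y f h y)^`()%classic 0 = \int[leb]_y partial1of2 f 0 y.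
  apply: E.
  - move=> h y _ _; apply/derivable_line; exact: dF.
  - by move=> y; rewrite /G mulr_ge0 // indicE; case: (_ \in _).
  move=> h y /=; rewrite in_itv /= => /andP[h1 h2] _; rewrite d1E /G indicE.
  have [yK|yK] := boolP (y \in K); first by rewrite mulr1.
  rewrite mulr0 partial_off ?normr0 // => cl.
  have : `|y + h *: ev i| <= `|B| + 1.
    by apply: (BP _ _ _ cl); rewrite (le_lt_trans (ler_norm B)) // ltrDl.
  move=> yh; move: yK; rewrite notin_setE; apply.
  rewrite /K /= subr0 -[y](addrK (h *: ev i)); apply: le_trans (ler_normB _ _) _.
  rewrite /rho lerD // normrZ ler_piMl // ler_norml; apply/andP; split; exact: ltW.
have <- : \int[leb]_y partial1of2 f 0 y = \int[leb]_x partial i F x.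
  by apply: eq_Rintegral => y _; rewrite d1E scale0r addr0.
rewrite -E (_ : (fun h => _) = cst (\int[leb]_y F y)); first by rewrite derive1_cst.
by apply/funext => h; rewrite /Rintegral If.
Qed.
End PartialDerivatives.

Section FlatFunctions.
Variable R : realType.
Implicit Types p : {poly R}.

(** The functions [p(1/x) exp(-1/x)], extended by 0 to [x <= 0]: a family stable
    under derivation, so that all its members are smooth. *)
Definition flat p (x : R) : R := if 0 < x then p.[x^-1] * expR (- x^-1) else 0.

(** With [y = 1/x], the derivative of [p(y) exp(-y)] with respect to [x] is
    [y^2 (p(y) - p'(y)) exp(-y)]. *)
Definition flat_deriv p : {poly R} := 'X^2 * (p - p^`()).

Lemma pow_le_expR (y : R) (m : nat) : 0 <= y -> (y / m.+1%:R) ^+ m.+1 <= expR y.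
Proof.
move=> y0; have m0 : (m.+1%:R : R) != 0 by rewrite pnatr_eq0.
have -> : expR y = expR (y / m.+1%:R) ^+ m.+1 by rewrite -expRM_natl mulrC divfK.
rewrite lerXn2r ?nnegrE ?expR_ge0 ?divr_ge0 //.
by apply: le_trans (expR_ge1Dx _); rewrite lerDr.
Qed.

Lemma horner_bound p : exists2 A : R, 0 <= A & forall y, 1 <= y -> `|p.[y]| <= A * y ^+ size p.
Proof.
exists (\sum_(i < size p) `|p`_i|); first exact: sumr_ge0.
move=> y y1; rewrite horner_coef mulr_suml; apply: le_trans (ler_norm_sum _ _ _) _.
apply: ler_sum => i _; rewrite normrM ler_wpM2l // normrX ger0_norm ?(le_trans ler01) //.
by apply: ler_weXn2l => //; exact: ltnW.
Qed.

(** With [y = 1/x], the exponential dominates [y ^+ (size p + 2)]; the exponent 2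
    on the right gives differentiability at 0. *)
Lemma flat_bound p : exists2 C : R, 0 <= C & forall x, `|x| <= 1 -> `|flat p x| <= C * x ^+ 2.
Proof.
have [A A0 Ap] := horner_bound p; set n := size p in Ap.
pose m : R := n.+2%:R.
exists (A * m ^+ n.+2); first by rewrite mulr_ge0 // exprn_ge0.
move=> x x1; rewrite /flat; case: ifPn => [x0|_]; last first.
  by rewrite normr0 mulr_ge0 ?sqr_ge0 // mulr_ge0 // exprn_ge0.
pose y := x^-1; have y1 : 1 <= y.
  by rewrite /y -invr1 lef_pV2 ?posrE //; exact: le_trans (ler_norm x) x1.
have y0 : 0 < y by exact: lt_le_trans ltr01 y1.
have m0 : 0 < m by [].
rewrite -/y normrM (ger0_norm (expR_ge0 _)) expRN.
have eb : (y / m) ^+ n.+2 <= expR y by apply: pow_le_expR; exact: ltW.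
have -> : x ^+ 2 = y ^+ n / y ^+ n.+2.
  by rewrite -[n.+2]addn2 exprD invfM mulrA divff ?expf_neq0 ?gt_eqF // mul1r /y exprVn invrK.
apply: (@le_trans _ _ (A * y ^+ n * (m ^+ n.+2 / y ^+ n.+2))).
  apply: ler_pM => //; first exact: Ap.
  rewrite -invf_div -expr_div_n lef_pV2 ?posrE ?expR_gt0 //.
  by rewrite exprn_gt0 // divr_gt0.
by rewrite le_eqVlt; apply/orP; left; apply/eqP; ring.
Qed.

Lemma is_derive_flat p (x : R) : is_derive x 1 (flat p) (flat (flat_deriv p) x).
Proof.
have [x0|x0|->] := ltgtP x 0.
- have nx : \forall y \near x, cst 0 y = flat p y.
    have : nbhs x `]-oo, (0 : R)[%classic.
      by apply: open_nbhs_nbhs; split; [exact: interval_open|rewrite /= in_itv].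
    by apply: filterS => y; rewrite /= in_itv /= /flat => y0; rewrite ltNge (ltW y0).
  apply: near_eq_is_derive nx _.
  by rewrite /flat ltNge (ltW x0) /=; exact: is_derive_cst.
- have nx : \forall y \near x, ((horner p \o (fun y => y^-1)) * (expR \o (fun y => - y^-1))) y = flat p y.
    have : nbhs x `](0 : R), +oo[%classic.
      by apply: open_nbhs_nbhs; split; [exact: interval_open|rewrite /= in_itv /= x0].
    by apply: filterS => y; rewrite /= in_itv /= andbT /flat => ->.
  apply: near_eq_is_derive nx _.
  have x0' : x != 0 by rewrite gt_eqF.
  have dV : is_derive x (1 : R) (fun y : R => y^-1) (- x ^- 2 *: (1 : R)).
    by apply: (@is_deriveV _ id); exact: x0'.
  have dN : is_derive x (1 : R) (fun y : R => - y^-1) (- (- x ^- 2 *: (1 : R))).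
    exact: is_deriveN.
  have d1 := is_derive1_comp (is_derive_poly p x^-1) dV.
  have d2 := @is_derive1_comp R expR (fun y => - y^-1) x _ _ (is_derive_expR (- x^-1)) dN.
  have [d12 d12E] := is_deriveM d1 d2.
  apply: DeriveDef; first exact: d12.
  rewrite [LHS]d12E.
  rewrite /flat x0 /flat_deriv hornerM hornerXn hornerD hornerN /=.
  by rewrite /GRing.scale /= -exprVn; ring.
have [C C0 Cp] := flat_bound p.
have -> : flat (flat_deriv p) 0 = 0 by rewrite /flat ltxx.
have lim0 : h^-1 *: ((flat p \o shift 0) (h *: (1 : R)) - flat p 0) @[h --> 0^'] --> (0 : R).
  apply/cvgrPdist_lt => eps eps0.
  have e0 : 0 < Num.min 1 (eps / (C + 1)) by rewrite lt_min ltr01 divr_gt0 // ltr_wpDl.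
  near=> h.
  have : `|h| < Num.min 1 (eps / (C + 1)) by near: h; exact: dnbhs0_lt.
  have h0 : h != 0 by near: h; exact: nbhs_dnbhs_neq.
  rewrite lt_min ltr_pdivlMr ?ltr_wpDl // => /andP[h1 h2].
  rewrite /= addr0 {2}/flat ltxx subr0 sub0r normrN /GRing.scale /= mulr1 normrM normfV.
  have hn : 0 < `|h| by rewrite normr_gt0.
  rewrite mulrC ltr_pdivrMr //; apply: le_lt_trans (Cp h (ltW h1)) _.
  rewrite -(real_normK (num_real h)) expr2 mulrA ltr_pM2r //; nra.
split; first by apply/cvg_ex; exists 0.
exact/cvg_lim.
Unshelve. all: by end_near. Qed.

Lemma continuous_flat p : continuous (flat p).
Proof.
move=> x; apply/differentiable_continuous/derivable1_diffP.
by case: (is_derive_flat p x).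
Qed.
End FlatFunctions.

Section Bump.
Variables (R : realType) (d : nat).
Notation rV := 'rV[R]_d.
Notation ev i := (delta_mx 0 i : rV).

Definition paraboloid (x : rV) : R := 1 - \sum_j x 0 j ^+ 2.

(** A class of continuous functions stable under partial derivatives, and hence
    made of functions of class C^k for all k. *)
Inductive bumpy : (rV -> R) -> Prop :=
| bumpy_flat p : bumpy (fun x => flat p (paraboloid x))
| bumpy_coord j : bumpy (fun x => x 0 j)
| bumpy_cst c : bumpy (fun=> c)
| bumpy_add f g : bumpy f -> bumpy g -> bumpy (fun x => f x + g x)
| bumpy_mul f g : bumpy f -> bumpy g -> bumpy (fun x => f x * g x).

Lemma continuous_paraboloid : continuous paraboloid.
Proof.
move=> x; apply: (@continuousB R R^o rV (fun=> 1) (fun x => \sum_j x 0 j ^+ 2)).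
  exact: cst_continuous.
apply: (@continuous_sumr R R^o _ _ (fun i (x : rV) => x 0 i ^+ 2)) => i {}x.
apply: (@continuous_comp _ _ _ (fun x : rV => x 0 i) (fun r => r ^+ 2)).
  exact: continuous_coord.
exact: exprn_continuous.
Qed.

Lemma paraboloid_line (x : rV) i (s : R) :
  paraboloid (x + s *: ev i) = ((paraboloid x)%:P - (2 * x 0 i)%:P * 'X - 'X^2).[s].
Proof.
rewrite !hornerE /paraboloid (bigD1 i) //= [\sum_j x 0 j ^+ 2](bigD1 i) //= !mxE !eqxx.
rewrite (eq_bigr (fun j => x 0 j ^+ 2)) => [|j /negbTE ji]; first by rewrite mulr1; ring.
by rewrite !mxE ji andbF mulr0 addr0.
Qed.

Lemma is_derive_of_line (f : rV -> R) (x : rV) i (a : R) :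
  is_derive (0 : R) 1 (fun s : R => f (x + s *: ev i)) a -> is_derive x (ev i) f a.
Proof.
move=> [df dE]; have x0 : x + 0 *: ev i = x by rewrite scale0r addr0.
apply: DeriveDef; first by rewrite -x0; apply/derivable_line.
by rewrite -[in LHS]x0 -derive_line.
Qed.

Lemma is_derive_flat_paraboloid p (x : rV) i :
  is_derive x (ev i) (fun x => flat p (paraboloid x))
    (flat (flat_deriv p) (paraboloid x) * (- 2 * x 0 i)).
Proof.
apply: is_derive_of_line.
rewrite (_ : (fun s : R => _) = flat p \o
    horner ((paraboloid x)%:P - (2 * x 0 i)%:P * 'X - 'X^2)); last first.
  by apply/funext => s /=; rewrite paraboloid_line.
pose q : {poly R} := (paraboloid x)%:P - (2 * x 0 i)%:P * 'X - 'X^2; rewrite -/q.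
have q0 : q.[0] = paraboloid x by rewrite /q !hornerE; ring.
have dq0 : q^`().[0] = - 2 * x 0 i.
  rewrite /q derivB derivB derivC derivM derivC derivX derivXn !hornerE /=; ring.
by rewrite -q0 -dq0; apply: is_derive1_comp; exact: is_derive_flat.
Qed.

Lemma is_derive_coord (x : rV) i j : is_derive x (ev i) (fun x => x 0 j) ((i == j)%:R : R).
Proof.
apply: is_derive_of_line.
rewrite (_ : (fun s : R => _) = horner ((x 0 j)%:P + ((i == j)%:R)%:P * 'X)); last first.
  by apply/funext => s /=; rewrite !mxE !hornerE /= mulrC eq_sym.
have := is_derive_poly ((x 0 j)%:P + ((i == j)%:R)%:P * 'X) (0 : R).
by rewrite derivD derivC derivM derivC derivX mul0r !add0r mulr1 hornerC.
Qed.

Lemma bumpy_partial f i : bumpy f ->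
  exists2 g, bumpy g & forall x, is_derive x (ev i) f (g x).
Proof.
elim=> [p|j|c|f1 f2 _ [g1 b1 d1] _ [g2 b2 d2]|f1 f2 h1 [g1 b1 d1] h2 [g2 b2 d2]].
- exists (fun x => flat (flat_deriv p) (paraboloid x) * (- 2 * x 0 i)).
    apply: bumpy_mul; first exact: bumpy_flat.
    by apply: bumpy_mul; [exact: bumpy_cst|exact: bumpy_coord].
  by move=> x; exact: is_derive_flat_paraboloid.
- by exists (fun=> (i == j)%:R); [exact: bumpy_cst|move=> x; exact: is_derive_coord].
- by exists (fun=> 0); [exact: bumpy_cst|move=> x; exact: is_derive_cst].
- exists (fun x => g1 x + g2 x); first exact: bumpy_add.
  by move=> x; exact: (is_deriveD (d1 x) (d2 x)).
- exists (fun x => f1 x * g2 x + f2 x * g1 x).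
    by apply: bumpy_add; apply: bumpy_mul.
  by move=> x; exact: (is_deriveM (d1 x) (d2 x)).
Qed.

Lemma bumpy_continuous f : bumpy f -> continuous f.
Proof.
elim=> [p|j|c|f1 f2 _ c1 _ c2|f1 f2 _ c1 _ c2].
- move=> x; apply: (@continuous_comp rV R R paraboloid (flat p)).
    exact: continuous_paraboloid.
  exact: continuous_flat.
- exact: continuous_coord.
- by move=> x; exact: cst_continuous.
- by move=> x; apply: (@continuousD R R^o rV f1 f2); [exact: c1|exact: c2].
- by move=> x; apply: (@continuousM R rV f1 f2); [exact: c1|exact: c2].
Qed.

Lemma bumpy_derivable f i x : bumpy f -> derivable f x (ev i).
Proof. by move=> /(bumpy_partial i)[g _ /(_ x)[]]. Qed.

Lemma bumpy_partialE f i : bumpy f -> bumpy (partial i f).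
Proof.
move=> /(bumpy_partial i)[g bg dg].
by rewrite (_ : partial i f = g) //; apply/funext => x; by have [_ dE] := dg x; rewrite -dE.
Qed.

Lemma bumpy_Ck k f : bumpy f -> Ck k f.
Proof.
elim: k f => [|k IHk] f bf; split => //; try exact: bumpy_continuous.
move=> i; split; first by move=> x; exact: bumpy_derivable.
by apply: IHk; exact: bumpy_partialE.
Qed.

(** The standard smooth function [exp (- 1 / (1 - |x|^2))] on the unit ball. *)
Definition bump (x : rV) : R := flat 1 (paraboloid x).

Lemma bump_ge0 x : 0 <= bump x.
Proof. by rewrite /bump /flat; case: ifP => // _; rewrite hornerC mul1r expR_ge0. Qed.

Lemma bump0 : 0 < bump 0.
Proof.
rewrite /bump /flat /paraboloid big1 ?subr0 ?ltr01 => [|j _]; last by rewrite mxE expr0n.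
by rewrite hornerC mul1r expR_gt0.
Qed.

Lemma bumpy_bump : bumpy bump. Proof. exact: bumpy_flat. Qed.

Lemma Cc_bump : Cc R d bump.
Proof.
split; first exact: bumpy_continuous bumpy_bump.
apply: (subclosed_compact _ (@compact_closed_ball_row R d 0 1)); first exact: closed_closure.
have cl : closed [set z : rV | `|z - 0| <= 1].
  by apply: compact_closed; [exact: norm_hausdorff|exact: compact_closed_ball_row].
rewrite [X in _ `<=` X]((closure_id _).1 cl); apply: closureS => x /=.
rewrite /bump /flat subr0; case: ifPn; rewrite ?eqxx // => px _.
apply: le_trans (norm_le_enorm x) _; rewrite /enorm -sqrtr1 ler_wsqrtr //.
by move: px; rewrite /paraboloid subr_gt0 => /ltW.
Qed.

Lemma bump_smooth : Cc_smooth bump.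
Proof.
by split; [move=> k; apply: bumpy_Ck; exact: bumpy_bump|case: Cc_bump].
Qed.

Lemma laplacian_bump_integral0 :
  leb.-integrable setT (EFin \o laplacian bump) /\
  \int[leb]_x laplacian bump x = 0.
Proof.
have CP i : Cc R d (partial i bump).
  by apply: (partial_Cc Cc_bump); apply: bumpy_continuous; apply: bumpy_partialE; exact: bumpy_bump.
have bP i : bumpy (partial i bump) by apply: bumpy_partialE; exact: bumpy_bump.
have CPP i : Cc R d (partial i (partial i bump)).
  by apply: (partial_Cc (CP i)); apply: bumpy_continuous; exact: bumpy_partialE.
have iP i : leb.-integrable setT (EFin \o partial i (partial i bump)).
  by apply: Cc_integrable => //; exact: leb_compact.
have sum0 (s : seq 'I_d) :
    leb.-integrable setT (EFin \o (fun x => \sum_(i <- s) partial i (partial i bump) x)) /\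
    \int[leb]_x (\sum_(i <- s) partial i (partial i bump) x) = 0.
  elim: s => [|i s [IH1 IH2]].
    under [X in leb.-integrable _ (EFin \o X)]eq_fun do rewrite big_nil.
    under eq_Rintegral do rewrite big_nil.
    split; first exact: integrable0.
    by rewrite /Rintegral integral0.
  have -> : (fun x => \sum_(j <- i :: s) partial j (partial j bump) x) =
      (fun x => partial i (partial i bump) x + \sum_(j <- s) partial j (partial j bump) x).
    by apply/funext => x; rewrite big_cons.
  split; first exact: (integrableD measurableT (iP i) IH1).
  rewrite RintegralD // IH2 addr0; apply: Rintegral_partial_eq0 => //.
    by move=> x; exact: bumpy_derivable.
  by apply: bumpy_continuous; exact: bumpy_partialE.
exact: (sum0 (index_enum 'I_d)).
Qed.

Lemma leb_le_dens (g : density R d) A : measurable A -> (leb A <= dens_meas g A)%E.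
Proof.
move=> mA; rewrite dens_measE // -[leLHS]mul1e -integral_cst //.
apply: ge0_le_integral => //.
- by apply: measurable_funTS; exact: measurable_dens.
- by move=> x _; rewrite lee_fin dens_ge1.
Qed.

Lemma Rintegral_dens_bump_gt0 (g : density R d) : 0 < \int[dens_meas g]_x bump x.
Proof.
pose c := bump 0 / 2; have c0 : 0 < c by rewrite divr_gt0 // bump0.
pose U := [set x : rV | c < bump x].
have oU : open U.
  apply: (@open_comp _ _ bump [set t | c < t]); last exact: open_gt.
  by move=> x _; exact: (bumpy_continuous bumpy_bump).
have mU : measurable U by exact: open_measurable_row.
have U0 : (0 < leb U)%E.
  apply: leb_open_gt0 => //; exists 0; rewrite /U /= /c ltr_pdivrMr // ltr_pMr ?bump0 //.
  by rewrite ltr1n.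
have mb : measurable_fun setT (EFin \o bump).
  by apply/measurable_EFinP; apply: continuous_measurable_row; case: Cc_bump.
have ib := Cc_integrable (@dens_meas_compact _ _ g) Cc_bump.
rewrite /Rintegral fine_gt0 //; apply/andP; split; last first.
  by rewrite ltey_eq (integrable_fin_num measurableT ib).
apply: (@lt_le_trans _ _ (\int[dens_meas g]_(x in U) c%:E)%E).
  rewrite integral_cst // mule_gt0 //.
  exact: lt_le_trans U0 (leb_le_dens g mU).
apply: (@le_trans _ _ (\int[dens_meas g]_(x in U) (bump x)%:E)%E).
  apply: ge0_le_integral => //.
  - by move=> x _; rewrite lee_fin ltW.
  - exact: measurable_funTS.
  - by move=> x /ltW; rewrite lee_fin.
by apply: ge0_subset_integral => // x _; rewrite lee_fin bump_ge0.
Qed.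

(** The Laplacian of the bump integrates to 0, whereas a measure with density
    at least 1 gives the bump a positive integral. *)
Lemma const_not_potential (u : subharmonic R d) (c : R) (g : density R d) :
  (forall x, u x = c%:E) -> ~ dist_laplacian u (dens_radon g).
Proof.
move=> uc /(_ bump bump_smooth).
have -> : \int[leb]_x (fine (u x) * laplacian bump x) = 0.
  have [ib b0] := laplacian_bump_integral0.
  under eq_Rintegral do rewrite uc.
  by rewrite RintegralZl // b0 mulr0.
by move=> E; have := Rintegral_dens_bump_gt0 g; rewrite -E ltxx.
Qed.
End Bump.

(** * Subgroups of full dimension *)

Section FullDimension.
Variables (R : realType) (d : nat) (G : set 'rV[R]_d).
Hypotheses (sG : subgroup G) (cG : closed G).

Let gfun (x : 'rV[R]_d) : R := 1 + tdist G x.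

Let continuous_gfun : continuous gfun.
Proof.
move=> x; apply: (@continuousD R R^o 'rV[R]_d (fun=> 1) (tdist G)).
  exact: cst_continuous.
exact: continuous_tdist.
Qed.

Let gfun_ge1 x : 1 <= gfun x.
Proof. by rewrite lerDl; exact: tdist_ge0. Qed.

Let gfun_le : exists C, forall x, gfun x <= C.
Proof. by exists (1 + 1) => x; rewrite lerD2l; exact: tdist_le1. Qed.

(** A density bounded below and periodic exactly under [G]. *)
Definition tdist_density : density R d := Density continuous_gfun gfun_ge1 gfun_le.

Lemma tdist_radon_stab : stab (@radon_shift R d) (dens_radon tdist_density) = G.
Proof.
apply/seteqP; split => r.
  move=> /dens_radon_stab /(_ 0); rewrite add0r /= /gfun => /addrI tr.
  by apply: (tdist_eq0 sG cG); rewrite tr; apply: tdist_in => //; case: sG.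
by move=> Gr; apply/dens_radon_stab => x; rewrite /= /gfun tdistD.
Qed.

(** A function with stabilizer [G] would be constant, so its Laplacian cannot be
    the measure with density [1 + tdist G]. *)
Lemma no_potential_full_dim (xi : radon_stab G -> subharmonic_stab G) :
  sgdim G = d -> ~ forall mu, dist_laplacian (\val (xi mu)) (\val mu).
Proof.
move=> dG Dxi.
pose mu : radon_stab G := exist _ (dens_radon tdist_density) (mem_set tdist_radon_stab).
have := Dxi mu; set u := xi mu => Du.
have [c uc] : exists c, forall x, \val u x = c%:E.
  by apply/stab_full_dimP; rewrite stratum_stab.
exact: (const_not_potential uc Du).
Qed.
End FullDimension.

(** * The theorem *)

Theorem theorem7p9 (R : realType) (d : nat) (G : set 'rV[R]_d)
    (hd : (2 <= d)%N) (Gsub : subgroup G) (Gclosed : closed G)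
    (Gdim : (d.-1 <= sgdim G)%N) :
  [/\ ~ exists xi : radon_stab G -> subharmonic_stab G,
        [/\ borel_map xi,
            equivariant (@radon_shift R d) (@sh_shift R d) xi
          & forall mu : radon_stab G, dist_laplacian (\val (xi mu)) (\val mu)],
      sgdim G = d.-1 ->
        exists S : set (subharmonic_stab G),
          borel_transversal (@sh_shift R d) S
    & forall u : subharmonic R d,
        sgdim (stab (@sh_shift R d) u) = d <-> exists c : R, forall x, u x = c%:E].
Proof.
have d0 : (0 < d)%N by exact: ltnW.
have dimGd : (sgdim G <= d)%N by rewrite -{2}(@dim_rV R d) dimvS ?subvf.
split; last by move=> u; exact: stab_full_dimP.
- move=> [xi [bxi exi Dxi]].
  have [dG|dG] := eqVneq (sgdim G) d; first exact: (no_potential_full_dim Gsub Gclosed dG Dxi).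
  have {}dG : sgdim G = d.-1.
    by apply/eqP; rewrite eqn_leq Gdim andbT -ltnS prednK // ltn_neqAle dG.
  have [tau [e [tau_e lspanE]]] := codim1_functional d0 dG.
  exact: (no_borel_equivariant_map hd Gsub Gclosed dG tau_e lspanE bxi exi).
- move=> dG; have [tau [e [tau_e lspanE]]] := codim1_functional d0 dG.
  exact: (transversal_exists hd Gsub dG tau_e lspanE).
Qed.
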